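(* Let $\Omega\subset\mathbb{C}$ be a bounded domain, $E\to\Omega$ a holomorphic vector bundle of rank $r$, and $h$ a smooth Hermitian metric on $E$. Assume that for every $a\in\Omega$ there exist $\gamma_a\in(0,\delta(a))$ and a lower semi-continuous function $g_a\colon[0,\gamma_a]\to\mathbb{R}_{\geq0}$ such that $L_h(a,\rho,\xi)\leq e^{-g_a(\rho)\rho^2}$ for every $\xi\in E_a\setminus\{0\}$ and every $\rho\in(0,\gamma_a)$. Then for every $a\in\Omega$, $$\sqrt{-1}\Theta_h(a)\geq 2g_a(0)\,\omega\otimes\mathrm{Id}_E,$$ i.e. $\langle\Theta_{h,z\bar z}(a)\xi,\xi\rangle_{h(a)}\geq 2g_a(0)|\xi|^2_{h(a)}$ for all $\xi\in E_a$, where $\sqrt{-1}\Theta_h=\sqrt{-1}\,\Theta_{h,z\bar z}\,\mathrm{d}z\wedge\mathrm{d}\bar z$ is the Chern curvature of $(E,h)$ and $\omega=\sqrt{-1}\,\mathrm{d}z\wedge\mathrm{d}\bar z$.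
   Context: For $a\in\mathbb{C}$, $\rho>0$: $\Delta(a;\rho)=\{|z-a|<\rho\}$; $\delta(a)=\sup\{\rho>0\mid\Delta(a;\rho)\subset\Omega\}$; $\Omega_\delta=\{(a,\rho)\in\Omega\times\mathbb{R}\mid 0<\rho<\delta(a)\}$. For a holomorphic vector bundle $\pi\colon E\to\Omega$ with smooth Hermitian metric $h$, $A^2(\Delta(a;\rho),h)$ is the space of holomorphic sections $s$ of $E$ over $\Delta(a;\rho)$ with $\int_{\Delta(a;\rho)}|s|_h^2<\infty$ (Lebesgue measure). The $L^2$-extension index of $h$ is defined for $(a,\rho)\in\Omega_\delta$ and $\xi\in E_a\setminus\{0\}$ by $$L_h(a,\rho,\xi)=\inf\left\{\frac{\int_{\Delta(a;\rho)}|s|^2_h}{\pi\rho^2|\xi|^2_{h(a)}}\ \middle|\ s\in A^2(\Delta(a;\rho),h),\ s(a)=\xi\right\}.$$ *)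

(* Defs.v *)
From HB Require Import structures.
From mathcomp Require Import all_boot all_order all_algebra.
From mathcomp Require Import complex.
From mathcomp Require Import all_classical all_reals all_analysis.

Set Implicit Arguments.
Unset Strict Implicit.
Unset Printing Implicit Defensive.

Import Order.TTheory GRing.Theory Num.Theory.
Local Open Scope classical_set_scope.
Local Open Scope ring_scope.
Local Open Scope complex_scope.

Section Defs.
Variable R : realType.
Local Notation C := R[i].

Definition disc (a : C) (rho : R) : set C := [set z | `|z - a| < rho%:C].

Definition open_set (U : set C) : Prop :=
  forall z, U z -> exists e : R, 0 < e /\ disc z e `<=` U.

Definition connected_set (U : set C) : Prop :=
  forall A B : set C, open_set A -> open_set B ->
    U `<=` A `|` B -> U `&` A `&` B = set0 ->
    U `&` A = set0 \/ U `&` B = set0.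

Definition bounded_set (U : set C) : Prop :=
  exists M : R, forall z, U z -> `|z| <= M%:C.

Definition bounded_domain (U : set C) : Prop :=
  U !=set0 /\ open_set U /\ connected_set U /\ bounded_set U.

Definition bdist (Om : set C) (a : C) : R :=
  sup [set rho : R | 0 < rho /\ disc a rho `<=` Om].

Definition is_cderiv (f : C -> C) (z c : C) : Prop :=
  forall e : R, 0 < e -> exists d : R, 0 < d /\
    forall w : C, 0 < `|w - z| -> `|w - z| < d%:C ->
      `|(f w - f z) / (w - z) - c| < e%:C.

Definition holo_on (U : set C) (f : C -> C) : Prop :=
  forall z, U z -> exists c, is_cderiv f z c.

Definition is_dderiv (f : C -> C) (v z l : C) : Prop :=
  forall e : R, 0 < e -> exists d : R, 0 < d /\
    forall t : R, 0 < `|t| -> `|t| < d ->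
      `|(f (z + t%:C * v) - f z) / t%:C - l| < e%:C.

(* the partial derivative (chosen via choice; 0 where it does not exist) *)
Definition dderiv (f : C -> C) (v : C) : C -> C :=
  fun z => xget 0 [set l | is_dderiv f v z l].

Definition dirC (b : bool) : C := if b then 'i else 1.

Fixpoint diter (l : seq bool) (f : C -> C) : C -> C :=
  match l with
  | [::] => f
  | b :: l' => dderiv (diter l' f) (dirC b)
  end.

Definition cont_at_in (U : set C) (f : C -> C) (z : C) : Prop :=
  forall e : R, 0 < e -> exists d : R, 0 < d /\
    forall w, U w -> `|w - z| < d%:C -> `|f w - f z| < e%:C.

Definition smooth_on (U : set C) (f : C -> C) : Prop :=
  forall l : seq bool, forall z, U z ->
    (forall b, exists d, is_dderiv (diter l f) (dirC b) z d) /\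
    cont_at_in U (diter l f) z.

Definition dz (f : C -> C) : C -> C :=
  fun z => (dderiv f 1 z - 'i * dderiv f 'i z) / 2%:R.
Definition dzb (f : C -> C) : C -> C :=
  fun z => (dderiv f 1 z + 'i * dderiv f 'i z) / 2%:R.

Definition dz_mx (r : nat) (F : C -> 'M[C]_r) : C -> 'M[C]_r :=
  fun z => \matrix_(j, k) dz (fun w => F w j k) z.
Definition dzb_mx (r : nat) (F : C -> 'M[C]_r) : C -> 'M[C]_r :=
  fun z => \matrix_(j, k) dzb (fun w => F w j k) z.

Definition adjmx (m n : nat) (A : 'M[C]_(m, n)) : 'M[C]_(n, m) :=
  (map_mx conjc A)^T.

(* A holomorphic vector bundle of rank r over Om, given by an open cover
   (U_i) of Om and holomorphic transition functions g_ij : U_i ∩ U_j -> GL_r(C)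
   satisfying the cocycle condition; a local section is a family (s_i) with
   s_i = g_ij s_j.  [hb_sel z] is a chosen chart containing z. *)
Record holo_bundle (Om : set C) (r : nat) := HoloBundle {
  hb_idx : Type;
  hb_U : hb_idx -> set C;
  hb_g : hb_idx -> hb_idx -> C -> 'M[C]_r;
  hb_sel : C -> hb_idx;
  hb_U_open : forall i, open_set (hb_U i);
  hb_U_sub : forall i, hb_U i `<=` Om;
  hb_selP : forall z, Om z -> hb_U (hb_sel z) z;
  hb_g_holo : forall i j (p q : 'I_r),
      holo_on (hb_U i `&` hb_U j) (fun z => hb_g i j z p q);
  hb_g_id : forall i z, hb_U i z -> hb_g i i z = 1%:M;
  hb_g_cocycle : forall i j k z, hb_U i z -> hb_U j z -> hb_U k z ->
      hb_g i j z *m hb_g j k z = hb_g i k z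
}.
Arguments hb_idx {Om r} h.
Arguments hb_U {Om r} h i.
Arguments hb_g {Om r} h i j.
Arguments hb_sel {Om r} h z.

Variables (Om : set C) (r : nat) (E : holo_bundle Om r).

Definition holo_section (V : set C) (s : hb_idx E -> C -> 'cV[C]_r) : Prop :=
  (forall i (p : 'I_r), holo_on (hb_U E i `&` V) (fun z => s i z p ord0)) /\
  (forall i j z, hb_U E i z -> hb_U E j z -> V z ->
      s i z = hb_g E i j z *m s j z).

(* smooth Hermitian metric: H_i on U_i, <u,v>_{h} = v^* H_i u in frame i *)
Definition herm_metric (H : hb_idx E -> C -> 'M[C]_r) : Prop :=
  (forall i (p q : 'I_r), smooth_on (hb_U E i) (fun z => H i z p q)) /\
  (forall i z, hb_U E i z -> adjmx (H i z) = H i z) /\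
  (forall i z, hb_U E i z -> forall v : 'cV[C]_r, v != 0 ->
      0 < (adjmx v *m H i z *m v) ord0 ord0) /\
  (forall i j z, hb_U E i z -> hb_U E j z ->
      H j z = adjmx (hb_g E i j z) *m H i z *m hb_g E i j z).

(* <u, v>_{h(z)} in the chosen frame at z (u, v coordinates in that frame) *)
Definition hinner (H : hb_idx E -> C -> 'M[C]_r) (z : C) (u v : 'cV[C]_r) : C :=
  (adjmx v *m H (hb_sel E z) z *m u) ord0 ord0.

Definition sec_sqnorm (H : hb_idx E -> C -> 'M[C]_r)
  (s : hb_idx E -> C -> 'cV[C]_r) (z : C) : R :=
  complex.Re (hinner H z (s (hb_sel E z) z) (s (hb_sel E z) z)).

Definition disc_integral (a : C) (rho : R) (F : C -> R) : \bar R :=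
  (\int[(@lebesgue_measure R) \x (@lebesgue_measure R)]_(p in
      [set p : R * R | disc a rho (p.1 +i* p.2)]) (F (p.1 +i* p.2))%:E)%E.

Definition A2 (H : hb_idx E -> C -> 'M[C]_r) (a : C) (rho : R)
  (s : hb_idx E -> C -> 'cV[C]_r) : Prop :=
  holo_section (disc a rho) s /\
  (disc_integral a rho (sec_sqnorm H s) < +oo)%E.

Definition L2ext_index (H : hb_idx E -> C -> 'M[C]_r) (a : C) (rho : R)
  (xi : 'cV[C]_r) : \bar R :=
  ereal_inf [set (disc_integral a rho (sec_sqnorm H s) *
                  ((pi * rho ^+ 2 * complex.Re (hinner H a xi xi))^-1)%:E)%E
            | s in [set s | A2 H a rho s /\ s (hb_sel E a) a = xi]].

(* Chern curvature coefficient Theta_{h, z zbar} in frame i: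
   Theta_{z zbar} = - d/dzbar ( H^{-1} dH/dz ), for <u,v> = v^* H u *)
Definition chern_curv (H : hb_idx E -> C -> 'M[C]_r) (i : hb_idx E) (z : C)
  : 'M[C]_r :=
  - dzb_mx (fun w => invmx (H i w) *m dz_mx (H i) w) z.

End Defs.

Definition lsc_on_interval (R : realType) (gamma : R) (g : R -> R) : Prop :=
  forall x, 0 <= x <= gamma -> forall e : R, 0 < e -> exists d : R, 0 < d /\
    forall y, 0 <= y <= gamma -> `|y - x| < d -> g x - e < g y.

(* Main.v *)
(**
Fix xi and a local frame around a. Taylor expansion of the metric at a, followed by a
completion of the square, bounds |s|_h^2 from below, for every holomorphic section s with
s(a) = xi, by |xi|^2 - (<Theta(a) xi, xi> + eps) |z - a|^2 + Re w(z), where w is holomorphic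
and vanishes at a. Integrating over the disc of radius rho kills Re w, so
  L_h(a, rho, xi) >= 1 - (<Theta(a) xi, xi> + eps) rho^2 / (2 |xi|^2).
Comparing with the upper bound exp (- g(rho) rho^2) and letting rho tend to 0 gives the
curvature estimate, g being lower semi-continuous at 0.

Since s is only known to be complex differentiable, the mean value property of w is
obtained directly: a Goursat bisection proves the divergence theorem for vector fields that
are merely differentiable, and it is applied to a truncation of w(z) / (z - a).
*)
Require Import Defs.
From HB Require Import structures.
From mathcomp Require Import all_boot all_order all_algebra.
From mathcomp Require Import complex.
From mathcomp Require Import all_classical all_reals all_analysis.
From mathcomp Require Import measurable_realfun.
From mathcomp Require Import ring lra.

Set Implicit Arguments.
Unset Strict Implicit.
Unset Printing Implicit Defensive.

Import Order.TTheory GRing.Theory Num.Theory.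
Import numFieldNormedType.Exports.
Local Open Scope classical_set_scope.
Local Open Scope ring_scope.
Local Open Scope complex_scope.

(** * Continuous functions of two real variables *)

Section PlaneContinuity.
Variable R : realType.
Implicit Types (f g : R -> R -> R) (x y d : R).

(** The infimum defining the index runs over sections that change with rho and have no a priori
    bound, so sections themselves are never expanded at [a]. Only the metric is expanded, and the
    lower bound is proved for an arbitrary vector F in the fibre over a + h, on a radius that
    depends on the metric and on xi alone. The first-order correction eta of xi is chosen so that
    the term of the metric linear in conj(h) disappears. The deviation u = F - xi - h eta then
    enters in three ways: through a row affine in h, whose contribution is holomorphic and goes into
    w; through an error O(|h|^2 |u|); and through the positive form of u, which absorbs that error
    up to O(|h|^4).

    No pointwise control of a section is available near the boundary circle, so Re w is integrated
    against radial cutoffs supported in smaller discs, whose radius tends to rho at the end.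

    The mean of |z - a|^2 over the disc is rho^2 / 2: this is the origin of the factor 2 in the
    curvature estimate. *)

Definition continuous_plane f := forall x y (e : R), 0 < e ->
  exists d : R, 0 < d /\ forall x' y', `|x' - x| < d -> `|y' - y| < d ->
    `|f x' y' - f x y| < e.

Lemma continuous_plane_uncurry f : continuous_plane f ->
  continuous (fun p : R * R => f p.1 p.2).
Proof.
move=> cf [x y]; apply/cvgrPdist_lt => e e0.
have [d [d0 fd]] := cf x y e e0.
exists (ball x d, ball y d) => /=; first by split; apply: nbhsx_ballx.
move=> [x' y'] [/= xx' yy']; rewrite distrC; apply: fd.
  by rewrite distrC.
by rewrite distrC.
Qed.

Lemma continuous_plane_fst f y : continuous_plane f -> continuous (f ^~ y).
Proof.
move=> cf x; apply/cvgrPdist_lt => e e0.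
have [d [d0 fd]] := cf x y e e0.
apply/nbhs_ballP; exists d => //= x' xx'; rewrite distrC; apply: fd.
  by rewrite distrC.
by rewrite subrr normr0.
Qed.

Lemma continuous_plane_snd f x : continuous_plane f -> continuous (f x).
Proof.
move=> cf y; apply/cvgrPdist_lt => e e0.
have [d [d0 fd]] := cf x y e e0.
apply/nbhs_ballP; exists d => //= y' yy'; rewrite distrC; apply: fd.
  by rewrite subrr normr0.
by rewrite distrC.
Qed.

(** The sigma-algebra on [R * R] is the product one: an open superlevel set belongs to it because it
    is the countable union of the rational open rectangles that it contains. *)
Lemma continuous_plane_measurable f : continuous_plane f ->
  measurable_fun setT (fun p : R * R => f p.1 p.2).
Proof.
move=> cf; apply: (measurability _ (RGenOInfty.measurableE R)).
move=> /= _ [_ [c ->]] <-; rewrite setTI.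
pose rect (q : rat * rat * rat * rat) : set (R * R) :=
  `]ratr q.1.1.1, ratr q.1.1.2[%classic `*` `]ratr q.1.2, ratr q.2[%classic.
pose S := (fun p : R * R => f p.1 p.2) @^-1` `]c, +oo[%classic.
suff: measurable S by [].
have -> : S = \bigcup_q (if `[< rect q `<=` S >] then rect q else set0).
  apply/seteqP; split => [[x y] /= Sxy|p [q _]]; last first.
    by case: ifPn => // /asboolP; apply.
  have cS : c < f x y by move: Sxy; rewrite /S /= in_itv /= andbT.
  have [|d [d0 fd]] := cf x y (f x y - c); first by rewrite subr_gt0.
  have rq (a b : R) : a < b -> exists q : rat, a < ratr q < b.
    by move=> /rat_in_itvoo[q]; rewrite in_itv /= => qab; exists q.
  have [q1 /andP[q1l q1r]] := rq (x - d) x ltac:(lra).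
  have [q2 /andP[q2l q2r]] := rq x (x + d) ltac:(lra).
  have [q3 /andP[q3l q3r]] := rq (y - d) y ltac:(lra).
  have [q4 /andP[q4l q4r]] := rq y (y + d) ltac:(lra).
  exists (q1, q2, q3, q4) => //.
  rewrite ifT; first by rewrite /rect /= !in_itv /= q1r q2l q3r q4l.
  apply/asboolP => -[x' y']; rewrite /rect /S /= !in_itv /= andbT.
  move=> [/andP[? ?] /andP[? ?]].
  have : `|f x' y' - f x y| < f x y - c.
    by apply: fd; rewrite ltr_norml; apply/andP; split; lra.
  by rewrite ltr_norml => /andP[]; lra.
apply: countable_bigcupT_measurable => [|q].
  by apply: countableP.
by case: ifPn => // _; apply: measurableX; exact: measurable_itv.
Qed.

Lemma continuous_planeD f g : continuous_plane f -> continuous_plane g ->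
  continuous_plane (fun x y => f x y + g x y).
Proof.
move=> cf cg x y e e0.
have [d1 [d10 fd]] := cf x y (e / 2) ltac:(lra).
have [d2 [d20 gd]] := cg x y (e / 2) ltac:(lra).
exists (Num.min d1 d2); split; first by rewrite lt_min d10.
move=> x' y'; rewrite !lt_min => /andP[? ?] /andP[? ?].
have := fd x' y' ltac:(by []) ltac:(by []).
have := gd x' y' ltac:(by []) ltac:(by []).
by rewrite !ltr_norml => /andP[? ?] /andP[? ?]; apply/andP; split; lra.
Qed.

Lemma continuous_planeZ (k : R) f : continuous_plane f ->
  continuous_plane (fun x y => k * f x y).
Proof.
move=> cf x y e e0.
have k0 : 0 < `|k| + 1 by have := normr_ge0 k; lra.
have [d [d0 fd]] := cf x y (e / (`|k| + 1)) ltac:(by apply: divr_gt0).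
exists d; split => // x' y' xx' yy'.
rewrite -mulrBr normrM.
have h := fd _ _ xx' yy'.
apply: (@le_lt_trans _ _ ((`|k| + 1) * `|f x' y' - f x y|)).
  by apply: ler_wpM2r => //; lra.
by rewrite mulrC -ltr_pdivlMr.
Qed.

Lemma continuous_planeM f g : continuous_plane f -> continuous_plane g ->
  continuous_plane (fun x y => f x y * g x y).
Proof.
move=> cf cg x y e e0.
have k0 : 0 < `|f x y| + 1 by have := normr_ge0 (f x y); lra.
have l0 : 0 < `|g x y| + 1 by have := normr_ge0 (g x y); lra.
have [d1 [d10 fd]] := cf x y (Num.min 1 (e / (`|g x y| + 1) / 2))
  ltac:(by rewrite lt_min ltr01 /= !divr_gt0).
have [d2 [d20 gd]] := cg x y (e / (`|f x y| + 1) / 2)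
  ltac:(by rewrite !divr_gt0).
exists (Num.min d1 d2); split; first by rewrite lt_min d10.
move=> x' y'; rewrite !lt_min => /andP[? ?] /andP[? ?].
have := fd x' y' ltac:(by []) ltac:(by []).
have := gd x' y' ltac:(by []) ltac:(by []).
rewrite lt_min => h2 /andP[h0 h1].
have -> : f x' y' * g x' y' - f x y * g x y =
  f x' y' * (g x' y' - g x y) + (f x' y' - f x y) * g x y by ring.
apply: (le_lt_trans (ler_normD _ _)); rewrite !normrM.
have hf : `|f x' y'| <= `|f x y| + 1.
  have := ler_normD (f x' y' - f x y) (f x y).
  by rewrite subrK; lra.
have e1 : (`|f x y| + 1) * (e / (`|f x y| + 1) / 2) = e / 2.
  by field; rewrite gt_eqF.
have e2 : (`|g x y| + 1) * (e / (`|g x y| + 1) / 2) = e / 2.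
  by field; rewrite gt_eqF.
have h3 : `|f x' y'| * `|g x' y' - g x y| <= (`|f x y| + 1) * `|g x' y' - g x y|.
  by apply: ler_wpM2r.
have h4 : (`|f x y| + 1) * `|g x' y' - g x y| < e / 2.
  by rewrite -e1 ltr_pM2l.
have h5 : `|f x' y' - f x y| * `|g x y| <= (`|g x y| + 1) * `|f x' y' - f x y|.
  by rewrite mulrC; apply: ler_wpM2r => //; lra.
have h6 : (`|g x y| + 1) * `|f x' y' - f x y| < e / 2.
  by rewrite -e2 ltr_pM2l.
lra.
Qed.

(** Half-open sides: the four quarters of a square are then disjoint and cover it exactly, which
    makes integrals additive under quartering. *)
Definition square x y d : set (R * R) :=
  `[x, x + d[%classic `*` `[y, y + d[%classic.

Lemma measurable_square x y d : measurable (square x y d).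
Proof. by apply: measurableX; exact: measurable_itv. Qed.

Local Notation mu2 := (lebesgue_measure \x lebesgue_measure)%E.

Lemma square_measure x y d : 0 < d -> mu2 (square x y d) = (d ^+ 2)%:E.
Proof.
move=> d0; rewrite product_measure1E; [|exact: measurable_itv|exact: measurable_itv].
have E a : lebesgue_measure `[a, a + d[%classic = d%:E.
  by rewrite lebesgue_measure_itv /= lte_fin ltrDl d0 -EFinD; congr EFin; ring.
by transitivity (d%:E * d%:E)%E => //; congr (_ * _)%E; exact: E.
Qed.

Lemma continuous_plane_bounded_square f x y d : continuous_plane f ->
  exists M, forall p, square x y d p -> `|f p.1 p.2| <= M.
Proof.
move=> cf.
have : compact ((fun p : R * R => f p.1 p.2) @` (`[x, x + d] `*` `[y, y + d])).
  apply: continuous_compact.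
    by apply: continuous_subspaceT; apply: continuous_plane_uncurry.
  by apply: compact_setX; exact: segment_compact.
move=> /compact_bounded[M [_ HM]].
exists (M + 1) => p [/= p1 p2]; apply: (HM (M + 1)); first by rewrite ltrDl.
exists p => //; split => /=.
  by move: p1; rewrite !in_itv /= => /andP[-> /ltW].
by move: p2; rewrite !in_itv /= => /andP[-> /ltW].
Qed.

Lemma continuous_plane_integrable_square f x y d : continuous_plane f -> 0 < d ->
  mu2.-integrable (square x y d) (EFin \o (fun p => f p.1 p.2)).
Proof.
move=> cf d0; apply: measurable_bounded_integrable.
- exact: measurable_square.
- by rewrite (_ : _ (square x y d) = (d ^+ 2)%:E) ?ltry //; exact: square_measure.
- apply: measurable_funS (continuous_plane_measurable cf) => //.
have [M HM] := @continuous_plane_bounded_square f x y d cf.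
exists M; split; first by rewrite num_real.
by move=> N MN p /= sp; apply: (le_trans (HM _ sp)); exact: ltW.
Qed.

End PlaneContinuity.

(** * Divergence theorem on a square *)

Section Bisection.
Variable R : realType.

(** Every lower coordinate is below every upper one, so the suprema of the lower coordinates give a
    common point. It may lie on an upper side, which is why the local condition of the bisection
    concerns closed squares. *)
Lemma nested_squares (q : nat -> R * R * R) (x0 y0 d0 : R) : 0 < d0 ->
  q 0%N = (x0, y0, d0) ->
  (forall n, [/\ (q n.+1).2 = (q n).2 / 2,
    (q n).1.1 <= (q n.+1).1.1 <= (q n).1.1 + (q n).2 / 2 &
    (q n).1.2 <= (q n.+1).1.2 <= (q n).1.2 + (q n).2 / 2]) ->
  exists p : R * R, forall n, (q n).1.1 <= p.1 <= (q n).1.1 + (q n).2 /\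
    (q n).1.2 <= p.2 <= (q n).1.2 + (q n).2.
Proof.
move=> d0_gt0 q0 qS.
have qd n : 0 < (q n).2.
  elim: n => [|n IH]; first by rewrite q0.
  by have [-> _ _] := qS n; lra.
have mono m n : (m <= n)%N ->
    [/\ (q m).1.1 <= (q n).1.1, (q n).1.1 + (q n).2 <= (q m).1.1 + (q m).2,
     (q m).1.2 <= (q n).1.2 & (q n).1.2 + (q n).2 <= (q m).1.2 + (q m).2].
  elim: n => [|n IH]; first by rewrite leqn0 => /eqP ->.
  rewrite leq_eqVlt => /predU1P[-> //|]; rewrite ltnS => /IH[? ? ? ?].
  by have [-> /andP[? ?] /andP[? ?]] := qS n; split; lra.
have sup_in (u v : nat -> R) :
    (forall m n, u m <= v n) -> exists s, forall n, u n <= s <= v n.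
  move=> uv; exists (sup (range u)) => n.
  have hs : has_sup (range u).
    split; first by exists (u 0%N), 0%N.
    by exists (v 0%N) => _ [m _ <-].
  apply/andP; split.
    by apply: sup_upper_bound => //; exists n.
  by apply: ge_sup; [exact: hs.1|move=> _ [m _ <-]].
have cross m n : (q m).1.1 <= (q n).1.1 + (q n).2 /\
                 (q m).1.2 <= (q n).1.2 + (q n).2.
  have := qd n; have := qd m.
  by case/orP: (leq_total m n) => /mono[? ? ? ?]; split; lra.
have [s Hs] := sup_in (fun n => (q n).1.1) (fun n => (q n).1.1 + (q n).2)
  (fun m n => (cross m n).1).
have [t Ht] := sup_in (fun n => (q n).1.2) (fun n => (q n).1.2 + (q n).2)
  (fun m n => (cross m n).2).
by exists (s, t) => n; split; [exact: Hs|exact: Ht].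
Qed.

(** With [eq] for [op] this is additivity; with the order relation, superadditivity. *)
Definition quartering (op : R -> R -> Prop) (F : R -> R -> R -> R) :=
  forall x y d, 0 < d -> op (F x y (d / 2) + F (x + d / 2) y (d / 2) +
    F x (y + d / 2) (d / 2) + F (x + d / 2) (y + d / 2) (d / 2)) (F x y d).

(* Goursat's bisection: an additive function of squares which is locally
   negligible with respect to mu vanishes. *)
Lemma goursat_bisection (Phi mu : R -> R -> R -> R) (x0 y0 d0 : R) : 0 < d0 ->
  quartering eq Phi -> quartering (fun a b => a <= b) mu ->
  0 <= mu x0 y0 d0 ->
  (forall px py e : R, 0 < e -> exists delta : R, 0 < delta /\ forall x y d : R,
    0 < d -> d < delta -> x <= px <= x + d -> y <= py <= y + d ->
    x0 <= x -> x + d <= x0 + d0 -> y0 <= y -> y + d <= y0 + d0 ->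
    `|Phi x y d| <= e * mu x y d) ->
  Phi x0 y0 d0 = 0.
Proof.
move=> d0_gt0 Phi4 mu4 mu0 loc; apply: contrapT => /eqP Phi_neq0.
have P0 : 0 < `|Phi x0 y0 d0| by rewrite normr_gt0.
(* The + 1 keeps the quotient meaningful when mu vanishes; the initial square is bad because mu /
   (mu + 1) < 1. *)
pose e := `|Phi x0 y0 d0| / (mu x0 y0 d0 + 1) / 2.
have m1 : 0 < mu x0 y0 d0 + 1 by lra.
have e0 : 0 < e by rewrite !divr_gt0.
pose bad (q : R * R * R) := e * mu q.1.1 q.1.2 q.2 < `|Phi q.1.1 q.1.2 q.2|.
have bad0 : bad (x0, y0, d0).
  rewrite /bad /= /e -mulrA -mulrA gtr_pMr // mulrCA -ltr_pdivlMl // mulr1 invrK.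
  by rewrite ltr_pdivrMl //; lra.
pose sub (q q' : R * R * R) := [/\ q'.2 = q.2 / 2,
  q.1.1 <= q'.1.1 <= q.1.1 + q.2 / 2 & q.1.2 <= q'.1.2 <= q.1.2 + q.2 / 2].
(* Stated as an implication under the existential, so that a choice function is defined on all
   triples; degenerate or good squares are sent to themselves. *)
have step (q : R * R * R) : exists q', 0 < q.2 -> bad q -> sub q q' /\ bad q'.
  case: q => -[x y] d.
  have [d_gt0|] := pselect (0 < d); last by exists (x, y, d).
  have [badq|] := pselect (bad (x, y, d)); last by exists (x, y, d).
  have := Phi4 x y d d_gt0; have := mu4 x y d d_gt0.
  set h := d / 2 => M4 P4.
  have s1 : sub (x, y, d) (x, y, h) by split => //=; rewrite /h; lra.
  have s2 : sub (x, y, d) (x + h, y, h) by split => //=; rewrite /h; lra.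
  have s3 : sub (x, y, d) (x, y + h, h) by split => //=; rewrite /h; lra.
  have s4 : sub (x, y, d) (x + h, y + h, h) by split => //=; rewrite /h; lra.
  have [b1|b1] := pselect (bad (x, y, h)); first by exists (x, y, h).
  have [b2|b2] := pselect (bad (x + h, y, h)); first by exists (x + h, y, h).
  have [b3|b3] := pselect (bad (x, y + h, h)); first by exists (x, y + h, h).
  have [b4|b4] := pselect (bad (x + h, y + h, h)); first by exists (x + h, y + h, h).
  (* If no quarter were bad, additivity of [Phi], the triangle inequality and superadditivity of
     [mu] would make the whole square good. *)
  exfalso; move: badq b1 b2 b3 b4; rewrite /bad /= -P4.
  move=> badq /negP; rewrite -leNgt => b1 /negP; rewrite -leNgt => b2.
  move=> /negP; rewrite -leNgt => b3 /negP; rewrite -leNgt => b4.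
  have := ler_wpM2l (ltW e0) M4; move: badq.
  set a1 := Phi x y h; set a2 := Phi (x + h) y h; set a3 := Phi x (y + h) h.
  set a4 := Phi (x + h) (y + h) h.
  have := ler_normD (a1 + a2 + a3) a4; have := ler_normD (a1 + a2) a3.
  have := ler_normD a1 a2.
  by rewrite !mulrDr; lra.
have [next nextP] := choice step.
pose q n := iter n next (x0, y0, d0).
have qP n : 0 < (q n).2 /\ bad (q n).
  elim: n => [|n [IH1 IH2]]; first by [].
  have [[-> _ _] ?] := nextP (q n) IH1 IH2.
  by split; [lra|].
have qS n : sub (q n) (q n.+1) by have [? ?] := qP n; apply: (nextP _ _ _).1.
have [p Hp] := @nested_squares q x0 y0 d0 d0_gt0 erefl qS.
have [delta [delta0 Hdelta]] := loc p.1 p.2 e e0.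
have in0 n : [/\ x0 <= (q n).1.1, (q n).1.1 + (q n).2 <= x0 + d0,
    y0 <= (q n).1.2 & (q n).1.2 + (q n).2 <= y0 + d0].
  elim: n => [|n [? ? ? ?]]; first by rewrite /= !lexx.
  by have [-> /andP[? ?] /andP[? ?]] := qS n; split; lra.
have qdn n : (q n).2 = d0 / 2 ^+ n.
  elim: n => [|n IH]; first by rewrite expr0 divr1.
  have [-> _ _] := qS n; rewrite IH exprS; field.
  by rewrite expf_neq0 // pnatr_eq0.
have [n Hn] : exists n, (q n).2 < delta.
  exists (Num.bound (d0 / delta)); rewrite qdn.
  rewrite ltr_pdivrMr ?exprn_gt0 // mulrC -ltr_pdivrMr //.
  apply: (lt_trans (archi_boundP _)); first by rewrite divr_ge0 // ltW.
  by rewrite -natrX ltr_nat ltn_expl.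
have [qn0 badn] := qP n; have [? ? ? ?] := in0 n; have [? ?] := Hp n.
move: badn; rewrite /bad ltNge => /negP; apply.
exact: Hdelta.
Qed.

End Bisection.

(** * Flux and integrals over squares *)

Section Green.
Variable R : realType.
Local Notation mu2 := (lebesgue_measure \x lebesgue_measure)%E.

Lemma primitive_exists (f : R -> R) (lo hi : R) : lo < hi -> continuous f ->
  exists F : R -> R, forall x, lo < x < hi -> is_derive x 1 F (f x).
Proof.
move=> lohi cf.
have fi : lebesgue_measure.-integrable `[lo, hi] (EFin \o f).
  apply: continuous_compact_integrable; first exact: segment_compact.
  exact: continuous_subspaceT.
exists (fun x => \int[lebesgue_measure]_(t in `[lo, x]) f t)%R => x /andP[lx xh].
have [dF F'x] := @continuous_FTC1_closed R f lo x hi xh fi lx (cf x).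
have E : 'D_1 (fun x => \int[lebesgue_measure]_(t in `[lo, x]) f t)%R x = f x.
  by rewrite -derive1E.
exact: (DeriveDef dF E).
Qed.

(** Mean value theorem for F1 - F2: the net flux through two opposite sides is read at one common
    parameter t, so that in a linear approximation the variation along the sides cancels. *)
Lemma mixed_difference_MVT (F1 F2 f1 f2 : R -> R) (lo hi y d : R) : 0 < d ->
  lo < y -> y + d < hi ->
  (forall x, lo < x < hi -> is_derive x 1 F1 (f1 x)) ->
  (forall x, lo < x < hi -> is_derive x 1 F2 (f2 x)) ->
  exists2 t, y <= t <= y + d &
    F1 (y + d) - F1 y - (F2 (y + d) - F2 y) = d * (f1 t - f2 t).
Proof.
move=> d0 loy yhi dF1 dF2.
have yd : y < y + d by rewrite ltrDl.
have dF x : y <= x <= y + d -> is_derive x 1 (fun x => F1 x - F2 x) (f1 x - f2 x).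
  move=> /andP[? ?].
  have h1 := dF1 x ltac:(lra); have h2 := dF2 x ltac:(lra).
  exact: is_deriveB.
have dFo x : x \in `]y, (y + d)[ -> is_derive x 1 (fun x => F1 x - F2 x) (f1 x - f2 x).
  by rewrite in_itv /= => /andP[/ltW h1 /ltW h2]; apply: dF; rewrite h1.
have cF : {within `[y, y + d], continuous (fun x => F1 x - F2 x)}.
  apply: derivable_within_continuous => x.
  by rewrite in_itv /= => xI; case: (dF x xI).
have [c cyd E] := MVT yd dFo cF.
exists c; first by move: cyd; rewrite in_itv /= => /andP[/ltW -> /ltW].
by rewrite mulrC; move: E; rewrite (_ : y + d - y = d); [move=> <-; ring|ring].
Qed.

Lemma square_integral_near (k : R -> R -> R) (x y d c e : R) :
  continuous_plane k -> 0 < d ->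
  (forall p, square x y d p -> `|k p.1 p.2 - c| <= e) ->
  `|\int[mu2]_(p in square x y d) k p.1 p.2 - c * d ^+ 2| <= e * d ^+ 2.
Proof.
move=> ck d0 kc.
have ik := @continuous_plane_integrable_square R k x y d ck d0.
have cst_int (r : R) : \int[mu2]_(p in square x y d) r = r * d ^+ 2.
  rewrite Rintegral_cst; last exact: measurable_square.
  congr (_ * _); rewrite (_ : _ (square x y d) = (d ^+ 2)%:E) //.
  exact: square_measure.
have icst (r : R) : mu2.-integrable (square x y d) (EFin \o (fun=> r)).
  have ccst : continuous_plane (fun _ _ : R => r).
    by move=> ? ? e' e'0; exists 1; split => // ? ? _ _; rewrite subrr normr0.
  exact: (@continuous_plane_integrable_square R _ x y d ccst d0).
have lo : (c - e) * d ^+ 2 <= \int[mu2]_(p in square x y d) k p.1 p.2.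
  rewrite -cst_int; apply: le_Rintegral => //; first exact: measurable_square.
  by move=> p /kc; rewrite ler_norml => /andP[]; lra.
have up : \int[mu2]_(p in square x y d) k p.1 p.2 <= (c + e) * d ^+ 2.
  rewrite -cst_int; apply: le_Rintegral => //; first exact: measurable_square.
  by move=> p /kc; rewrite ler_norml => /andP[]; lra.
move: lo up; move: (\int[mu2]_(p in square x y d) k p.1 p.2)%R => I.
by rewrite ler_norml !mulrDl !mulNr => ? ?; apply/andP; split; lra.
Qed.

Lemma square_integral_quartering (k : R -> R -> R) : continuous_plane k ->
  quartering eq (fun x y d => \int[mu2]_(p in square x y d) k p.1 p.2).
Proof.
move=> ck x y d d0; pose h := d / 2; rewrite -/h.
have dh : d = h + h by rewrite /h; lra.
have h0 : 0 < h by rewrite /h; lra.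
have E1 : square x y d = (square x y h `|` square (x + h) y h) `|`
    (square x (y + h) h `|` square (x + h) (y + h) h).
  rewrite /square; apply/seteqP; split => [[s t]|[s t]] /=; rewrite !in_itv /=.
    move=> [/andP[? ?] /andP[? ?]].
    case: (ltP s (x + h)) => sx; case: (ltP t (y + h)) => ty.
    - by left; left; split; apply/andP; split.
    - by right; left; split; apply/andP; split => //; lra.
    - by left; right; split; apply/andP; split => //; lra.
    - by right; right; split; apply/andP; split => //; lra.
  by move=> [[]|[]] [/andP[? ?] /andP[? ?]]; split; apply/andP; split; lra.
have ik := @continuous_plane_integrable_square R k x y d ck d0.
have mS a b c := @measurable_square R a b c.
have mU : measurable (square x y h `|` square (x + h) y h) by apply: measurableU.
have mV : measurable (square x (y + h) h `|` square (x + h) (y + h) h).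
  by apply: measurableU.
have disjS (x1 y1 x2 y2 : R) : x1 + h <= x2 \/ y1 + h <= y2 ->
    [disjoint square x1 y1 h & square x2 y2 h].
  move=> H; apply/disj_setPS => -[s t]; rewrite /square /= !in_itv /=.
  by move=> [[/andP[? ?] /andP[? ?]] [/andP[? ?] /andP[? ?]]]; case: H; lra.
rewrite E1 Rintegral_setU; [|exact: mU|exact: mV|by rewrite -E1|].
  rewrite [X in _ = X + _]Rintegral_setU; [|exact: mS|exact: mS| |]; first last.
  - by apply: disjS; left.
  - by apply: integrableS ik; [exact: mS|exact: mU|rewrite E1; apply: subsetUl].
  rewrite [X in _ = _ + X]Rintegral_setU; [|exact: mS|exact: mS| |]; first last.
  - by apply: disjS; left.
  - by apply: integrableS ik; [exact: mS|exact: mV|rewrite E1; apply: subsetUr].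
  by rewrite !addrA.
apply/disj_setPS => -[s t]; rewrite /square /= !in_itv /=.
by move=> [[[/andP[? ?] /andP[? ?]]|[/andP[? ?] /andP[? ?]]]
           [[/andP[? ?] /andP[? ?]]|[/andP[? ?] /andP[? ?]]]]; lra.
Qed.

(* Mass of the point c for the interval [x, x + d]: 2 in the interior, 1 at an
   endpoint, so that it is additive and at least 1 on closed intervals through c. *)
Definition point_mass (c x d : R) : R :=
  ((x <= c < x + d)%R : nat)%:R + ((x < c <= x + d)%R : nat)%:R.

Lemma point_mass_ge0 c x d : 0 <= point_mass c x d.
Proof. by rewrite addr_ge0. Qed.

Lemma point_mass_ge1 c x d : 0 < d -> x <= c <= x + d -> 1 <= point_mass c x d.
Proof.
move=> d0 /andP[xc cx]; rewrite /point_mass.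
case: (ltP c (x + d)) => h; first by rewrite xc /= lerDl.
by rewrite cx (_ : x < c) ?andbT /= ?lerDr //; lra.
Qed.

Lemma point_mass_half c x d : 0 < d ->
  point_mass c x (d / 2) + point_mass c (x + d / 2) (d / 2) = point_mass c x d.
Proof.
move=> d0; rewrite /point_mass.
have -> : x + d / 2 + d / 2 = x + d by lra.
rewrite addrACA; congr (_ + _); rewrite -natrD; congr (_%:R).
  case: (leP x c) => ?; case: (ltP c (x + d / 2)) => ?;
    case: (ltP c (x + d)) => ? //=; exfalso; lra.
case: (ltP x c) => ?; case: (leP c (x + d / 2)) => ?;
  case: (leP c (x + d)) => ? //=; exfalso; lra.
Qed.

(** Total differentiability at one point with gradient (p, q), the sum norm replacing the Euclidean
    one. *)
Definition linear_approx (f : R -> R -> R) (x y p q : R) :=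
  forall e : R, 0 < e -> exists d : R, 0 < d /\ forall x' y',
    `|x' - x| < d -> `|y' - y| < d ->
    `|f x' y' - f x y - p * (x' - x) - q * (y' - y)| <=
      e * (`|x' - x| + `|y' - y|).

(** Both points have ordinate t, so the terms in q cancel; each of the two approximations costs at
    most e (d + d), whence 4 e d. *)
Lemma linear_approx_diff1 (f : R -> R -> R) (x y p q e : R) : 0 < e ->
  linear_approx f x y p q -> exists delta : R, 0 < delta /\
  forall x' y' d, 0 < d -> d < delta -> x' <= x <= x' + d -> y' <= y <= y' + d ->
    forall t, y' <= t <= y' + d ->
    `|f (x' + d) t - f x' t - p * d| <= 4 * e * d.
Proof.
move=> e0 /(_ e e0)[delta [delta0 H]]; exists delta; split => //.
move=> x' y' d d0 dd /andP[? ?] /andP[? ?] t /andP[? ?].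
have B1 : `|x' + d - x| <= d by rewrite ler_norml; apply/andP; split; lra.
have B2 : `|x' - x| <= d by rewrite ler_norml; apply/andP; split; lra.
have B3 : `|t - y| <= d by rewrite ler_norml; apply/andP; split; lra.
have H1 := H (x' + d) t ltac:(lra) ltac:(lra).
have H2 := H x' t ltac:(lra) ltac:(lra).
have K1 : e * (`|x' + d - x| + `|t - y|) <= e * (d + d).
  by apply: ler_wpM2l; [exact: ltW|lra].
have K2 : e * (`|x' - x| + `|t - y|) <= e * (d + d).
  by apply: ler_wpM2l; [exact: ltW|lra].
have := le_trans H1 K1; have := le_trans H2 K2.
rewrite !mulrDr.
rewrite !ler_norml => /andP[? ?] /andP[? ?]; apply/andP; split; nra.
Qed.

Lemma linear_approx_swap (f : R -> R -> R) (x y p q : R) :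
  linear_approx f x y p q -> linear_approx (fun s t => f t s) y x q p.
Proof.
move=> H e e0; have [d [d0 Hd]] := H e e0; exists d; split => // x' y' hx hy.
have := Hd y' x' hy hx.
by rewrite [`|y' - x| + _]addrC [_ - p * _ - _]addrAC.
Qed.

Lemma segment_dist_lt (x d u v delta : R) : d < delta ->
  x <= v <= x + d -> x <= u <= x + d -> `|u - v| < delta.
Proof.
move=> ? /andP[? ?] /andP[? ?]; rewrite ltr_norml; apply/andP; split; lra.
Qed.

Lemma ler_norm_sum_diff (A B I a b p q r : R) : `|A - a| <= p ->
  `|B - b| <= q -> `|I - (a + b)| <= r -> `|A + B - I| <= p + q + r.
Proof.
rewrite !ler_norml => /andP[? ?] /andP[? ?] /andP[? ?]; apply/andP; split; lra.
Qed.

Lemma ler_dist_center (u v c p : R) : `|u - c| < p -> `|v - c| < p ->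
  `|u - v| <= 2 * p.
Proof.
rewrite !ltr_norml ler_norml => /andP[? ?] /andP[? ?]; apply/andP; split; lra.
Qed.

(* The partial derivatives of (A, B) need not be continuous, only the divergence k:
   hence Goursat's argument instead of Fubini's theorem. The boundary flux of a square
   is a mixed difference of primitives of A and B, which is additive. *)
Lemma divergence_square (A B k : R -> R -> R) (x0 y0 d0 a1 a2 : R) : 0 < d0 ->
  continuous_plane A -> continuous_plane B -> continuous_plane k ->
  (forall x y, (x, y) <> (a1, a2) -> exists Ax Ay Bx By, k x y = Ax + By /\
     linear_approx A x y Ax Ay /\ linear_approx B x y Bx By) ->
  (forall t, A x0 t = 0 /\ A (x0 + d0) t = 0) ->
  (forall t, B t y0 = 0 /\ B t (y0 + d0) = 0) ->
  \int[mu2]_(p in square x0 y0 d0) k p.1 p.2 = 0.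
Proof.
move=> d0_gt0 cA cB ck AB A0 B0.
(* The margin 1 on either side makes the endpoints of the square interior to the interval on which
   the primitives are differentiable. *)
have /choice[PA dPA] : forall x, exists F : R -> R,
    forall t : R, y0 - 1 < t < y0 + d0 + 1 -> is_derive t 1 F (A x t).
  by move=> x; apply: primitive_exists; [lra|exact: continuous_plane_snd].
have /choice[PB dPB] : forall y, exists F : R -> R,
    forall t : R, x0 - 1 < t < x0 + d0 + 1 -> is_derive t 1 F (B t y).
  move=> y; apply: primitive_exists; first lra.
  exact: (@continuous_plane_fst R B y cB).
pose mixA x y d := PA (x + d) (y + d) - PA (x + d) y - (PA x (y + d) - PA x y).
pose mixB x y d := PB (y + d) (x + d) - PB (y + d) x - (PB y (x + d) - PB y x).
pose I x y d := \int[mu2]_(p in square x y d) k p.1 p.2.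
pose Phi x y d := mixA x y d + mixB x y d - I x y d.
(* The area is the comparison function of Goursat's argument at points of differentiability. The
   product of point masses, again additive, is at least 1 on squares whose closure contains (a1,
   a2), where A and B are only continuous. *)
pose mu x y d := d ^+ 2 + point_mass a1 x d * point_mass a2 y d.
have mixAE x y d : 0 < d -> y0 <= y -> y + d <= y0 + d0 ->
    exists2 t, y <= t <= y + d & mixA x y d = d * (A (x + d) t - A x t).
  move=> ? ? ?; apply: (@mixed_difference_MVT (PA (x + d)) (PA x) (A (x + d)) (A x)
    (y0 - 1) (y0 + d0 + 1)) => //; lra.
have mixBE x y d : 0 < d -> x0 <= x -> x + d <= x0 + d0 ->
    exists2 t, x <= t <= x + d & mixB x y d = d * (B t (y + d) - B t y).
  move=> ? ? ?; apply: (@mixed_difference_MVT (PB (y + d)) (PB y)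
    (B ^~ (y + d)) (B ^~ y) (x0 - 1) (x0 + d0 + 1)) => //; try lra.
suff : Phi x0 y0 d0 = 0.
  rewrite /Phi.
  have [t _ ->] := mixAE x0 y0 d0 d0_gt0 (lexx _) (lexx _).
  have [s _ ->] := mixBE x0 y0 d0 d0_gt0 (lexx _) (lexx _).
  have [-> ->] := A0 t; have [-> ->] := B0 s.
  by rewrite !subrr !mulr0 addr0 sub0r => /eqP; rewrite oppr_eq0 => /eqP.
apply: (@goursat_bisection R Phi mu) => //.
- move=> x y d d_gt0.
  have IE : _ = I x y d := square_integral_quartering ck x y d_gt0.
  rewrite /Phi -IE -!/(I _ _ _) /mixA /mixB.
  have -> : x + d / 2 + d / 2 = x + d by lra.
  have -> : y + d / 2 + d / 2 = y + d by lra.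
  ring.
- move=> x y d d_gt0; rewrite /mu -(point_mass_half a1 x d_gt0) -(point_mass_half a2 y d_gt0).
  by rewrite le_eqVlt; apply/orP; left; apply/eqP; field.
- by rewrite /mu addr_ge0 ?sqr_ge0 // mulr_ge0 // point_mass_ge0.
move=> px py e e0.
have [pa|pa] := pselect ((px, py) = (a1, a2)); last first.
  have [Ax [Ay [Bx [By [kE [lA lB]]]]]] := AB px py pa.
  (* With e / 16 each of the two flux errors is at most (e / 4) d^2 and the integral error at most
     (e / 16) d^2, in total below e d^2. *)
  have e'0 : 0 < e / 16 by lra.
  have [d1 [d10 H1]] := linear_approx_diff1 e'0 lA.
  have [d2 [d20 H2]] := linear_approx_diff1 e'0 (linear_approx_swap lB).
  have [d3 [d30 H3]] := ck px py _ e'0.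
  exists (Num.min d1 (Num.min d2 d3)); split; first by rewrite !lt_min d10 d20.
  move=> x y d d_gt0; rewrite !lt_min => /andP[dd1 /andP[dd2 dd3]] hx hy ? ? ? ?.
  have [t ht Et] := mixAE x y d ltac:(by []) ltac:(by []) ltac:(by []).
  have [s hs Es] := mixBE x y d ltac:(by []) ltac:(by []) ltac:(by []).
  have K1 := H1 x y d d_gt0 dd1 hx hy t ht.
  have K2 := H2 y x d d_gt0 dd2 hy hx s hs.
  have K3 : `|I x y d - k px py * d ^+ 2| <= e / 16 * d ^+ 2.
    apply: square_integral_near => // -[u v]; rewrite /square /= !in_itv /=.
    move=> [/andP[u1 /ltW u2] /andP[v1 /ltW v2]]; apply/ltW/H3.
      by apply: segment_dist_lt dd3 hx _; rewrite u1.
    by apply: segment_dist_lt dd3 hy _; rewrite v1.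
  have d20' : 0 <= d ^+ 2 by exact: sqr_ge0.
  have K1' : `|mixA x y d - Ax * d ^+ 2| <= e / 4 * d ^+ 2.
    have -> : mixA x y d - Ax * d ^+ 2 = d * (A (x + d) t - A x t - Ax * d).
      by rewrite Et; ring.
    rewrite normrM gtr0_norm //.
    have -> : e / 4 * d ^+ 2 = d * (4 * (e / 16) * d) by field.
    by rewrite ler_pM2l.
  have K2' : `|mixB x y d - By * d ^+ 2| <= e / 4 * d ^+ 2.
    have -> : mixB x y d - By * d ^+ 2 = d * (B s (y + d) - B s y - By * d).
      by rewrite Es; ring.
    rewrite normrM gtr0_norm //.
    have -> : e / 4 * d ^+ 2 = d * (4 * (e / 16) * d) by field.
    by rewrite ler_pM2l.
  apply: (@le_trans _ _ (e * d ^+ 2)); last first.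
    by rewrite ler_pM2l // /mu lerDl mulr_ge0 // point_mass_ge0.
  rewrite kE mulrDl in K3; apply: (le_trans (ler_norm_sum_diff K1' K2' K3)).
  by rewrite -!mulrDl; apply: ler_wpM2r => //; move: e0; clear; lra.
(* At the exceptional point continuity is enough: on a small square the fluxes and the integral add
   up to less than e, while [mu] is at least 1. The side is kept below 1 to bound d and d^2, and
   below e / 16 / K to make the integral small. *)
case: pa => -> ->.
pose K := `|k a1 a2| + 1.
have K0 : 0 < K by rewrite /K; have := normr_ge0 (k a1 a2); lra.
have e'0 : 0 < e / 16 by lra.
have [d1 [d10 H1]] := cA a1 a2 _ e'0.
have [d2 [d20 H2]] := cB a1 a2 _ e'0.
have [d3 [d30 H3]] := ck a1 a2 1 ltr01.
exists (Num.min (Num.min d1 1) (Num.min (Num.min d2 d3) (e / 16 / K))); split.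
  by rewrite !lt_min d10 ltr01 d20 d30 divr_gt0.
move=> x y d d_gt0.
rewrite !lt_min => /andP[/andP[dd1 dl1] /andP[/andP[dd2 dd3] ddK]].
move=> hx hy ? ? ? ?.
have [t ht Et] := mixAE x y d ltac:(by []) ltac:(by []) ltac:(by []).
have [s hs Es] := mixBE x y d ltac:(by []) ltac:(by []) ltac:(by []).
have xdI : x <= x + d <= x + d by rewrite lexx lerDl ltW.
have ydI : y <= y + d <= y + d by rewrite lexx lerDl ltW.
have xI : x <= x <= x + d by rewrite lexx lerDl ltW.
have yI : y <= y <= y + d by rewrite lexx lerDl ltW.
have K1 : `|mixA x y d| <= 2 * (e / 16).
  rewrite Et normrM gtr0_norm //.
  have h1 := H1 _ _ (segment_dist_lt dd1 hx xdI) (segment_dist_lt dd1 hy ht).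
  have h2 := H1 _ _ (segment_dist_lt dd1 hx xI) (segment_dist_lt dd1 hy ht).
  by apply: (le_trans _ (ler_dist_center h1 h2)); rewrite ler_piMl // ltW.
have K2 : `|mixB x y d| <= 2 * (e / 16).
  rewrite Es normrM gtr0_norm //.
  have h1 := H2 _ _ (segment_dist_lt dd2 hx hs) (segment_dist_lt dd2 hy ydI).
  have h2 := H2 _ _ (segment_dist_lt dd2 hx hs) (segment_dist_lt dd2 hy yI).
  by apply: (le_trans _ (ler_dist_center h1 h2)); rewrite ler_piMl // ltW.
have K3 : `|I x y d| <= e / 16.
  have : `|I x y d - 0 * d ^+ 2| <= K * d ^+ 2.
    apply: square_integral_near => // -[u v]; rewrite /square /= !in_itv /= subr0.
    move=> [/andP[u1 /ltW u2] /andP[v1 /ltW v2]].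
    have uI : x <= u <= x + d by rewrite u1.
    have vI : y <= v <= y + d by rewrite v1.
    have := H3 _ _ (segment_dist_lt dd3 hx uI) (segment_dist_lt dd3 hy vI).
    have := ler_normD (k u v - k a1 a2) (k a1 a2); rewrite subrK /K; clear; lra.
  rewrite mul0r subr0 => /le_trans; apply.
  apply: (@le_trans _ _ (K * d)); last by rewrite mulrC -ler_pdivlMr // ltW.
  by rewrite ler_pM2l // expr2 ger_pMr // ltW.
apply: (@le_trans _ _ e); last first.
  have := point_mass_ge1 d_gt0 hx; have := point_mass_ge1 d_gt0 hy.
  move=> m2 m1; rewrite -[leLHS]mulr1 ler_pM2l // /mu.
  have : 1 <= point_mass a1 x d * point_mass a2 y d.
    by rewrite -[1]mulr1; apply: ler_pM.
  by move=> /le_trans; apply; rewrite lerDr sqr_ge0.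
rewrite -[mixA _ _ _]subr0 in K1; rewrite -[mixB _ _ _]subr0 in K2.
rewrite -[I _ _ _]subr0 -[in X in _ - X](addr0 0) in K3.
apply: (le_trans (ler_norm_sum_diff K1 K2 K3)).
by move: e0; clear; lra.
Qed.

End Green.

(** * Integral of a radial quadratic over a disc *)

Section PointwiseDerivatives.
Variable R : realType.
Implicit Types (f g : R -> R) (x : R).

Lemma is_derive_cstE (c x : R) : is_derive x 1 (fun=> c) 0.
Proof. exact: is_derive_cst. Qed.

Lemma is_derive_idE x : is_derive x 1 (fun t => t) 1.
Proof. exact: is_derive_id. Qed.

Lemma is_derive_addE f g x df dg : is_derive x 1 f df -> is_derive x 1 g dg ->
  is_derive x 1 (fun t => f t + g t) (df + dg).
Proof. by move=> ? ?; exact: is_deriveD. Qed.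

Lemma is_derive_subE f g x df dg : is_derive x 1 f df -> is_derive x 1 g dg ->
  is_derive x 1 (fun t => f t - g t) (df - dg).
Proof. by move=> ? ?; exact: is_deriveB. Qed.

Lemma is_derive_mulE f g x df dg : is_derive x 1 f df -> is_derive x 1 g dg ->
  is_derive x 1 (fun t => f t * g t) (f x * dg + g x * df).
Proof. by move=> ? ?; exact: is_deriveM. Qed.

Lemma is_derive_continuous f x df : is_derive x 1 f df -> {for x, continuous f}.
Proof.
by move=> h; apply/differentiable_continuous/derivable1_diffP; case: h.
Qed.

Lemma continuous_addE f g x : {for x, continuous f} -> {for x, continuous g} ->
  {for x, continuous (fun t => f t + g t)}.
Proof. by move=> ? ?; exact: continuousD. Qed.

Lemma continuous_mulE f g x : {for x, continuous f} -> {for x, continuous g} ->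
  {for x, continuous (fun t => f t * g t)}.
Proof. by move=> ? ?; exact: continuousM. Qed.

Lemma derivable_oo_LRcontinuous_everywhere f df (a b : R) :
  (forall x, is_derive x 1 f (df x)) -> derivable_oo_LRcontinuous f a b.
Proof.
move=> fd; have cf x : {for x, continuous f} by apply: is_derive_continuous (fd x).
split.
- by move=> x _; case: (fd x).
- exact: cvg_at_right_filter (cf a).
- exact: cvg_at_left_filter (cf b).
Qed.

Lemma integral_is_derive (f F : R -> R) (a b : R) : a <= b -> continuous f ->
  (forall x, is_derive x 1 F (f x)) ->
  (\int[lebesgue_measure]_(x in `[a, b]) (f x)%:E = (F b - F a)%:E)%E.
Proof.
rewrite le_eqVlt => /predU1P[<-|ab] cf dF.
  by rewrite set_itv1 integral_set1 subrr.
rewrite (@continuous_FTC2 R f F a b) //.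
- exact: continuous_subspaceT.
- exact: derivable_oo_LRcontinuous_everywhere dF.
- by move=> x _; rewrite derive1E; case: (dF x).
Qed.

End PointwiseDerivatives.

Lemma ltr_sqr_itv (R : realType) (u q : R) : 0 < q ->
  (u ^+ 2 < q ^+ 2) = (- q < u < q).
Proof.
move=> q0; rewrite -ltr_norml -[u ^+ 2]real_normK ?num_real //.
by rewrite ltr_pXn2r // nnegrE // ltW.
Qed.

Section DiscQuadratic.
Variable R : realType.
Local Notation mu := (@lebesgue_measure R).
Local Notation mu2 := (lebesgue_measure \x lebesgue_measure)%E.
Variables a1 a2 : R.

Definition sqdist (x y : R) : R := (x - a1) ^+ 2 + (y - a2) ^+ 2.

Lemma sqdist_ge0 x y : 0 <= sqdist x y.
Proof. by rewrite addr_ge0 ?sqr_ge0. Qed.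

Lemma continuous_sqdist : continuous_plane sqdist.
Proof.
have c1 : continuous_plane (fun x y : R => x - a1).
  by move=> x y e e0; exists e; split => // x' y' h _; rewrite opprD addrACA subrr addr0.
have c2 : continuous_plane (fun x y : R => y - a2).
  by move=> x y e e0; exists e; split => // x' y' _ h; rewrite opprD addrACA subrr addr0.
have := continuous_planeD (continuous_planeM c1 c1) (continuous_planeM c2 c2).
by [].
Qed.

Definition open_disc (c : R) : set (R * R) := [set p | sqdist p.1 p.2 < c].

Lemma measurable_open_disc c : measurable (open_disc c).
Proof.
have := continuous_plane_measurable continuous_sqdist measurableT (measurable_itv `]-oo, c[).
by rewrite setTI; congr measurable.
Qed.

Lemma disc_section_integral (c k l x : R) : (x - a1) ^+ 2 < c ->
  let q : R := @Num.sqrt R (c - (x - a1) ^+ 2) in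
  (\int[mu]_(y in [set y | sqdist x y < c]%R) (k + l * sqdist x y)%R%:E =
   (2 * (k + l * (x - a1) ^+ 2) * q + 2 / 3 * l * q ^+ 3)%R%:E)%E.
Proof.
move=> xc q.
have q2 : q ^+ 2 = c - (x - a1) ^+ 2 by rewrite sqr_sqrtr // subr_ge0 ltW.
have q0 : 0 < q by rewrite sqrtr_gt0 subr_gt0.
have -> : [set y | sqdist x y < c] = `]a2 - q, a2 + q[%classic.
  have E y : (sqdist x y < c) = (a2 - q < y < a2 + q).
    rewrite /sqdist -ltrBrDl -q2 ltr_sqr_itv //.
    by apply/idP/idP => /andP[? ?]; apply/andP; split; lra.
  by apply/seteqP; split => y /=; rewrite in_itv /= E.
pose f (y : R) : R := k + l * (x - a1) ^+ 2 + l * ((y - a2) * (y - a2)).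
pose F (y : R) : R := (k + l * (x - a1) ^+ 2) * (y - a2) + l / 3 * ((y - a2) * ((y - a2) * (y - a2))).
have dY (y : R) : is_derive y 1 (fun y => y - a2) 1.
  apply: (is_derive_eq (is_derive_subE (is_derive_idE y) (is_derive_cstE a2 y))).
  by rewrite subr0.
have dF (y : R) : is_derive y 1 F (f y).
  have h1 := is_derive_mulE (is_derive_cstE (k + l * (x - a1) ^+ 2) y) (dY y).
  have h2 := is_derive_mulE (dY y) (dY y).
  have h3 := is_derive_mulE (dY y) h2.
  have h4 := is_derive_mulE (is_derive_cstE (l / 3) y) h3.
  apply: (is_derive_eq (is_derive_addE h1 h4)).
  by rewrite /f; field.
have cf : continuous f.
  move=> y.
  have h2 := is_derive_mulE (dY y) (dY y).
  have h4 := is_derive_mulE (is_derive_cstE l y) h2.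
  exact: is_derive_continuous
    (is_derive_addE (is_derive_cstE (k + l * (x - a1) ^+ 2) y) h4).
transitivity (\int[mu]_(y in `](a2 - q)%R, (a2 + q)%R[) (f y)%:E)%E.
  by apply: eq_integral => y _; rewrite /f /sqdist; congr EFin; ring.
rewrite -(@integral_itv_bndoo R _ _ (EFin \o f) true false); last first.
  apply/measurable_EFinP.
  by apply: measurable_funS (continuous_measurable_fun cf).
rewrite (@integral_is_derive R f F) //; last by lra.
by congr EFin; rewrite /F; field.
Qed.

(** Slicing by vertical lines, which Tonelli allows because the integrand is non-negative on the
    disc, leaves an integral in x containing a square root; the substitution x = a1 + rho sin t
    turns it into a trigonometric polynomial. *)
Lemma integral_disc_quadratic (c k l : R) : 0 < c ->
  (forall s : R, 0 <= s -> s < c -> 0 <= k + l * s) ->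
  (\int[mu2]_(p in open_disc c) (k + l * sqdist p.1 p.2)%R%:E =
   (pi * k * c + pi * l * c ^+ 2 / 2)%R%:E)%E.
Proof.
move=> c0 kl.
pose rho : R := @Num.sqrt R c.
have rho0 : 0 < rho by rewrite sqrtr_gt0.
have rho2 : rho ^+ 2 = c by rewrite sqr_sqrtr // ltW.
pose q (x : R) : R := @Num.sqrt R (c - (x - a1) ^+ 2).
pose G (x : R) : R := 2 * (k + l * (x - a1) ^+ 2) * q x + 2 / 3 * l * q x ^+ 3.
have mD := measurable_open_disc c.
have cg : continuous_plane (fun x y => k + l * sqdist x y).
  apply: (@continuous_planeD R (fun _ _ => k)).
    by move=> ? ? e e0; exists 1; split => // ? ? _ _; rewrite subrr normr0.
  exact: continuous_planeZ continuous_sqdist.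
rewrite integral_mkcond.
rewrite fubini_tonelli1; first last.
- move=> p; rewrite patchE; case: ifPn => //.
  by rewrite inE => Dp; rewrite lee_fin; apply: kl => //; exact: sqdist_ge0.
- apply/(measurable_restrictT _ mD)/measurable_EFinP.
  by apply: measurable_funS (continuous_plane_measurable cg).
transitivity (\int[mu]_(x in `](a1 - rho)%R, (a1 + rho)%R[) (G x)%:E)%E.
  rewrite [RHS]integral_mkcond; apply: eq_integral => x _.
  rewrite /fubini_F /= patchE.
  have xin : (x \in (`](a1 - rho), (a1 + rho)[%classic : set R)) = ((x - a1) ^+ 2 < c).
    rewrite mem_setE in_itv /= -rho2 ltr_sqr_itv //.
    have E (u : R) : (a1 - rho < u < a1 + rho) = (- rho < u - a1 < rho).
      by apply/idP/idP => /andP[? ?]; apply/andP; split; lra.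
    exact: E.
  rewrite xin; case: ifPn => [xc|].
    rewrite -(disc_section_integral k l xc) [RHS]integral_mkcond.
    apply: eq_integral => y _; rewrite !patchE.
    by rewrite (_ : ((x, y) \in open_disc c) = (y \in [set y | sqdist x y < c])) // !in_setE.
  rewrite -leNgt => cx; apply: integral0_eq => y _; rewrite patchE ifF //.
  apply/negbTE; rewrite notin_setE /open_disc /= => /lt_le_trans/(_ cx).
  by rewrite /sqdist gtrDl ltNge sqr_ge0.
have cx (x : R) : {for x, continuous (fun x : R => x - a1)}.
  exact: is_derive_continuous
    (is_derive_subE (is_derive_idE x) (is_derive_cstE a1 x)).
have cq : continuous q.
  move=> x; apply: continuous_comp; last exact: sqrt_continuous.
  apply: continuousB; first exact: cst_continuous.
  by apply: continuousM; exact: cx.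
have cG : continuous G.
  move=> /= x.
  have cX2 : {for (x : R), continuous (fun t : R => (t - a1) * (t - a1))}.
    exact: continuous_mulE.
  have ckl : {for (x : R), continuous (fun t : R => k + l * ((t - a1) * (t - a1)))}.
    apply: continuous_addE; first exact: cst_continuous.
    by apply: continuous_mulE; first exact: cst_continuous.
  have cq3 : {for (x : R), continuous (fun t : R => q t * (q t * q t))}.
    by apply: continuous_mulE; [|apply: continuous_mulE]; exact: cq.
  have c1 : {for (x : R), continuous (fun t : R => 2 * (k + l * ((t - a1) * (t - a1))) * q t)}.
    apply: continuous_mulE; last exact: cq.
    by apply: continuous_mulE; first exact: cst_continuous.
  have c2 : {for (x : R), continuous (fun t : R => 2 / 3 * l * (q t * (q t * q t)))}.
    by apply: continuous_mulE; first exact: cst_continuous.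
  exact: (continuous_addE c1 c2).
rewrite -(@integral_itv_bndoo R _ _ (EFin \o G) true false); last first.
  apply/measurable_EFinP.
  by apply: measurable_funS (continuous_measurable_fun cG).
pose F (t : R) : R := a1 + rho * sin t.
have dF (t : R) : is_derive t 1 F (rho * cos t).
  have h := is_derive_mulE (is_derive_cstE rho t) (is_derive_sin t).
  apply: (is_derive_eq (is_derive_addE (is_derive_cstE a1 t) h)).
  by rewrite mulr0 addr0 add0r.
have F'x t : derive1 F t = rho * cos t.
  by rewrite derive1E; case: (dF t).
have F'E := funext F'x.
have cF' : continuous (fun t : R => rho * cos t).
  move=> t; exact: is_derive_continuous
    (is_derive_mulE (is_derive_cstE rho t) (is_derive_cos t)).
have pi2 : 0 < pi / 2 :> R by rewrite divr_gt0 // pi_gt0.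
have FN : F (- (pi / 2)) = a1 - rho by rewrite /F sinN sin_pihalf mulrN1.
have FP : F (pi / 2) = a1 + rho by rewrite /F sin_pihalf mulr1.
rewrite -FN -FP (@integration_by_substitution_increasing R F G (- (pi / 2)) (pi / 2));
  first last.
- exact: continuous_subspaceT.
- exact: derivable_oo_LRcontinuous_everywhere dF.
- rewrite F'E; apply: cvgP; exact: cvg_at_left_filter (cF' _).
- rewrite F'E; apply: cvgP; exact: cvg_at_right_filter (cF' _).
- by rewrite F'E => t _; exact: cF'.
- move=> s t sI tI st; rewrite /F ltrD2l ltr_pM2l //.
  by rewrite ltr_sin.
- by lra.
pose f (t : R) : R := 2 * k * c * (cos t * cos t) + l * c ^+ 2 *
  (2 * (sin t * sin t * (cos t * cos t)) + 2 / 3 * (cos t * cos t * (cos t * cos t))).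
(* With S and C for sine and cosine, C^2 is the derivative of (t + S C) / 2, and 2 S^2 C^2 + (2/3)
   C^4 = C^2 - (1/3) (S C^3)'. *)
pose P (t : R) : R := k * c * (t + sin t * cos t) + l * c ^+ 2 *
  ((1 / 2) * (t + sin t * cos t) - 1 / 3 * (sin t * (cos t * (cos t * cos t)))).
have ds (t : R) := is_derive_sin t; have dc (t : R) := is_derive_cos t.
have dP (t : R) : is_derive t 1 P (f t).
  have dsc := is_derive_mulE (ds t) (dc t).
  have dcc := is_derive_mulE (dc t) (dc t).
  have dccc := is_derive_mulE (dc t) dcc.
  have dsccc := is_derive_mulE (ds t) dccc.
  have dt := is_derive_addE (is_derive_idE t) dsc.
  have e1 := is_derive_mulE (is_derive_cstE (k * c) t) dt.
  have e2 := is_derive_mulE (is_derive_cstE (1 / 2) t) dt.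
  have e3 := is_derive_mulE (is_derive_cstE (1 / 3) t) dsccc.
  have e4 := is_derive_mulE (is_derive_cstE (l * c ^+ 2) t)
    (is_derive_subE e2 e3).
  apply: (is_derive_eq (is_derive_addE e1 e4)).
  have := cos2Dsin2 t; rewrite /f.
  set C := cos t; set S := sin t => CS.
  have -> : S * - S = C ^+ 2 - 1 by rewrite -CS; ring.
  have SS : S * S = 1 - C ^+ 2 by rewrite -CS; ring.
  rewrite SS.
  rewrite !mulr0 !addr0.
  have -> : S * (C * (C * - S + C * - S) + C * C * - S) = - 3 * (C * C) * (S * S) by ring.
  by rewrite SS; field.
have cf : continuous f.
  move=> t.
  have dss := is_derive_mulE (ds t) (ds t).
  have dcc := is_derive_mulE (dc t) (dc t).
  have e1 := is_derive_mulE (is_derive_cstE (2 * k * c) t) dcc.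
  have e2 := is_derive_mulE (is_derive_cstE 2 t) (is_derive_mulE dss dcc).
  have e3 := is_derive_mulE (is_derive_cstE (2 / 3) t) (is_derive_mulE dcc dcc).
  have e4 := is_derive_mulE (is_derive_cstE (l * c ^+ 2) t)
    (is_derive_addE e2 e3).
  exact: is_derive_continuous (is_derive_addE e1 e4).
transitivity (\int[mu]_(t in `[(- (pi / 2))%R, (pi / 2)%R]) (f t)%:E)%E.
  apply: eq_integral => t; rewrite inE /= in_itv /= => tI.
  rewrite F'E; congr EFin; rewrite fctE /= /G.
  have cos0 : 0 <= cos t by apply: cos_ge0_pihalf.
  have FX : F t - a1 = rho * sin t by rewrite /F addrC addKr.
  have qE : q (F t) = rho * cos t.
    rewrite /q FX -rho2.
    have -> : rho ^+ 2 - (rho * sin t) ^+ 2 = (rho * cos t) ^+ 2.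
      by have := cos2Dsin2 t => E; rewrite !exprMn -[X in X - _]mulr1 -E; ring.
    by rewrite sqrtr_sqr ger0_norm // mulr_ge0 // ltW.
  by rewrite qE FX /f -rho2; field.
rewrite (@integral_is_derive R f P) //; last lra.
by rewrite /P sinN cosN sin_pihalf cos_pihalf; congr EFin; field.
Qed.

End DiscQuadratic.

(** * Mean value property of holomorphic functions *)

Section ComplexModulus.
Variable R : realType.
Local Notation C := R[i].
Implicit Types (z w : C) (t : R).

(** The norm of [R[i]] takes values in [R[i]], whose order is partial; estimates are carried out
    with this real-valued version. *)
Definition cabs z : R := complex.Re `|z|.

Lemma cabsE z : `|z| = (cabs z)%:C.
Proof. by rewrite /cabs normc_def. Qed.

Lemma cabs_lt z t : (`|z| < t%:C) = (cabs z < t).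
Proof. by rewrite cabsE ltcR. Qed.

Lemma cabs_ge0 z : 0 <= cabs z.
Proof. by have := normr_ge0 z; rewrite cabsE lecE /= => /andP[]. Qed.

Lemma cabs_gt0 z : (0 < cabs z) = (z != 0).
Proof. by rewrite -ltcR -cabsE normr_gt0. Qed.

Lemma cabs0 : cabs 0 = 0.
Proof. by rewrite /cabs normr0. Qed.

Lemma cabsM z w : cabs (z * w) = cabs z * cabs w.
Proof. by apply: complexI; rewrite rmorphM /= -!cabsE normrM. Qed.

Lemma cabsV z : cabs z^-1 = (cabs z)^-1.
Proof. by apply: complexI; rewrite fmorphV /= -!cabsE normfV. Qed.

Lemma cabsN z : cabs (- z) = cabs z.
Proof. by rewrite /cabs normrN. Qed.

Lemma cabsD z w : cabs (z + w) <= cabs z + cabs w.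
Proof. by rewrite -lecR rmorphD /= -!cabsE ler_normD. Qed.

Lemma cabsB z w : cabs (z - w) <= cabs z + cabs w.
Proof. by rewrite -(cabsN w); exact: cabsD. Qed.

Lemma cabsR t : cabs t%:C = `|t|.
Proof. by apply: complexI; rewrite -cabsE normc_def /= expr0n addr0 sqrtr_sqr. Qed.

Lemma cabsJ z : cabs (z^*%C) = cabs z.
Proof. by apply: complexI; rewrite -!cabsE normcJ. Qed.

Lemma cabs_sqr z : cabs z ^+ 2 = complex.Re z ^+ 2 + complex.Im z ^+ 2.
Proof. by apply: complexI; rewrite add_Re2_Im2 rmorphXn /= -cabsE. Qed.

Lemma Re_le_cabs z : `|complex.Re z| <= cabs z.
Proof. by rewrite -lecR -cabsE normc_ge_Re. Qed.

Lemma Im_le_cabs z : `|complex.Im z| <= cabs z.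
Proof.
rewrite -[leRHS]ger0_norm ?cabs_ge0 // -ler_sqr ?nnegrE ?normr_ge0 //.
by rewrite !real_normK ?num_real // cabs_sqr lerDr sqr_ge0.
Qed.

Lemma cabs_le_ReIm z : cabs z <= `|complex.Re z| + `|complex.Im z|.
Proof.
rewrite -ler_sqr ?nnegrE ?cabs_ge0 ?addr_ge0 // cabs_sqr sqrrD !real_normK ?num_real //.
by rewrite [leRHS]addrAC lerDl mulrn_wge0 // mulr_ge0.
Qed.

Lemma ReB z w : complex.Re (z - w) = complex.Re z - complex.Re w.
Proof. by case: z; case: w. Qed.
Lemma ImB z w : complex.Im (z - w) = complex.Im z - complex.Im w.
Proof. by case: z; case: w. Qed.
Lemma ReD z w : complex.Re (z + w) = complex.Re z + complex.Re w.
Proof. by case: z; case: w. Qed.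
Lemma ImD z w : complex.Im (z + w) = complex.Im z + complex.Im w.
Proof. by case: z; case: w. Qed.
Lemma ReM z w : complex.Re (z * w) =
  complex.Re z * complex.Re w - complex.Im z * complex.Im w.
Proof. by case: z; case: w. Qed.
Lemma ImM z w : complex.Im (z * w) =
  complex.Re z * complex.Im w + complex.Im z * complex.Re w.
Proof. by case: z; case: w. Qed.
Lemma ReJ z : complex.Re (z^*%C) = complex.Re z. Proof. by case: z. Qed.
Lemma ImJ z : complex.Im (z^*%C) = - complex.Im z. Proof. by case: z. Qed.
Lemma ReRM t z : complex.Re (t%:C * z) = t * complex.Re z.
Proof. by rewrite ReM /= mul0r subr0. Qed.
Lemma ImRM t z : complex.Im (t%:C * z) = t * complex.Im z.
Proof. by rewrite ImM /= mul0r addr0. Qed.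

End ComplexModulus.

(** * Wirtinger derivatives at a point *)

Section RealDifferentiability.
Variable R : realType.
Local Notation C := R[i].
Implicit Types (W f g : C -> C) (z h a b : C).

Definition ccont W z := forall e : R, 0 < e -> exists d : R, 0 < d /\
  forall h, cabs h < d -> cabs (W (z + h) - W z) < e.

(* W (z + h) = W z + a h + b h^* + o(|h|): a and b are the Wirtinger derivatives. *)
Definition rdiff W z a b := forall e : R, 0 < e -> exists d : R, 0 < d /\
  forall h, cabs h < d ->
    cabs (W (z + h) - W z - a * h - b * h^*%C) <= e * cabs h.

Lemma rdiff_bound W z a b : rdiff W z a b -> exists K : R, exists d : R,
  [/\ 0 < K, 0 < d & forall h, cabs h < d -> cabs (W (z + h) - W z) <= K * cabs h].
Proof.
move=> /(_ 1 ltr01)[d [d0 H]]; exists (1 + cabs a + cabs b), d.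
have := cabs_ge0 a; have := cabs_ge0 b => b0 a0.
split => //; first lra.
move=> h /H; rewrite mul1r => H1.
have -> : W (z + h) - W z =
  (W (z + h) - W z - a * h - b * h^*%C) + (a * h + b * h^*%C) by ring.
apply: (le_trans (cabsD _ _)).
have := cabsD (a * h) (b * h^*%C); rewrite !cabsM cabsJ.
by rewrite !mulrDl mul1r; lra.
Qed.

Lemma rdiff_ccont W z a b : rdiff W z a b -> ccont W z.
Proof.
move=> /rdiff_bound[K [d [K0 d0 H]]] e e0.
exists (Num.min d (e / K)); split; first by rewrite lt_min d0 divr_gt0.
move=> h; rewrite lt_min => /andP[/H hd]; rewrite ltr_pdivlMr // mulrC.
exact: le_lt_trans.
Qed.

Lemma ccontM f g z : ccont f z -> ccont g z -> ccont (fun x => f x * g x) z.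
Proof.
move=> cf cg e e0.
have k0 : 0 < cabs (f z) + 1 by have := cabs_ge0 (f z); lra.
have l0 : 0 < cabs (g z) + 1 by have := cabs_ge0 (g z); lra.
have [d1 [d10 fd]] := cf (Num.min 1 (e / (cabs (g z) + 1) / 2))
  ltac:(by rewrite lt_min ltr01 /= !divr_gt0).
have [d2 [d20 gd]] := cg (e / (cabs (f z) + 1) / 2)
  ltac:(by rewrite !divr_gt0).
exists (Num.min d1 d2); split; first by rewrite lt_min d10.
move=> h; rewrite !lt_min => /andP[/fd + /gd].
rewrite lt_min => /andP[h0 h1] h2.
have -> : f (z + h) * g (z + h) - f z * g z =
  f (z + h) * (g (z + h) - g z) + (f (z + h) - f z) * g z by ring.
apply: (le_lt_trans (cabsD _ _)); rewrite !cabsM.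
have hf : cabs (f (z + h)) <= cabs (f z) + 1.
  have := cabsD (f (z + h) - f z) (f z).
  by rewrite subrK; lra.
have e1 : (cabs (f z) + 1) * (e / (cabs (f z) + 1) / 2) = e / 2.
  by field; rewrite gt_eqF.
have e2 : (cabs (g z) + 1) * (e / (cabs (g z) + 1) / 2) = e / 2.
  by field; rewrite gt_eqF.
have h3 : cabs (f (z + h)) * cabs (g (z + h) - g z) <=
    (cabs (f z) + 1) * cabs (g (z + h) - g z).
  by apply: ler_wpM2r => //; exact: cabs_ge0.
have h4 : (cabs (f z) + 1) * cabs (g (z + h) - g z) < e / 2.
  by rewrite -e1 ltr_pM2l.
have h5 : cabs (f (z + h) - f z) * cabs (g z) <=
    (cabs (g z) + 1) * cabs (f (z + h) - f z).
  rewrite mulrC; apply: ler_wpM2r; first exact: cabs_ge0.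
  by rewrite lerDl.
have h6 : (cabs (g z) + 1) * cabs (f (z + h) - f z) < e / 2.
  by rewrite -e2 ltr_pM2l.
by move: h3 h4 h5 h6; clear; lra.
Qed.

Lemma rdiffM f g z a b a' b' : rdiff f z a b -> rdiff g z a' b' ->
  rdiff (fun x => f x * g x) z (a * g z + f z * a') (b * g z + f z * b').
Proof.
move=> rf rg e e0.
have [K [dK [K0 dK0 HK]]] := rdiff_bound rf.
have k0 : 0 < cabs (f z) + 1 by have := cabs_ge0 (f z); lra.
have l0 : 0 < cabs (g z) + 1 by have := cabs_ge0 (g z); lra.
have [d1 [d10 fd]] := rf (e / 3 / (cabs (g z) + 1)) ltac:(by rewrite !divr_gt0).
have [d2 [d20 gd]] := rg (e / 3 / (cabs (f z) + 1)) ltac:(by rewrite !divr_gt0).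
have e3K : 0 < e / 3 / K by rewrite !divr_gt0.
have [d3 [d30 gc]] := rdiff_ccont rg e3K.
exists (Num.min (Num.min d1 d2) (Num.min d3 dK)).
split; first by rewrite !lt_min d10 d20 d30.
move=> h; rewrite !lt_min => /andP[/andP[/fd h1 /gd h2] /andP[/gc h3 /HK h4]].
have -> : f (z + h) * g (z + h) - f z * g z - (a * g z + f z * a') * h -
    (b * g z + f z * b') * h^*%C =
  (f (z + h) - f z - a * h - b * h^*%C) * g z +
  f z * (g (z + h) - g z - a' * h - b' * h^*%C) +
  (f (z + h) - f z) * (g (z + h) - g z) by ring.
apply: (le_trans (cabsD _ _)).
have t := cabsD ((f (z + h) - f z - a * h - b * h^*%C) * g z)
  (f z * (g (z + h) - g z - a' * h - b' * h^*%C)).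
rewrite !cabsM in t *.
have hh := cabs_ge0 h.
have u1 : cabs (f (z + h) - f z - a * h - b * h^*%C) * cabs (g z) <= e / 3 * cabs h.
  apply: (@le_trans _ _ (e / 3 / (cabs (g z) + 1) * cabs h * (cabs (g z) + 1))).
    by apply: ler_pM; rewrite ?cabs_ge0 // lerDl.
  by rewrite mulrAC divfK // gt_eqF.
have u2 : cabs (f z) * cabs (g (z + h) - g z - a' * h - b' * h^*%C) <= e / 3 * cabs h.
  apply: (@le_trans _ _ ((cabs (f z) + 1) * (e / 3 / (cabs (f z) + 1) * cabs h))).
    by apply: ler_pM; rewrite ?cabs_ge0 // lerDl.
  by rewrite mulrA [X in X * cabs h]mulrC divfK // gt_eqF.
have u3 : cabs (f (z + h) - f z) * cabs (g (z + h) - g z) <= e / 3 * cabs h.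
  apply: (@le_trans _ _ (K * cabs h * (e / 3 / K))).
    by apply: ler_pM; rewrite ?cabs_ge0 // ltW.
  by rewrite mulrAC mulrC [K * _]mulrC divfK ?gt_eqF // mulrC.
by move: t u1 u2 u3; clear; lra.
Qed.

Lemma rdiff_quadratic W z a b (K r : R) : 0 <= K -> 0 < r ->
  (forall h, cabs h < r ->
     cabs (W (z + h) - W z - a * h - b * h^*%C) <= K * cabs h ^+ 2) ->
  rdiff W z a b.
Proof.
move=> K0 r0 H e e0; exists (Num.min r (e / (K + 1))).
have K1 : 0 < K + 1 by lra.
split; first by rewrite lt_min r0 divr_gt0.
move=> h; rewrite lt_min ltr_pdivlMr // => /andP[/H h1 h2].
apply: (le_trans h1); rewrite expr2 mulrA; apply: ler_wpM2r; first exact: cabs_ge0.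
by have := cabs_ge0 h; move: h2; rewrite mulrDr mulr1 mulrC; lra.
Qed.

Lemma rdiff_cderiv f z c : is_cderiv f z c -> rdiff f z c 0.
Proof.
move=> H e e0; have [d [d0 Hd]] := H e e0; exists d; split => // h hd.
rewrite mul0r subr0.
have [->|h0] := eqVneq h 0.
  by rewrite addr0 mulr0 subrr subr0 cabs0 mulr0.
have := Hd (z + h); rewrite addrAC subrr add0r normr_gt0 !cabs_lt => /(_ h0 hd).
have -> : f (z + h) - f z - c * h = ((f (z + h) - f z) / h - c) * h.
  by rewrite mulrBl divfK.
by rewrite cabsM => /ltW; apply: ler_wpM2r; exact: cabs_ge0.
Qed.

Lemma rdiff_local f g z a b (r : R) : 0 < r ->
  (forall h, cabs h < r -> f (z + h) = g (z + h)) ->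
  rdiff f z a b -> rdiff g z a b.
Proof.
move=> r0 E H e e0; have [d [d0 Hd]] := H e e0.
exists (Num.min d r); split; first by rewrite lt_min d0.
move=> h; rewrite lt_min => /andP[/Hd + hr].
by rewrite E // -[z in f z]addr0 E ?cabs0 // addr0.
Qed.

Lemma ccont_local f g z (r : R) : 0 < r ->
  (forall h, cabs h < r -> f (z + h) = g (z + h)) -> ccont f z -> ccont g z.
Proof.
move=> r0 E H e e0; have [d [d0 Hd]] := H e e0.
exists (Num.min d r); split; first by rewrite lt_min d0.
move=> h; rewrite lt_min => /andP[/Hd + hr].
by rewrite E // -[z in f z]addr0 E ?cabs0 // addr0.
Qed.

Lemma rdiff0 z : rdiff (fun=> 0) z 0 0.
Proof.
move=> e e0; exists 1; split => // h _.
by rewrite !mul0r !subr0 cabs0 mulr_ge0 ?cabs_ge0 // ltW.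
Qed.

Lemma rdiff_inv z (u : C) : z != u ->
  rdiff (fun x => (x - u)^-1) z (- (z - u)^-2) 0.
Proof.
move=> zu; have zu0 : z - u != 0 by rewrite subr_eq0.
have n0 : 0 < cabs (z - u) by rewrite cabs_gt0.
(* The remainder is h^2 / ((z - u)^2 (z + h - u)), and |z + h - u| >= |z - u| / 2 on this radius. *)
apply: (@rdiff_quadratic _ _ _ _ (2 / cabs (z - u) ^+ 3) (cabs (z - u) / 2)).
- by rewrite divr_ge0 // exprn_ge0 // ltW.
- by rewrite divr_gt0.
move=> h hh; rewrite mul0r subr0.
have lb : cabs (z - u) / 2 <= cabs (z + h - u).
  have := cabsB (z + h - u) h.
  by rewrite (_ : z + h - u - h = z - u); [lra|ring].
have zhu : z + h - u != 0 by rewrite -cabs_gt0; apply: lt_le_trans lb; rewrite divr_gt0.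
have -> : (z + h - u)^-1 - (z - u)^-1 - - (z - u)^-2 * h =
    h ^+ 2 / ((z - u) ^+ 2 * (z + h - u)).
  by field; rewrite zhu zu0.
rewrite expr2 !cabsM cabsV !cabsM -expr2 mulrC; apply: ler_wpM2r; first exact: sqr_ge0.
have -> : 2 / cabs (z - u) ^+ 3 = (cabs (z - u) ^+ 2 * (cabs (z - u) / 2))^-1.
  by field; rewrite gt_eqF.
rewrite lef_pV2 ?posrE ?mulr_gt0 ?exprn_gt0 ?divr_gt0 //; last first.
  by apply: lt_le_trans lb; rewrite divr_gt0.
by rewrite -expr2 ler_pM2l // exprn_gt0.
Qed.

(** The partial derivatives of W are a + b in x and i (a - b) in y. Together with the next lemma
    this shows that the field (Re W, - Im W) has divergence 2 Re b, so that only the antiholomorphic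
    derivative contributes. *)
Lemma rdiff_linear_approx_Re W (x y : R) a b : rdiff W (x +i* y) a b ->
  linear_approx (fun s t => complex.Re (W (s +i* t))) x y
    (complex.Re (a + b)) (- complex.Im (a - b)).
Proof.
move=> H e e0; have [d [d0 Hd]] := H e e0.
exists (d / 2); split; first by rewrite divr_gt0.
move=> x' y' hx hy.
pose h : C := (x' - x) +i* (y' - y).
have habs : cabs h <= `|x' - x| + `|y' - y| := cabs_le_ReIm h.
have := Hd h ltac:(by apply: (le_lt_trans habs); lra).
have -> : (x +i* y) + h = x' +i* y'.
  by apply/eqP; rewrite eq_complex /=; apply/andP; split; apply/eqP; ring.
move=> H1; apply: (@le_trans _ _ (e * cabs h)); last by rewrite ler_pM2l.
apply: (le_trans _ H1); apply: (le_trans _ (Re_le_cabs _)).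
rewrite le_eqVlt; apply/orP; left; apply/eqP; congr (`|_|).
rewrite !ReB !ReM ReJ ImJ ReD ImB /h /=; ring.
Qed.

Lemma rdiff_linear_approx_Im W (x y : R) a b : rdiff W (x +i* y) a b ->
  linear_approx (fun s t => - complex.Im (W (s +i* t))) x y
    (- complex.Im (a + b)) (- complex.Re (a - b)).
Proof.
move=> H e e0; have [d [d0 Hd]] := H e e0.
exists (d / 2); split; first by rewrite divr_gt0.
move=> x' y' hx hy.
pose h : C := (x' - x) +i* (y' - y).
have habs : cabs h <= `|x' - x| + `|y' - y| := cabs_le_ReIm h.
have := Hd h ltac:(by apply: (le_lt_trans habs); lra).
have -> : (x +i* y) + h = x' +i* y'.
  by apply/eqP; rewrite eq_complex /=; apply/andP; split; apply/eqP; ring.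
move=> H1; apply: (@le_trans _ _ (e * cabs h)); last by rewrite ler_pM2l.
apply: (le_trans _ H1); apply: (le_trans _ (Im_le_cabs _)).
rewrite le_eqVlt; apply/orP; left; apply/eqP; rewrite -normrN; congr (`|_|).
rewrite !ImB !ImM ReJ ImJ ImD ReB /h /=; ring.
Qed.

Lemma ccont_plane W : (forall z, ccont W z) ->
  continuous_plane (fun x y => complex.Re (W (x +i* y))) /\
  continuous_plane (fun x y => - complex.Im (W (x +i* y))).
Proof.
move=> cW; suff H x y e : 0 < e -> exists d : R, 0 < d /\ forall x' y',
    `|x' - x| < d -> `|y' - y| < d -> cabs (W (x' +i* y') - W (x +i* y)) < e.
  split=> x y e e0; have [d [d0 Hd]] := H x y e e0; exists d; split => // x' y' hx hy.
    by apply: le_lt_trans (Hd _ _ hx hy); rewrite -ReB; exact: Re_le_cabs.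
  apply: le_lt_trans (Hd _ _ hx hy).
  by rewrite -opprD normrN -ImB; exact: Im_le_cabs.
move=> e0; have [d [d0 Hd]] := cW (x +i* y) e e0.
exists (d / 2); split; first by rewrite divr_gt0.
move=> x' y' hx hy.
pose h : C := (x' - x) +i* (y' - y).
have habs : cabs h <= `|x' - x| + `|y' - y| := cabs_le_ReIm h.
have := Hd h ltac:(by apply: (le_lt_trans habs); lra).
rewrite (_ : (x +i* y) + h = x' +i* y') //.
by apply/eqP; rewrite eq_complex /=; apply/andP; split; apply/eqP; ring.
Qed.

End RealDifferentiability.

(** * Radial cutoffs and the truncated mean value property *)

Section MeanValue.
Variable R : realType.
Local Notation C := R[i].
Local Notation mu2 := (lebesgue_measure \x lebesgue_measure)%E.
Implicit Types (w : C -> C) (a z h : C).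

Definition sqd a z : R := cabs (z - a) ^+ 2.

Lemma sqd_sqdist a (x y : R) :
  sqd a (x +i* y) = sqdist (complex.Re a) (complex.Im a) x y.
Proof. by rewrite /sqd cabs_sqr ReB ImB. Qed.

Lemma sqdD a z h : sqd a (z + h) =
  sqd a z + 2 * complex.Re ((z - a)^*%C * h) + cabs h ^+ 2.
Proof.
rewrite /sqd !cabs_sqr; case: z => z1 z2; case: h => h1 h2; case: a => a1 a2 /=; ring.
Qed.

Definition cut (c : R) a z : R := Num.max 0 (c - sqd a z).

Lemma cut_ge0 c a z : 0 <= cut c a z.
Proof. by rewrite /cut le_max lexx. Qed.

Lemma cut0 c a z : c <= sqd a z -> cut c a z = 0.
Proof. by move=> h; rewrite /cut; apply/max_idPl; lra. Qed.

(** Squaring the positive part removes its corner at 0: this is why the cutoff enters squared in the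
    field to be differentiated. *)
Lemma maxr_sqr_approx (t k : R) :
  `|Num.max 0 (t + k) ^+ 2 - Num.max 0 t ^+ 2 - 2 * Num.max 0 t * k| <= k ^+ 2.
Proof.
by case: (leP 0 (t + k)) => ?; case: (leP 0 t) => ?;
  rewrite ler_norml; apply/andP; split; nra.
Qed.

Lemma cut_lip (t k : R) : `|Num.max 0 (t + k) - Num.max 0 t| <= `|k|.
Proof.
have k1 := ler_norm k.
have k3 : - k <= `|k| by rewrite -normrN ler_norm.
by case: (leP 0 (t + k)) => ?; case: (leP 0 t) => ?;
  rewrite ler_norml; apply/andP; split; lra.
Qed.

Lemma sqd_increment a z h : cabs h < 1 ->
  `|sqd a (z + h) - sqd a z| <= (2 * cabs (z - a) + 1) * cabs h.
Proof.
move=> h1; rewrite sqdD.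
have -> : sqd a z + 2 * complex.Re ((z - a)^*%C * h) + cabs h ^+ 2 - sqd a z =
  2 * complex.Re ((z - a)^*%C * h) + cabs h ^+ 2 by ring.
apply: (le_trans (ler_normD _ _)).
rewrite normrM ger0_norm // [`|cabs h ^+ 2|]ger0_norm ?sqr_ge0 //.
have := Re_le_cabs ((z - a)^*%C * h); rewrite cabsM cabsJ => h2.
have : cabs h ^+ 2 <= cabs h by rewrite expr2 ler_piMl ?cabs_ge0 // ltW.
by rewrite mulrDl mul1r; lra.
Qed.

Lemma ccont_cut c a z : ccont (fun x => (cut c a x)%:C) z.
Proof.
move=> e e0; pose K := 2 * cabs (z - a) + 1.
have K0 : 0 < K by rewrite /K; have := cabs_ge0 (z - a); lra.
exists (Num.min 1 (e / K)); split; first by rewrite lt_min ltr01 divr_gt0.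
move=> h; rewrite lt_min ltr_pdivlMr // => /andP[h1 h2].
rewrite -rmorphB /= cabsR.
have := cut_lip (c - sqd a z) (- (sqd a (z + h) - sqd a z)).
rewrite (_ : c - sqd a z - (sqd a (z + h) - sqd a z) = c - sqd a (z + h)); last ring.
move=> /le_lt_trans; apply; rewrite normrN.
by apply: le_lt_trans (sqd_increment _ _ h1) _; rewrite mulrC.
Qed.

Lemma rdiff_cut_sqr c a z : rdiff (fun x => (cut c a x ^+ 2)%:C) z
  ((- 2 * cut c a z)%:C * (z - a)^*%C) ((- 2 * cut c a z)%:C * (z - a)).
Proof.
pose K := 2 * cabs (z - a) + 1; pose T := cut c a z.
have K0 : 0 < K by rewrite /K; have := cabs_ge0 (z - a); lra.
have T0 : 0 <= T by exact: cut_ge0.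
apply: (@rdiff_quadratic R _ _ _ _ (K ^+ 2 + 2 * T) 1) => //.
  by have := sqr_ge0 K; lra.
move=> h h1; pose k := sqd a (z + h) - sqd a z.
have kE : k = 2 * complex.Re ((z - a)^*%C * h) + cabs h ^+ 2.
  by rewrite /k sqdD; ring.
have -> : (cut c a (z + h) ^+ 2)%:C - (cut c a z ^+ 2)%:C -
    (- 2 * cut c a z)%:C * (z - a)^*%C * h - (- 2 * cut c a z)%:C * (z - a) * h^*%C =
    (cut c a (z + h) ^+ 2 - T ^+ 2 - 2 * T * (- k) - 2 * T * cabs h ^+ 2)%:C.
  rewrite kE /T.
  by apply/eqP; rewrite eq_complex; case: h {h1 k kE} => h1 h2;
    case: (z - a) => z1 z2 /=; apply/andP; split; apply/eqP; ring.
rewrite cabsR; apply: (le_trans (ler_normB _ _)); rewrite [leRHS]mulrDl; apply: lerD.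
  have := maxr_sqr_approx (c - sqd a z) (- k).
  rewrite (_ : c - sqd a z - k = c - sqd a (z + h)); last by rewrite /k; ring.
  move=> /le_trans; apply; rewrite sqrrN -exprMn -[k ^+ 2]real_normK ?num_real //.
  rewrite ler_sqr ?nnegrE //; first exact: sqd_increment.
  by rewrite mulr_ge0 ?cabs_ge0 // ltW.
by rewrite ger0_norm // mulr_ge0 ?sqr_ge0 // mulr_ge0.
Qed.

Lemma disc_sqd a (rho : R) z : 0 < rho -> disc a rho z <-> sqd a z < rho ^+ 2.
Proof.
move=> r0; rewrite /disc /= cabs_lt /sqd.
by rewrite ltr_pXn2r // nnegrE ?cabs_ge0 // ltW.
Qed.

Lemma sqd_eventually_gt (c : R) a z : c < sqd a z -> exists r : R, 0 < r /\
  forall h, cabs h < r -> c < sqd a (z + h).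
Proof.
move=> cz; pose K := 2 * cabs (z - a) + 1.
have K0 : 0 < K by rewrite /K; have := cabs_ge0 (z - a); lra.
exists (Num.min 1 ((sqd a z - c) / K)).
split; first by rewrite lt_min ltr01 divr_gt0 // subr_gt0.
move=> h; rewrite lt_min ltr_pdivlMr // => /andP[h1 h2].
have := sqd_increment a z h1; rewrite -/K ler_norml => /andP[+ _].
by move: h2; rewrite mulrC; lra.
Qed.

(* Apply the divergence theorem to W = cut^2 w / (z - a): its antiholomorphic
   derivative is - 2 cut w, because that of |z - a|^2 is z - a. *)
Lemma holomorphic_mean_value w a (rho c : R) : 0 < rho -> 0 < c -> c < rho ^+ 2 ->
  holo_on (disc a rho) w -> w a = 0 ->
  continuous_plane (fun x y => cut c a (x +i* y) * complex.Re (w (x +i* y))) /\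
  \int[mu2]_(p in square (complex.Re a - rho) (complex.Im a - rho) (2 * rho))
     (cut c a (p.1 +i* p.2) * complex.Re (w (p.1 +i* p.2))) = 0.
Proof.
move=> r0 c0 cr hw wa.
have da : disc a rho a by apply/disc_sqd => //; rewrite /sqd subrr cabs0 expr0n exprn_gt0.
have [c' dw] := hw a da.
(* The value c' = w'(a) makes [v] continuous at [a]; differentiability there is not known, so [a] is
   the exceptional point of the divergence theorem. *)
pose v z := if z == a then c' else w z / (z - a).
pose W z := (cut c a z ^+ 2)%:C * v z.
(* Off the disc [w] is arbitrary, but c < rho^2 makes the cutoff vanish in a neighbourhood of each
   such point, boundary points included. *)
have far z : ~ disc a rho z -> exists r : R, 0 < r /\
    forall h, cabs h < r -> cut c a (z + h) = 0.
  move=> /(disc_sqd a z r0)/negP; rewrite -leNgt => hz.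
  have [r [r_gt0 Hr]] := sqd_eventually_gt (lt_le_trans cr hz).
  by exists r; split => // h /Hr /ltW /cut0.
have rW z : z != a -> exists al, rdiff W z al ((- 2 * cut c a z)%:C * w z).
  move=> za; have [dz|ndz] := pselect (disc a rho z); last first.
    have [r [r_gt0 Hr]] := far z ndz; exists 0.
    have -> : (- 2 * cut c a z)%:C * w z = 0.
      by have := Hr 0; rewrite cabs0 addr0 => -> //; rewrite mulr0 mul0r.
    apply: (@rdiff_local R (fun=> 0) _ _ _ _ r) => //; last exact: rdiff0.
    by move=> h /Hr hh; rewrite /W hh expr0n mul0r.
  have [cz dwz] := hw z dz.
  have rv := rdiffM (rdiff_cderiv dwz) (rdiff_inv za).
  have n0 : 0 < cabs (z - a) by rewrite cabs_gt0 subr_eq0.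
  have := rdiffM (rdiff_cut_sqr c a z) rv.
  set al := (X in rdiff _ _ X _); set be := (X in rdiff _ _ _ X) => rr.
  exists al.
  have -> : (- 2 * cut c a z)%:C * w z = be.
    by rewrite /be mul0r mulr0 addr0 mulr0 addr0; field; rewrite subr_eq0.
  apply: rdiff_local n0 _ rr => h hh; rewrite /W /v ifF //.
  apply/negbTE; apply: contraTneq hh => zh.
  by rewrite -leNgt -[X in cabs (z - X)]zh opprD addrA subrr sub0r cabsN.
have cW z : ccont W z.
  have [->|za] := eqVneq z a; last by have [al /rdiff_ccont] := rW z za.
  apply: ccontM.
    exact: rdiff_ccont (rdiff_cut_sqr c a a).
  move=> e e0; have [d [d0 Hd]] := dw e e0; exists d; split => // h hd.
  rewrite /v eqxx; case: eqP => [_|/eqP ha]; first by rewrite subrr cabs0.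
  have h0 : h != 0 by apply: contra_neq ha => ->; rewrite addr0.
  have := Hd (a + h); rewrite wa subr0 addrAC subrr add0r normr_gt0 !cabs_lt.
  exact.
have ck z : ccont (fun z => (cut c a z)%:C * w z) z.
  have [dz|ndz] := pselect (disc a rho z).
    have [cz dwz] := hw z dz.
    apply: ccontM; first exact: ccont_cut.
    exact: rdiff_ccont (rdiff_cderiv dwz).
  have [r [r_gt0 Hr]] := far z ndz.
  apply: (@ccont_local R (fun=> 0) _ _ r) => //.
    by move=> h /Hr hh; rewrite hh mul0r.
  exact: rdiff_ccont (rdiff0 z).
have [cA cB] := ccont_plane cW.
have kE : (fun x y => complex.Re ((cut c a (x +i* y))%:C * w (x +i* y))) =
   (fun x y => cut c a (x +i* y) * complex.Re (w (x +i* y))).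
  by apply/funext => x; apply/funext => y; rewrite ReRM.
have cK := (ccont_plane ck).1; rewrite kE in cK.
split => //.
(* The divergence is 2 Re b with b = - 2 cut w, whence - 4. *)
have cK4 := continuous_planeZ (- 4) cK.
have d_gt0 : 0 < 2 * rho by rewrite mulr_gt0.
pose x0 := complex.Re a - rho; pose y0 := complex.Im a - rho.
(* The sides of the square stay at distance at least rho from [a], so the field vanishes on them. *)
have Wout x y : rho ^+ 2 <= sqdist (complex.Re a) (complex.Im a) x y -> W (x +i* y) = 0.
  move=> h; rewrite /W cut0 ?expr0n ?mul0r // sqd_sqdist.
  exact: le_trans (ltW cr) h.
have := @divergence_square R _ _ _ x0 y0 (2 * rho) (complex.Re a) (complex.Im a)
  d_gt0 cA cB cK4.
have -> : \int[mu2]_(p in square x0 y0 (2 * rho))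
    (- 4 * (cut c a (p.1 +i* p.2) * complex.Re (w (p.1 +i* p.2)))) =
  - 4 * \int[mu2]_(p in square x0 y0 (2 * rho))
    (cut c a (p.1 +i* p.2) * complex.Re (w (p.1 +i* p.2))).
  apply: RintegralZl; first exact: measurable_square.
  exact: (continuous_plane_integrable_square x0 y0 cK d_gt0).
move=> H; suff /eqP : - 4 * \int[mu2]_(p in square x0 y0 (2 * rho))
    (cut c a (p.1 +i* p.2) * complex.Re (w (p.1 +i* p.2))) = 0.
  rewrite mulf_eq0 => /orP[|/eqP //].
  by rewrite oppr_eq0 pnatr_eq0.
apply: H.
- move=> x y xya; have za : x +i* y != a.
    by apply/eqP => E; apply: xya; rewrite -E.
  have [al r] := rW _ za.
  exists (complex.Re (al + (- 2 * cut c a (x +i* y))%:C * w (x +i* y))).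
  exists (- complex.Im (al - (- 2 * cut c a (x +i* y))%:C * w (x +i* y))).
  exists (- complex.Im (al + (- 2 * cut c a (x +i* y))%:C * w (x +i* y))).
  exists (- complex.Re (al - (- 2 * cut c a (x +i* y))%:C * w (x +i* y))).
  split; last split.
  + by rewrite ReB ReD !ReRM; ring.
  + exact: rdiff_linear_approx_Re.
  + exact: rdiff_linear_approx_Im.
- move=> t; rewrite !Wout //= /sqdist /x0.
    rewrite (_ : complex.Re a - rho + 2 * rho - complex.Re a = rho); last by ring.
    by rewrite lerDl sqr_ge0.
  rewrite (_ : complex.Re a - rho - complex.Re a = - rho); last by ring.
  by rewrite sqrrN lerDl sqr_ge0.
- move=> t; rewrite !Wout //= ?oppr0 // /sqdist /y0.
    rewrite (_ : complex.Im a - rho + 2 * rho - complex.Im a = rho); last by ring.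
    by rewrite lerDr sqr_ge0.
  rewrite (_ : complex.Im a - rho - complex.Im a = - rho); last by ring.
  by rewrite sqrrN lerDr sqr_ge0.
Qed.

(** Monotonicity is read off the supremum over simple functions that defines a non-negative
    integral; the squared norm of a section, for which only pointwise bounds are at hand, can thus
    stand on the right. *)
Lemma ge0_le_integral_patch d (T : measurableType d) (mu : {measure set T -> \bar R})
    (D1 D2 : set T) (f1 f2 : T -> \bar R) :
  (forall x, D1 x -> 0 <= f1 x)%E -> (forall x, D2 x -> 0 <= f2 x)%E ->
  (forall x, (f1 \_ D1) x <= (f2 \_ D2) x)%E ->
  (\int[mu]_(x in D1) f1 x <= \int[mu]_(x in D2) f2 x)%E.
Proof.
move=> f10 f20 f12; rewrite !ge0_integralE //.
apply: ereal_sup_le => _ [h hf <-]; exists h => //= x.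
exact: le_trans (hf x) (f12 x).
Qed.

(* The cutoff chi equals 1 on the disc of squared radius c and vanishes off the
   disc of squared radius (c + rho^2)/2; being a difference of two [cut]s,
   it integrates Re w to zero. *)
Lemma disc_integral_ge (S : C -> R) w a (rho c k l : R) :
  0 < rho -> 0 < c -> c < rho ^+ 2 ->
  holo_on (disc a rho) w -> w a = 0 ->
  (forall s : R, 0 <= s -> s < rho ^+ 2 -> 0 <= k + l * s) ->
  (forall z, disc a rho z -> 0 <= S z) ->
  (forall z, disc a rho z -> k + l * sqd a z + complex.Re (w z) <= S z) ->
  ((pi * k * c + pi * l * c ^+ 2 / 2)%R%:E <= disc_integral a rho S)%E.
Proof.
move=> r0 c0 cr hw wa kl S0 SG.
pose a1 := complex.Re a; pose a2 := complex.Im a.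
pose c' := (c + rho ^+ 2) / 2; pose eta := c' - c.
have eta0 : 0 < eta by rewrite /eta /c'; lra.
have c'0 : 0 < c' by rewrite /c'; lra.
have c'r : c' < rho ^+ 2 by rewrite /c'; lra.
have cc' : c < c' by rewrite /c'; lra.
have d_gt0 : 0 < 2 * rho by rewrite mulr_gt0.
pose Q := square (a1 - rho) (a2 - rho) (2 * rho).
have mQ : measurable Q by exact: measurable_square.
have [cI0 I0] := holomorphic_mean_value r0 c0 cr hw wa.
have [cI1 I1] := holomorphic_mean_value r0 c'0 c'r hw wa.
pose chi z := eta^-1 * (cut c' a z - cut c a z).
have chi01 z : 0 <= chi z <= 1.
  rewrite /chi /cut.
  case: (leP 0 (c' - sqd a z)) => ?; case: (leP 0 (c - sqd a z)) => ?; apply/andP;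
   (split; [by rewrite mulr_ge0 ?invr_ge0 ?(ltW eta0) //; lra|
            by rewrite mulrC ler_pdivrMr // mul1r /eta; lra]).
have chi1 z : sqd a z <= c -> chi z = 1.
  move=> h; rewrite /chi /cut.
  have -> : Num.max 0 (c' - sqd a z) = c' - sqd a z by apply/max_idPr; lra.
  have -> : Num.max 0 (c - sqd a z) = c - sqd a z by apply/max_idPr; lra.
  have -> : c' - sqd a z - (c - sqd a z) = eta by rewrite /eta; ring.
  by rewrite mulVf // gt_eqF.
have chi0 z : ~ disc a rho z -> chi z = 0.
  move=> /(disc_sqd a z r0)/negP; rewrite -leNgt => h.
  by rewrite /chi !cut0 ?subrr ?mulr0 //; lra.
have ccut cc : continuous_plane (fun x y => cut cc a (x +i* y)).
  by have := (ccont_plane (ccont_cut cc a)).1.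
have cchi : continuous_plane (fun x y => chi (x +i* y)).
  have := continuous_planeZ eta^-1 (continuous_planeD (ccut c')
    (continuous_planeZ (- 1) (ccut c))).
  congr continuous_plane; apply/funext => x; apply/funext => y.
  by rewrite /chi mulN1r.
have cq : continuous_plane (fun x y => k + l * sqd a (x +i* y)).
  apply: (@continuous_planeD R (fun _ _ => k)).
    by move=> ? ? e e0; exists 1; split => // ? ? _ _; rewrite subrr normr0.
  apply: continuous_planeZ.
  have := @continuous_sqdist R a1 a2; congr continuous_plane.
  by apply/funext => x; apply/funext => y; rewrite sqd_sqdist.
pose T1 x y := chi (x +i* y) * (k + l * sqd a (x +i* y)).
have cT1 : continuous_plane T1 by apply: continuous_planeM.
pose T2 x y := eta^-1 * (cut c' a (x +i* y) * complex.Re (w (x +i* y))) +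
  - eta^-1 * (cut c a (x +i* y) * complex.Re (w (x +i* y))).
have cT2 : continuous_plane T2.
  by apply: continuous_planeD; apply: continuous_planeZ.
pose T x y := T1 x y + T2 x y.
have cT : continuous_plane T by apply: continuous_planeD.
have TE x y : T x y = chi (x +i* y) *
    (k + l * sqd a (x +i* y) + complex.Re (w (x +i* y))).
  by rewrite /T /T1 /T2 /chi; ring.
have int f : continuous_plane f ->
    mu2.-integrable Q (EFin \o (fun p => f p.1 p.2)).
  by move=> cf; apply: continuous_plane_integrable_square.
have IT2 : \int[mu2]_(p in Q) T2 p.1 p.2 = 0.
  rewrite /T2 RintegralD; [|exact: mQ| |]; first last.
  - exact: (int _ (continuous_planeZ (- eta^-1) cI0)).
  - exact: (int _ (continuous_planeZ (eta^-1) cI1)).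
  rewrite !RintegralZl; [|exact: mQ|exact: (int _ cI0)|exact: mQ|exact: (int _ cI1)].
  by rewrite I0 I1 !mulr0 addr0.
have IT : \int[mu2]_(p in Q) T p.1 p.2 = \int[mu2]_(p in Q) T1 p.1 p.2.
  rewrite /T RintegralD; [|exact: mQ|exact: (int _ cT1)|exact: (int _ cT2)].
  by rewrite IT2 addr0.
have fT f : continuous_plane f ->
    (\int[mu2]_(p in Q) (f p.1 p.2)%:E = (\int[mu2]_(p in Q) f p.1 p.2)%R%:E)%E.
  move=> cf; rewrite /Rintegral fineK //.
  by apply: integrable_fin_num; [exact: mQ|exact: int].
apply: (@le_trans _ _ (\int[mu2]_(p in Q) (T1 p.1 p.2)%:E)%E).
  rewrite -(@integral_disc_quadratic R a1 a2 c k l) //; last first.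
    by move=> s s0 sc; apply: kl => //; apply: lt_trans cr.
  have dQ p : open_disc a1 a2 c p -> Q p.
    case: p => x y; rewrite /open_disc /sqdist /Q /square /= !in_itv /= => h.
    have hx : (x - a1) ^+ 2 < rho ^+ 2 by have := sqr_ge0 (y - a2); lra.
    have hy : (y - a2) ^+ 2 < rho ^+ 2 by have := sqr_ge0 (x - a1); lra.
    move: hx hy; rewrite !ltr_sqr_itv // => /andP[x1 x2] /andP[y1 y2].
    by clear -x1 x2 y1 y2; split; apply/andP; split; lra.
  have kl' (x y : R) : sqd a (x +i* y) < rho ^+ 2 -> 0 <= k + l * sqd a (x +i* y).
    by move=> h; apply: kl => //; exact: sqr_ge0.
  have T10 (x y : R) : 0 <= T1 x y.
    rewrite /T1; have [dz|/chi0 ->] := pselect (disc a rho (x +i* y)); last by rewrite mul0r.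
    apply: mulr_ge0; first by case/andP: (chi01 (x +i* y)).
    by apply: kl'; apply/disc_sqd.
  apply: ge0_le_integral_patch.
  - move=> [x y] /= h; rewrite lee_fin; apply: kl; first exact: sqdist_ge0.
    exact: lt_trans cr.
  - by move=> [x y] _; rewrite lee_fin.
  move=> [x y]; rewrite !patchE; case: ifPn => [|_].
    rewrite inE => dxy; rewrite ifT; last by rewrite inE; apply: dQ.
    rewrite lee_fin /T1 chi1 ?mul1r ?sqd_sqdist //.
    exact: ltW.
  by case: ifPn => // _; rewrite lee_fin.
(* Since [T2] has integral zero, [T1] may be replaced by [T], which is [chi] times the assumed lower
   bound of S. *)
rewrite fT // -IT -fT //.
(* [T] may be negative; its positive part is still below S on the disc, because 0 <= chi <= 1 and S
   >= 0, and it vanishes off the disc. *)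
apply: (@le_trans _ _ (\int[mu2]_(p in Q) (Num.max 0 (T p.1 p.2))%:E)%E).
  have cTp : continuous_plane (fun x y => Num.max 0 (T x y)).
    move=> x y e e0; have [d [d0 Hd]] := cT x y e e0; exists d; split => // x' y' hx hy.
    apply: le_lt_trans (Hd _ _ hx hy).
    have := cut_lip (T x y) (T x' y' - T x y).
    by rewrite [T x y + _]addrC subrK.
  rewrite fT // (fT _ cTp) lee_fin; apply: le_Rintegral.
  - exact: mQ.
  - exact: (int _ cT).
  - exact: (int _ cTp).
  - by move=> p _; rewrite le_max lexx orbT.
rewrite /disc_integral.
apply: ge0_le_integral_patch.
- by move=> p _; rewrite lee_fin le_max lexx.
- by move=> [x y] /= h; rewrite lee_fin; exact: S0.
move=> [x y]; rewrite !patchE.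
have [dz|ndz] := pselect (disc a rho (x +i* y)).
  rewrite [X in (_ <= X)%E]ifT ?inE //.
  case: ifPn => _; rewrite lee_fin; last exact: S0.
  rewrite ge_max S0 //= TE.
  have /andP[h0 h1] := chi01 (x +i* y).
  apply: (@le_trans _ _ (chi (x +i* y) * S (x +i* y))).
    by apply: ler_wpM2l => //; exact: SG.
  by apply: ler_piMl => //; exact: S0.
rewrite [X in (_ <= X)%E]ifF; last by apply/negbTE; rewrite notin_setE.
case: ifPn => _ //.
by rewrite lee_fin ge_max lexx /= TE chi0 // mul0r.
Qed.

End MeanValue.

(** * Second-order Taylor expansion in complex coordinates *)

Section DirectionalDerivatives.
Variable R : realType.
Local Notation C := R[i].
Implicit Types (f g : C -> C) (z v l : C) (U : set C).

Lemma is_derive_eps (F : R -> R) (s l : R) :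
  (forall e : R, 0 < e -> exists d : R, 0 < d /\ forall h, 0 < `|h| -> `|h| < d ->
    `|(F (s + h) - F s) / h - l| < e) ->
  is_derive s 1 F l.
Proof.
move=> Fl.
have cv : h^-1 *: ((F \o shift s) (h *: (1 : R)) - F s) @[h --> 0^'] --> l.
  apply/cvgrPdist_lt => e e0; have [d [d0 H]] := Fl e e0.
  apply/nbhs_ballP; exists d => //= h; rewrite /ball /= sub0r normrN => hd h0.
  have := H h; rewrite normr_gt0 => /(_ h0 hd).
  by rewrite distrC /shift /= [h *: 1]mulr1 [h + s]addrC mulrC.
apply: DeriveDef; first exact: cvgP cv.
exact: cvg_lim cv.
Qed.

Lemma is_dderiv_cabs f v z l : is_dderiv f v z l <->
  forall e : R, 0 < e -> exists d : R, 0 < d /\ forall t : R, 0 < `|t| -> `|t| < d ->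
    cabs ((f (z + t%:C * v) - f z) / t%:C - l) < e.
Proof.
split=> H e e0; have [d [d0 Hd]] := H e e0; exists d; split => // t t0 td.
  by rewrite -cabs_lt; exact: Hd.
by rewrite cabs_lt; exact: Hd.
Qed.

Lemma cabs_small_eq0 z : (forall e : R, 0 < e -> cabs z <= e) -> z = 0.
Proof.
move=> H; apply/eqP; apply: contraT; rewrite -cabs_gt0 => z0.
by have := H (cabs z / 2) ltac:(by rewrite divr_gt0); lra.
Qed.

Lemma is_dderiv_unique f v z l l' : is_dderiv f v z l -> is_dderiv f v z l' -> l = l'.
Proof.
move=> /is_dderiv_cabs H /is_dderiv_cabs H'; apply/eqP; rewrite -subr_eq0; apply/eqP.
apply: cabs_small_eq0 => e e0.
have [d [d0 Hd]] := H (e / 2) ltac:(by rewrite divr_gt0).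
have [d' [d'0 Hd']] := H' (e / 2) ltac:(by rewrite divr_gt0).
pose t := Num.min d d' / 2.
have m0 : 0 < Num.min d d' by rewrite lt_min d0.
have t0 : 0 < t by rewrite divr_gt0.
have td : t < Num.min d d' by rewrite /t; lra.
move: (td); rewrite lt_min => /andP[td1 td2].
have := Hd t; have := Hd' t; rewrite !gtr0_norm // => /(_ t0 td2) h2 /(_ t0 td1) h1.
set q := (f (z + t%:C * v) - f z) / t%:C in h1 h2.
have -> : l - l' = (q - l') - (q - l) by ring.
by apply: (le_trans (cabsB _ _)); lra.
Qed.

Lemma dderivE f v z l : is_dderiv f v z l -> dderiv f v z = l.
Proof.
move=> H; have := xgetPex 0 (ex_intro _ l H).
by rewrite -/(dderiv f v z) => H'; exact: is_dderiv_unique H' H.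
Qed.

Lemma is_dderivD f g v z l l' : is_dderiv f v z l -> is_dderiv g v z l' ->
  is_dderiv (fun x => f x + g x) v z (l + l').
Proof.
move=> /is_dderiv_cabs H /is_dderiv_cabs H'; apply/is_dderiv_cabs => e e0.
have [d [d0 Hd]] := H (e / 2) ltac:(by rewrite divr_gt0).
have [d' [d'0 Hd']] := H' (e / 2) ltac:(by rewrite divr_gt0).
exists (Num.min d d'); split; first by rewrite lt_min d0.
move=> t t0; rewrite lt_min => /andP[/(Hd t t0) h1 /(Hd' t t0) h2].
have tn : t%:C != 0 :> C by rewrite (fmorph_eq0 (real_complex R)) -normr_gt0.
have -> : (f (z + t%:C * v) + g (z + t%:C * v) - (f z + g z)) / t%:C - (l + l') =
  ((f (z + t%:C * v) - f z) / t%:C - l) + ((g (z + t%:C * v) - g z) / t%:C - l').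
  by field.
by apply: (le_lt_trans (cabsD _ _)); lra.
Qed.

Lemma is_dderivZ (k : C) f v z l : is_dderiv f v z l ->
  is_dderiv (fun x => k * f x) v z (k * l).
Proof.
move=> /is_dderiv_cabs H; apply/is_dderiv_cabs => e e0.
have k0 : 0 < cabs k + 1 by have := cabs_ge0 k; lra.
have [d [d0 Hd]] := H (e / (cabs k + 1)) ltac:(by rewrite divr_gt0).
exists d; split => // t t0 /(Hd t t0); rewrite ltr_pdivlMr // => h.
have tn : t%:C != 0 :> C by rewrite (fmorph_eq0 (real_complex R)) -normr_gt0.
have -> : (k * f (z + t%:C * v) - k * f z) / t%:C - k * l =
  k * ((f (z + t%:C * v) - f z) / t%:C - l) by field.
rewrite cabsM; apply: le_lt_trans h; rewrite mulrC.
by apply: ler_wpM2l; [exact: cabs_ge0|rewrite lerDl].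
Qed.

Lemma smooth_is_dderiv U f (l : seq bool) b z : smooth_on U f -> U z ->
  is_dderiv (diter l f) (dirC R b) z (diter (b :: l) f z).
Proof.
move=> sf Uz; have [/(_ b)[d Hd] _] := sf l z Uz.
by rewrite /= (dderivE Hd).
Qed.

Lemma is_dderiv_is_derive (L : C -> R) f v z l (s : R) :
  (forall x y, L (x - y) = L x - L y) -> (forall (t : R) x, L (t%:C * x) = t * L x) ->
  (forall x, `|L x| <= cabs x) ->
  is_dderiv f v (z + s%:C * v) l ->
  is_derive s 1 (fun t => L (f (z + t%:C * v))) (L l).
Proof.
move=> LB LZ Lb /is_dderiv_cabs H; apply: is_derive_eps => e e0.
have [d [d0 Hd]] := H e e0; exists d; split => // h h0 hd.
apply: le_lt_trans (Hd h h0 hd).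
have hn : h != 0 by rewrite -normr_gt0.
have -> : (L (f (z + (s + h)%:C * v)) - L (f (z + s%:C * v))) / h - L l =
   L ((f (z + s%:C * v + h%:C * v) - f (z + s%:C * v)) / h%:C - l).
  rewrite LB -[_ / h%:C]mulrC -fmorphV LZ LB mulrC.
  by rewrite rmorphD /= mulrDl addrA.
exact: Lb.
Qed.

(** The mean value theorem fails for complex values, so it is applied after a real-linear [L],
    namely the real or the imaginary part. Taking d = 0 gives the first-order estimate, general d
    the second-order one. *)
Lemma dderiv_mvt_functional (L : C -> R) f v z (T e : R) (g : R -> C) (c d : C) :
  (forall x y, L (x - y) = L x - L y) -> (forall (t : R) x, L (t%:C * x) = t * L x) ->
  (forall x, `|L x| <= cabs x) ->
  (forall s : R, `|s| <= `|T| -> is_dderiv f v (z + s%:C * v) (g s)) ->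
  (forall s, `|s| <= `|T| -> cabs (g s - c - s%:C * d) <= e) ->
  `|L (f (z + T%:C * v) - f z - T%:C * c - (T ^+ 2 / 2)%:C * d)| <= e * `|T|.
Proof.
move=> LB LZ Lb df ge.
(* Subtracting the quadratic polynomial makes the derivative of [phi] exactly the quantity bounded
   by [e]. *)
pose phi s := L (f (z + s%:C * v)) - (L c * s + L d / 2 * (s * s)).
have dphi (s : R) : `|s| <= `|T| -> is_derive s 1 phi (L (g s - c - s%:C * d)).
  move=> sT; have h := is_dderiv_is_derive LB LZ Lb (df s sT).
  have h1 := is_derive_mulE (is_derive_cstE (L c) s) (is_derive_idE s).
  have h2 := is_derive_mulE (is_derive_cstE (L d / 2) s)
    (is_derive_mulE (is_derive_idE s) (is_derive_idE s)).
  apply: (is_derive_eq (is_derive_subE h (is_derive_addE h1 h2))).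
  by rewrite !LB LZ; field.
have -> : L (f (z + T%:C * v) - f z - T%:C * c - (T ^+ 2 / 2)%:C * d) = phi T - phi 0.
  by rewrite /phi !LB !LZ rmorph0 mul0r addr0; field.
have mvt (p q : R) : p <= q -> (forall s, p <= s <= q -> `|s| <= `|T|) ->
    `|phi q - phi p| <= e * (q - p).
  move=> pq H.
  have dphi' s : s \in `]p, q[ -> is_derive s 1 phi (L (g s - c - s%:C * d)).
    by move=> /subset_itv_oo_cc; rewrite in_itv /= => sI; apply/dphi/H.
  have cphi : {within `[p, q], continuous phi}.
    apply: derivable_within_continuous => s; rewrite in_itv /= => sI.
    by case: (dphi s (H s sI)).
  have [c0 c0I ->] := MVT_segment pq dphi' cphi.
  rewrite normrM [`|q - p|]ger0_norm ?subr_ge0 //.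
  apply: ler_wpM2r; first by rewrite subr_ge0.
  by apply: (le_trans (Lb _)); apply/ge/H; move: c0I; rewrite in_itv.
have [T0|T0] := leP 0 T.
  rewrite [X in _ <= e * X]ger0_norm // -[X in _ <= e * X]subr0; apply: mvt => //.
  by move=> s /andP[s0 sT]; rewrite !ger0_norm.
rewrite distrC [X in _ <= e * X]ltr0_norm // -[X in _ <= e * X]sub0r; apply: mvt.
  exact: ltW.
move=> s /andP[sT s0]; rewrite [leRHS]ltr0_norm // ler0_norm // lerN2.
by [].
Qed.

(** The factor 2 comes from bounding the modulus by the sum of the real and imaginary parts. *)
Lemma dderiv_mvt f v z (T e : R) (g : R -> C) (c d : C) :
  (forall s : R, `|s| <= `|T| -> is_dderiv f v (z + s%:C * v) (g s)) ->
  (forall s, `|s| <= `|T| -> cabs (g s - c - s%:C * d) <= e) ->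
  cabs (f (z + T%:C * v) - f z - T%:C * c - (T ^+ 2 / 2)%:C * d) <= 2 * e * `|T|.
Proof.
move=> df ge; apply: (le_trans (cabs_le_ReIm _)).
have := dderiv_mvt_functional (@ReB R) (@ReRM R) (@Re_le_cabs R) df ge.
have := dderiv_mvt_functional (@ImB R) (@ImRM R) (@Im_le_cabs R) df ge.
by move=> h1 h2; rewrite -mulrA mulr_natl mulr2n; exact: lerD.
Qed.

Lemma cabs_dirC b : cabs (dirC R b) = 1.
Proof.
apply/eqP; rewrite -(@eqrXn2 _ 2) ?cabs_ge0 // cabs_sqr expr1n; apply/eqP.
by case: b; rewrite /= expr1n expr0n ?addr0 ?add0r.
Qed.

(** The point is reached by moving t along [v], then s along [u], with second derivatives compared
    to their values at [a] by continuity. The mixed term is the derivative along [v] of the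
    derivative along [u]; leaving [b] free gives both orders. *)
Lemma taylor_directions U f a b : open_set U -> smooth_on U f -> U a ->
  forall e : R, 0 < e -> exists delta : R, 0 < delta /\ forall s t : R,
  `|s| < delta -> `|t| < delta ->
  cabs (f (a + s%:C * dirC R b + t%:C * dirC R (~~ b)) -
    (f a + s%:C * diter [:: b] f a + t%:C * diter [:: ~~ b] f a +
     (s ^+ 2 / 2)%:C * diter [:: b; b] f a + (s * t)%:C * diter [:: ~~ b; b] f a +
     (t ^+ 2 / 2)%:C * diter [:: ~~ b; ~~ b] f a)) <= e * (`|s| + `|t|) ^+ 2.
Proof.
move=> oU sf Ua e e0; set u := dirC R b; set v := dirC R (~~ b).
have [r [r0 rU]] := oU a Ua.
have e40 : 0 < e / 4 by rewrite divr_gt0.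
have cont (l : seq bool) : exists d : R, 0 < d /\ forall z, U z -> cabs (z - a) < d ->
    cabs (diter l f z - diter l f a) <= e / 4.
  have [_ H] := sf l a Ua; have [d [d0 Hd]] := H _ e40.
  exists d; split => // z Uz zd; apply: ltW.
  by rewrite -cabs_lt; apply: Hd => //; rewrite cabs_lt.
have [d1 [d10 H1]] := cont [:: b; b].
have [d2 [d20 H2]] := cont [:: ~~ b; b].
have [d3 [d30 H3]] := cont [:: ~~ b; ~~ b].
pose m := Num.min (Num.min r d1) (Num.min d2 d3).
have m0 : 0 < m by rewrite !lt_min r0 d10 d20 d30.
exists (m / 2); split; first by rewrite divr_gt0.
move=> s t sm tm.
have near p q : `|p| <= `|s| -> `|q| <= `|t| ->
    let z := a + q%:C * v + p%:C * u in
    [/\ U z, cabs (z - a) < d1, cabs (z - a) < d2 & cabs (z - a) < d3].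
  move=> ps qt z.
  have : cabs (z - a) < m.
    have -> : z - a = q%:C * v + p%:C * u by rewrite /z; ring.
    apply: (le_lt_trans (cabsD _ _)).
    by rewrite !cabsM !cabs_dirC !mulr1 !cabsR; lra.
  rewrite !lt_min => /andP[/andP[zr zd1] /andP[zd2 zd3]]; split => //.
  by apply: rU; rewrite /disc /= cabs_lt.
have pt0 q : a + q%:C * v + 0%:C * u = a + q%:C * v by rewrite rmorph0 mul0r addr0.
have s00 : `|0 : R| <= `|s| by rewrite normr0.
have B1 q : `|q| <= `|t| ->
    cabs (diter [:: ~~ b] f (a + q%:C * v) - diter [:: ~~ b] f a -
      q%:C * diter [:: ~~ b; ~~ b] f a) <= e / 2 * `|q|.
  move=> qt; have := @dderiv_mvt (diter [:: ~~ b] f) v a q (e / 4)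
    (fun x => diter [:: ~~ b; ~~ b] f (a + x%:C * v)) (diter [:: ~~ b; ~~ b] f a) 0.
  rewrite mulr0 subr0 (_ : 2 * (e / 4) = e / 2); last by field.
  apply=> x xq; have [Ux _ _ x3] := near 0 x s00 (le_trans xq qt); rewrite pt0 in Ux x3.
    exact: (@smooth_is_dderiv U f [:: ~~ b] (~~ b)).
  by rewrite mulr0 subr0; exact: H3.
have A1 : cabs (f (a + t%:C * v) - f a - t%:C * diter [:: ~~ b] f a -
    (t ^+ 2 / 2)%:C * diter [:: ~~ b; ~~ b] f a) <= e * `|t| * `|t|.
  have := @dderiv_mvt f v a t (e / 2 * `|t|) (fun x => diter [:: ~~ b] f (a + x%:C * v))
    (diter [:: ~~ b] f a) (diter [:: ~~ b; ~~ b] f a).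
  rewrite (_ : 2 * (e / 2 * `|t|) * `|t| = e * `|t| * `|t|); last by field.
  apply=> x xt.
    have [Ux _ _ _] := near 0 x s00 xt; rewrite pt0 in Ux.
    exact: (@smooth_is_dderiv U f [::] (~~ b)).
  apply: (le_trans (B1 x xt)); apply: ler_wpM2l => //; lra.
have A2 : cabs (diter [:: b] f (a + t%:C * v) - diter [:: b] f a -
    t%:C * diter [:: ~~ b; b] f a) <= e / 2 * `|t|.
  have := @dderiv_mvt (diter [:: b] f) v a t (e / 4)
    (fun x => diter [:: ~~ b; b] f (a + x%:C * v)) (diter [:: ~~ b; b] f a) 0.
  rewrite mulr0 subr0 (_ : 2 * (e / 4) = e / 2); last by field.
  apply=> x xt; have [Ux _ x2 _] := near 0 x s00 xt; rewrite pt0 in Ux x2.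
    exact: (@smooth_is_dderiv U f [:: b] (~~ b)).
  by rewrite mulr0 subr0; exact: H2.
set z := a + t%:C * v in A1 A2.
have B3 p : `|p| <= `|s| ->
    cabs (diter [:: b] f (z + p%:C * u) - diter [:: b] f z -
      p%:C * diter [:: b; b] f a) <= e / 2 * `|p|.
  move=> ps; have := @dderiv_mvt (diter [:: b] f) u z p (e / 4)
    (fun x => diter [:: b; b] f (z + x%:C * u)) (diter [:: b; b] f a) 0.
  rewrite mulr0 subr0 (_ : 2 * (e / 4) = e / 2); last by field.
  apply=> x xp; have [Ux x1 _ _] := near x t (le_trans xp ps) (lexx _).
    exact: (@smooth_is_dderiv U f [:: b] b).
  by rewrite mulr0 subr0; exact: H1.
have A4 : cabs (f (z + s%:C * u) - f z - s%:C * diter [:: b] f z -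
    (s ^+ 2 / 2)%:C * diter [:: b; b] f a) <= e * `|s| * `|s|.
  have := @dderiv_mvt f u z s (e / 2 * `|s|) (fun x => diter [:: b] f (z + x%:C * u))
    (diter [:: b] f z) (diter [:: b; b] f a).
  rewrite (_ : 2 * (e / 2 * `|s|) * `|s| = e * `|s| * `|s|); last by field.
  apply=> x xs.
    have [Ux _ _ _] := near x t xs (lexx _).
    exact: (@smooth_is_dderiv U f [::] b).
  apply: (le_trans (B3 x xs)); apply: ler_wpM2l => //; lra.
have A2' : cabs (s%:C * (diter [:: b] f z - diter [:: b] f a -
    t%:C * diter [:: ~~ b; b] f a)) <= e / 2 * `|t| * `|s|.
  by rewrite cabsM cabsR mulrC; apply: ler_wpM2r.
have -> : a + s%:C * u + t%:C * v = z + s%:C * u by rewrite /z; ring.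
set E1 := f z - f a - _ - _ in A1; set E2 := s%:C * _ in A2'.
set E4 := f (z + s%:C * u) - _ - _ - _ in A4.
set X := (X in cabs X <= _).
(* [E4] is the error of the leg along [u], [E2] the error from transporting the [u]-derivative back
   to [a], [E1] the error of the leg along [v]. *)
have -> : X = E4 + E2 + E1.
  by rewrite /X /E1 /E2 /E4 [(s * t)%:C]rmorphM /=; ring.
apply: (le_trans (cabsD _ _)); have := cabsD E4 E2.
have s0 := normr_ge0 s; have t0 := normr_ge0 t.
have st : 0 <= `|s| * `|t| by rewrite mulr_ge0.
have est : 0 <= e * (`|s| * `|t|) by rewrite mulr_ge0 // ltW.
have -> : e * (`|s| + `|t|) ^+ 2 = e * `|s| * `|s| + 2 * (e * (`|s| * `|t|)) + e * `|t| * `|t|.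
  by ring.
have E : e / 2 * `|t| * `|s| = (e * (`|s| * `|t|)) / 2 by field.
by move: A1 A2' A4 est; rewrite E; clear; lra.
Qed.

(** On the diagonal s = t = x the two orders of [taylor_directions] expand f at the same point and
    differ only in the mixed term. Each error is (e / 8) (2 x)^2, so after division by x^2 the mixed
    derivatives differ by at most e. *)
Lemma mixed_derivative_sym U f a : open_set U -> smooth_on U f -> U a ->
  diter [:: true; false] f a = diter [:: false; true] f a.
Proof.
move=> oU sf Ua; apply/eqP; rewrite -subr_eq0; apply/eqP; apply: cabs_small_eq0 => e e0.
have e80 : 0 < e / 8 by rewrite divr_gt0.
have [d1 [d10 H1]] := taylor_directions false oU sf Ua e80.
have [d2 [d20 H2]] := taylor_directions true oU sf Ua e80.
pose x := Num.min d1 d2 / 2.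
have m0 : 0 < Num.min d1 d2 by rewrite lt_min d10.
have x0 : 0 < x by rewrite divr_gt0.
have xm : x < Num.min d1 d2 by rewrite /x; lra.
move: (xm); rewrite lt_min => /andP[x1 x2].
have := H1 x x; have := H2 x x; rewrite !(gtr0_norm x0) => /(_ x2 x2) h2 /(_ x1 x1) h1.
rewrite /= in h1 h2.
move: h1 h2; rewrite [a + x%:C * 'i + _]addrAC.
set p := f (a + _ + _); set A := diter _ _ _.
set fx := dderiv f 1 a; set fy := dderiv f 'i a.
set fxx := dderiv (dderiv f 1) 1 a; set fyy := dderiv (dderiv f 'i) 'i a.
set X1 := (X in cabs X <= _ -> _) => h1; set X2 := (X in cabs X <= _ -> _) => h2.
have E : (x * x)%:C * (dderiv (dderiv f 1) 'i a - dderiv (dderiv f 'i) 1 a) = X2 - X1.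
  by rewrite /X1 /X2; ring.
move: X1 X2 h1 h2 E => X1 X2 h1 h2 E.
have : cabs (X2 - X1) <= e * x ^+ 2.
  apply: (le_trans (cabsB _ _)).
  have -> : e * x ^+ 2 = e / 8 * (x + x) ^+ 2 + e / 8 * (x + x) ^+ 2 by field.
  exact: lerD h2 h1.
rewrite -E cabsM cabsR -expr2 ger0_norm ?sqr_ge0 // mulrC ler_pM2r //.
by rewrite exprn_gt0.
Qed.

(** A quarter of the Laplacian: the mixed derivatives cancel by symmetry. *)
Lemma dzb_dz U f a : open_set U -> smooth_on U f -> U a ->
  dzb (dz f) a = (diter [:: false; false] f a + diter [:: true; true] f a) / 4%:R.
Proof.
move=> oU sf Ua.
have dd b : is_dderiv (dz f) (dirC R b) a
    (2%:R^-1 * (diter [:: b; false] f a + - 'i * diter [:: b; true] f a)).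
  have h := is_dderivZ (2%:R^-1) (is_dderivD (@smooth_is_dderiv U f [:: false] b a sf Ua)
    (is_dderivZ (- 'i) (@smooth_is_dderiv U f [:: true] b a sf Ua))).
  have -> : dz f = (fun x => 2%:R^-1 * (diter [:: false] f x + - 'i * diter [:: true] f x)).
    by apply/funext => x; rewrite /dz /= mulrC mulNr.
  exact: h.
rewrite /dzb (dderivE (dd false)) (dderivE (dd true)).
rewrite (mixed_derivative_sym oU sf Ua).
have i2 : 'i * 'i = -1 :> C by rewrite -expr2 sqr_i.
set A := diter [:: false; false] f a; set B := diter [:: false; true] f a.
set D := diter [:: true; true] f a.
have -> : 'i * (2%:R^-1 * (B + - 'i * D)) = 2%:R^-1 * ('i * B - ('i * 'i) * D) by ring.
by rewrite i2; field.
Qed.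

(** The second-order Taylor polynomial in h = s + I t and its conjugate: the coefficients of the
    squares are half the pure second Wirtinger derivatives, and that of |h|^2 is a quarter of the
    Laplacian. *)
Lemma wirtinger_quadratic (I s t fa fx fy fxx fxy fyy : C) : I ^+ 2 = -1 ->
  fa + (fx - I * fy) / 2 * (s + I * t) + (fx + I * fy) / 2 * (s - I * t) +
  (fxx - fyy - 2 * I * fxy) / 8 * (s + I * t) ^+ 2 +
  (fxx - fyy + 2 * I * fxy) / 8 * (s - I * t) ^+ 2 +
  (fxx + fyy) / 4 * (s ^+ 2 + t ^+ 2) =
  fa + s * fx + t * fy + s * s / 2 * fxx + s * t * fxy + t * t / 2 * fyy.
Proof. by move=> i2; field : i2. Qed.

(** [B] and [B'] stay unspecified: the terms that they produce have real parts that will be absorbed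
    in the holomorphic w. Only the coefficient of |h|^2 carries curvature. *)
Lemma taylor_complex U f a : open_set U -> smooth_on U f -> U a ->
  exists B B' : C, forall e : R, 0 < e -> exists delta : R, 0 < delta /\
  forall h, cabs h < delta ->
  cabs (f (a + h) - (f a + dz f a * h + dzb f a * h^*%C + B * h ^+ 2 +
    B' * (h^*%C) ^+ 2 + dzb (dz f) a * (cabs h ^+ 2)%:C)) <= e * cabs h ^+ 2.
Proof.
move=> oU sf Ua.
pose fxx := diter [:: false; false] f a; pose fyy := diter [:: true; true] f a.
pose fxy := diter [:: true; false] f a.
exists ((fxx - fyy - 2 * 'i * fxy) / 8%:R), ((fxx - fyy + 2 * 'i * fxy) / 8%:R) => e e0.
have e40 : 0 < e / 4 by rewrite divr_gt0.
have [d [d0 H]] := taylor_directions false oU sf Ua e40.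
exists d; split => // h hd.
have := H (complex.Re h) (complex.Im h) (le_lt_trans (Re_le_cabs h) hd)
  (le_lt_trans (Im_le_cabs h) hd).
have -> : a + (complex.Re h)%:C * dirC R false + (complex.Im h)%:C * dirC R (~~ false) =
    a + h.
  by rewrite /= mulr1 [_ * 'i]mulrC -addrA -complexE.
move=> H1.
have -> : f a + dz f a * h + dzb f a * h^*%C + (fxx - fyy - 2 * 'i * fxy) / 8%:R * h ^+ 2 +
   (fxx - fyy + 2 * 'i * fxy) / 8%:R * (h^*%C) ^+ 2 + dzb (dz f) a * (cabs h ^+ 2)%:C =
   f a + (complex.Re h)%:C * diter [:: false] f a +
   (complex.Im h)%:C * diter [:: ~~ false] f a +
   (complex.Re h ^+ 2 / 2)%:C * diter [:: false; false] f a +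
   (complex.Re h * complex.Im h)%:C * diter [:: ~~ false; false] f a +
   (complex.Im h ^+ 2 / 2)%:C * diter [:: ~~ false; ~~ false] f a.
  rewrite (dzb_dz oU sf Ua) cabs_sqr /dz /dzb.
  rewrite -[diter [:: false] f a]/(dderiv f 1 a) -[diter [:: ~~ false] f a]/(dderiv f 'i a).
  rewrite -/fxx -/fxy -/fyy.
  set fx := dderiv f 1 a; set fy := dderiv f 'i a.
  have hE : h = (complex.Re h)%:C + 'i * (complex.Im h)%:C := complexE h.
  have hJ : h^*%C = (complex.Re h)%:C - 'i * (complex.Im h)%:C.
    by case: (h) => h1 h2; apply/eqP; rewrite eq_complex /=; apply/andP; split;
      apply/eqP; ring.
  rewrite !rmorphM !rmorphD !rmorphXn !fmorphV /= !rmorph_nat.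
  have i2 : 'i ^+ 2 = -1 :> C by rewrite sqr_i.
  have := wirtinger_quadratic (complex.Re h)%:C (complex.Im h)%:C (f a) fx fy fxx fxy fyy i2.
  by rewrite -hE -hJ.
apply: (le_trans H1); rewrite -mulrA ler_pM2l // ler_pdivrMl //.
have hh : `|complex.Re h| + `|complex.Im h| <= 2 * cabs h.
  by have := Re_le_cabs h; have := Im_le_cabs h; lra.
have -> : 4 * cabs h ^+ 2 = (2 * cabs h) ^+ 2 by ring.
by rewrite ler_sqr // nnegrE ?addr_ge0 // mulr_ge0 // cabs_ge0.
Qed.

End DirectionalDerivatives.

(** * Chern curvature in a local frame *)

Section LimitsAtZero.
Variable R : realType.
Local Notation C := R[i].
Implicit Types (F G : R -> C).

Definition lim0 F (l : C) := forall e : R, 0 < e -> exists d : R, 0 < d /\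
  forall t : R, 0 < `|t| -> `|t| < d -> cabs (F t - l) < e.

Lemma lim0_cst l : lim0 (fun=> l) l.
Proof. by move=> e e0; exists 1; split => // t _ _; rewrite subrr cabs0. Qed.

Lemma lim0_near F G l (r : R) : 0 < r ->
  (forall t, 0 < `|t| -> `|t| < r -> F t = G t) -> lim0 F l -> lim0 G l.
Proof.
move=> r0 E H e e0; have [d [d0 Hd]] := H e e0.
exists (Num.min d r); split; first by rewrite lt_min d0.
by move=> t t0; rewrite lt_min => /andP[td tr]; rewrite -E //; exact: Hd.
Qed.

Lemma lim0D F G l m : lim0 F l -> lim0 G m -> lim0 (fun t => F t + G t) (l + m).
Proof.
move=> H H' e e0.
have e2 : 0 < e / 2 by rewrite divr_gt0.
have [d [d0 Hd]] := H _ e2; have [d' [d'0 Hd']] := H' _ e2.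
exists (Num.min d d'); split; first by rewrite lt_min d0.
move=> t t0; rewrite lt_min => /andP[/(Hd t t0) h1 /(Hd' t t0) h2].
have -> : F t + G t - (l + m) = (F t - l) + (G t - m) by ring.
by apply: (le_lt_trans (cabsD _ _)); lra.
Qed.

Lemma lim0M F G l m : lim0 F l -> lim0 G m -> lim0 (fun t => F t * G t) (l * m).
Proof.
move=> cf cg e e0.
have k0 : 0 < cabs l + 1 by have := cabs_ge0 l; lra.
have l0 : 0 < cabs m + 1 by have := cabs_ge0 m; lra.
have [d1 [d10 fd]] := cf (Num.min 1 (e / (cabs m + 1) / 2))
  ltac:(by rewrite lt_min ltr01 /= !divr_gt0).
have [d2 [d20 gd]] := cg (e / (cabs l + 1) / 2)
  ltac:(by rewrite !divr_gt0).
exists (Num.min d1 d2); split; first by rewrite lt_min d10.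
move=> t t0; rewrite !lt_min => /andP[/(fd t t0) + /(gd t t0)].
rewrite lt_min => /andP[h0 h1] h2.
have -> : F t * G t - l * m = F t * (G t - m) + (F t - l) * m by ring.
apply: (le_lt_trans (cabsD _ _)); rewrite !cabsM.
have hf : cabs (F t) <= cabs l + 1.
  by have := cabsD (F t - l) l; rewrite subrK; lra.
have e1 : (cabs l + 1) * (e / (cabs l + 1) / 2) = e / 2.
  by field; rewrite gt_eqF.
have e2 : (cabs m + 1) * (e / (cabs m + 1) / 2) = e / 2.
  by field; rewrite gt_eqF.
have h3 : cabs (F t) * cabs (G t - m) <= (cabs l + 1) * cabs (G t - m).
  by apply: ler_wpM2r => //; exact: cabs_ge0.
have h4 : (cabs l + 1) * cabs (G t - m) < e / 2.
  by rewrite -e1 ltr_pM2l.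
have h5 : cabs (F t - l) * cabs m <= (cabs m + 1) * cabs (F t - l).
  rewrite mulrC; apply: ler_wpM2r; first exact: cabs_ge0.
  by rewrite lerDl.
have h6 : (cabs m + 1) * cabs (F t - l) < e / 2.
  by rewrite -e2 ltr_pM2l.
by move: h3 h4 h5 h6; clear; lra.
Qed.

Lemma lim0V F l : l != 0 -> lim0 F l -> lim0 (fun t => (F t)^-1) l^-1.
Proof.
move=> ln0 H e e0; have l0 : 0 < cabs l by rewrite cabs_gt0.
have [d [d0 Hd]] := H (Num.min (cabs l / 2) (e * (cabs l ^+ 2 / 2)))
  ltac:(by rewrite lt_min !divr_gt0 //= mulr_gt0 // divr_gt0 // exprn_gt0).
exists d; split => // t t0 /(Hd t t0); rewrite lt_min => /andP[h1 h2].
have lb : cabs l / 2 <= cabs (F t).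
  by have := cabsB (F t) (F t - l); rewrite (_ : F t - (F t - l) = l); [lra|ring].
have F0 : F t != 0 by rewrite -cabs_gt0; apply: lt_le_trans lb; rewrite divr_gt0.
have -> : (F t)^-1 - l^-1 = - (F t - l) / (F t * l) by field; rewrite ln0 F0.
rewrite cabsM cabsN cabsV cabsM ltr_pdivrMr; last by rewrite mulr_gt0 // cabs_gt0.
apply: (lt_le_trans h2); rewrite ler_pM2l // expr2.
have -> : cabs l * cabs l / 2 = cabs l / 2 * cabs l by field.
by apply: ler_wpM2r => //; exact: ltW.
Qed.

Lemma lim0_sum (I : Type) (r : seq I) (F : I -> R -> C) (l : I -> C) :
  (forall i, lim0 (F i) (l i)) ->
  lim0 (fun t => \sum_(i <- r) F i t) (\sum_(i <- r) l i).
Proof.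
move=> H; elim: r => [|i r IH].
  by rewrite big_nil; apply: (@lim0_near (fun=> 0) _ _ 1) => //;
    [move=> t _ _; rewrite big_nil|exact: lim0_cst].
rewrite big_cons; apply: (@lim0_near (fun t => F i t + \sum_(j <- r) F j t) _ _ 1) => //.
  by move=> t _ _; rewrite big_cons.
exact: lim0D.
Qed.

Lemma lim0_prod (I : Type) (r : seq I) (F : I -> R -> C) (l : I -> C) :
  (forall i, lim0 (F i) (l i)) ->
  lim0 (fun t => \prod_(i <- r) F i t) (\prod_(i <- r) l i).
Proof.
move=> H; elim: r => [|i r IH].
  by rewrite big_nil; apply: (@lim0_near (fun=> 1) _ _ 1) => //;
    [move=> t _ _; rewrite big_nil|exact: lim0_cst].
rewrite big_cons; apply: (@lim0_near (fun t => F i t * \prod_(j <- r) F j t) _ _ 1) => //.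
  by move=> t _ _; rewrite big_cons.
exact: lim0M.
Qed.

Lemma lim0_is_dderiv f v z l :
  is_dderiv f v z l <-> lim0 (fun t => (f (z + t%:C * v) - f z) / t%:C) l.
Proof. exact: is_dderiv_cabs. Qed.

Definition mxlim0 (m n : nat) (A : R -> 'M[C]_(m, n)) (L : 'M[C]_(m, n)) :=
  forall i j, lim0 (fun t => A t i j) (L i j).

Lemma mxlim0M (m n p : nat) (A : R -> 'M[C]_(m, n)) (B : R -> 'M[C]_(n, p)) L M :
  mxlim0 A L -> mxlim0 B M -> mxlim0 (fun t => A t *m B t) (L *m M).
Proof.
move=> HA HB i j; rewrite mxE.
apply: (@lim0_near (fun t => \sum_k A t i k * B t k j) _ _ 1) => //.
  by move=> t _ _; rewrite mxE.
by apply: lim0_sum => k; apply: lim0M.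
Qed.

Lemma mxlim0D (m n : nat) (A B : R -> 'M[C]_(m, n)) L M :
  mxlim0 A L -> mxlim0 B M -> mxlim0 (fun t => A t + B t) (L + M).
Proof.
move=> HA HB i j; rewrite mxE.
apply: (@lim0_near (fun t => A t i j + B t i j) _ _ 1) => //.
  by move=> t _ _; rewrite mxE.
exact: lim0D (HA i j) (HB i j).
Qed.

Lemma lim0_det n (A : R -> 'M[C]_n) L : mxlim0 A L ->
  lim0 (fun t => \det (A t)) (\det L).
Proof.
move=> H; rewrite /determinant; apply: lim0_sum => s; apply: lim0M; first exact: lim0_cst.
by apply: lim0_prod => i; exact: H.
Qed.

(** Cramer's rule: the entries of the inverse are cofactors divided by the determinant, hence
    rational in the entries. *)
Lemma mxlim0_invmx n (A : R -> 'M[C]_n) L (r : R) : 0 < r -> L \in unitmx ->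
  (forall t, `|t| < r -> A t \in unitmx) -> mxlim0 A L ->
  mxlim0 (fun t => invmx (A t)) (invmx L).
Proof.
move=> r0 uL uA H i j.
have -> : invmx L i j = (\det L)^-1 * cofactor L j i by rewrite /invmx uL !mxE.
apply: (@lim0_near (fun t => (\det (A t))^-1 * cofactor (A t) j i) _ _ r) => //.
  by move=> t _ /uA uAt; rewrite /invmx uAt !mxE.
apply: lim0M; first by apply: lim0V; [rewrite -unitfE -unitmxE|exact: lim0_det].
apply: lim0M; first exact: lim0_cst.
apply: lim0_det => p q; rewrite !mxE.
apply: (@lim0_near (fun t => A t (lift j p) (lift i q)) _ _ 1) => //.
by move=> t _ _; rewrite !mxE.
Qed.

End LimitsAtZero.

Section Adjoint.
Variable R : realType.
Local Notation C := R[i].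

Lemma conjcB (x y : C) : (x - y)^*%C = x^*%C - y^*%C.
Proof. exact: (rmorphB (@conjc R)). Qed.

Lemma conjcD (x y : C) : (x + y)^*%C = x^*%C + y^*%C.
Proof. exact: (rmorphD (@conjc R)). Qed.

Lemma conjcM (x y : C) : (x * y)^*%C = x^*%C * y^*%C.
Proof. exact: (rmorphM (@conjc R)). Qed.

Lemma adjmxE m n (A : 'M[C]_(m, n)) i j : adjmx A i j = (A j i)^*%C.
Proof. by rewrite !mxE. Qed.

Lemma adjmxK m n (A : 'M[C]_(m, n)) : adjmx (adjmx A) = A.
Proof. by apply/matrixP => i j; rewrite !adjmxE conjcK. Qed.

Lemma adjmxM m n p (A : 'M[C]_(m, n)) (B : 'M[C]_(n, p)) :
  adjmx (A *m B) = adjmx B *m adjmx A.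
Proof. by rewrite /adjmx map_mxM trmx_mul. Qed.

Lemma adjmxD m n (A B : 'M[C]_(m, n)) : adjmx (A + B) = adjmx A + adjmx B.
Proof. by apply/matrixP => i j; rewrite !(adjmxE, mxE) rmorphD. Qed.

Lemma adjmxN m n (A : 'M[C]_(m, n)) : adjmx (- A) = - adjmx A.
Proof. by apply/matrixP => i j; rewrite !(adjmxE, mxE) rmorphN. Qed.

Lemma adjmxZ m n (k : C) (A : 'M[C]_(m, n)) : adjmx (k *: A) = k^*%C *: adjmx A.
Proof. by apply/matrixP => i j; rewrite !(adjmxE, mxE) rmorphM. Qed.

Lemma adjmx1 n : adjmx (1%:M : 'M[C]_n) = 1%:M.
Proof. by apply/matrixP => i j; rewrite adjmxE !mxE rmorph_nat eq_sym. Qed.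

Lemma adjmx_invmx n (A : 'M[C]_n) : A \in unitmx -> adjmx A = A ->
  adjmx (invmx A) = invmx A.
Proof.
move=> uA hA; have : adjmx (invmx A) *m A = 1%:M.
  by rewrite -{2}hA -adjmxM mulmxV // adjmx1.
by move=> E; rewrite -[LHS]mulmx1 -(mulmxV uA) mulmxA E mul1mx.
Qed.

Lemma posdef_unitmx n (A : 'M[C]_n) :
  (forall v : 'cV[C]_n, v != 0 -> 0 < (adjmx v *m A *m v) ord0 ord0) -> A \in unitmx.
Proof.
move=> pA; rewrite -unitmx_tr -row_free_unit -kermx_eq0; apply: contraT.
move=> /rowV0Pn[v /sub_kermxP vA v0].
have vT0 : v^T != 0 by apply: contra_neq v0 => E; rewrite -[v]trmxK E trmx0.
have := pA _ vT0; rewrite -mulmxA.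
have -> : A *m v^T = 0 by rewrite -[A]trmxK -trmx_mul vA trmx0.
by rewrite mulmx0 mxE ltxx.
Qed.

End Adjoint.

(** * The Chern connection and its antiholomorphic derivative *)

Section ChernCurvature.
Variable R : realType.
Local Notation C := R[i].
Variables (r : nat) (U : set C) (H : C -> 'M[C]_r) (a : C).
Hypotheses (oU : open_set U) (Ua : U a).
Hypothesis smoothH : forall p q, smooth_on U (fun z => H z p q).

Lemma entries_dderiv (l : seq bool) b p q :
  is_dderiv (diter l (fun z => H z p q)) (dirC R b) a
    (diter (b :: l) (fun z => H z p q) a).
Proof. exact: smooth_is_dderiv. Qed.

Lemma dz_is_dderiv f b : smooth_on U f ->
  is_dderiv (dz f) (dirC R b) a (dderiv (dz f) (dirC R b) a).
Proof.
move=> sf.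
have h := is_dderivZ (2%:R^-1) (is_dderivD (@smooth_is_dderiv R U f [:: false] b a sf Ua)
    (is_dderivZ (- 'i) (@smooth_is_dderiv R U f [:: true] b a sf Ua))).
have E : dz f = (fun x => 2%:R^-1 * (diter [:: false] f x + - 'i * diter [:: true] f x)).
  by apply/funext => x; rewrite /dz /= mulrC mulNr.
by rewrite E (dderivE h).
Qed.

Lemma dir_in_U b : exists d : R, 0 < d /\
  forall t : R, `|t| < d -> U (a + t%:C * dirC R b).
Proof.
have [d [d0 dU]] := oU Ua; exists d; split => // t td; apply: dU.
by rewrite /disc /= addrAC subrr add0r cabs_lt cabsM cabs_dirC mulr1 cabsR.
Qed.

(** The inverse is never differentiated: with X = H(a)^-1 dz H(a), the difference quotient is
    H(w)^-1 times (the quotient of dz H minus the quotient of H times X), so continuity of the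
    inverse suffices. *)
Lemma connection_dderiv : (forall z, U z -> H z \in unitmx) ->
  forall b p q, is_dderiv (fun w => (invmx (H w) *m dz_mx H w) p q) (dirC R b) a
  ((invmx (H a) *m (\matrix_(j, k) dderiv (dz (fun w => H w j k)) (dirC R b) a -
     (\matrix_(j, k) dderiv (fun w => H w j k) (dirC R b) a) *m
       (invmx (H a) *m dz_mx H a))) p q).
Proof.
move=> uH b p q; apply/lim0_is_dderiv.
have [d [d0 dU]] := dir_in_U b.
pose w (t : R) := a + t%:C * dirC R b.
pose X := invmx (H a) *m dz_mx H a.
have HX : H a *m X = dz_mx H a by rewrite /X mulKVmx // uH.
pose Y t : 'M[C]_r := t%:C^-1 *: (dz_mx H (w t) - dz_mx H a).
pose W t : 'M[C]_r := (- 1) *: (t%:C^-1 *: (H (w t) - H a)).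
pose Z t : 'M[C]_r := Y t + W t *m X.
apply: (@lim0_near R (fun t => (invmx (H (w t)) *m Z t) p q) _ _ d) => //.
  move=> t t0 td; have uw := uH _ (dU t td).
  have -> : invmx (H (w t)) *m Z t =
      t%:C^-1 *: (invmx (H (w t)) *m dz_mx H (w t) - X).
    rewrite /Z /Y /W scaleN1r mulNmx -scalemxAl -scalerBr -scalemxAr; congr (_ *: _).
    rewrite mulmxBl HX opprB addrA subrK mulmxBr.
    by rewrite (mulKmx uw).
  by rewrite !mxE mulrC.
have HI : mxlim0 (fun t => invmx (H (w t))) (invmx (H a)).
  apply: (@mxlim0_invmx R r _ _ d) => //; first exact: uH.
    by move=> t td; exact/uH/dU.
  move=> j k e e0; have [_ cH] := smoothH j k [::] Ua.
  have [d' [d'0 Hd']] := cH e e0; exists (Num.min d d').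
  split; first by rewrite lt_min d0.
  move=> t t0; rewrite lt_min => /andP[td td']; rewrite -cabs_lt; apply: Hd'.
    exact: dU.
  by rewrite addrAC subrr add0r cabs_lt cabsM cabs_dirC mulr1 cabsR.
have HY : mxlim0 Y (\matrix_(j, k) dderiv (dz (fun w => H w j k)) (dirC R b) a).
  move=> j k; have /lim0_is_dderiv h := dz_is_dderiv b (smoothH j k).
  rewrite mxE; apply: (lim0_near ltr01 _ h) => t _ _.
  by rewrite /Y !mxE mulrC.
have HW : mxlim0 W ((- 1) *: \matrix_(j, k) dderiv (fun w => H w j k) (dirC R b) a).
  move=> j k; have /lim0_is_dderiv h := entries_dderiv [::] b j k.
  rewrite !mxE; apply: (lim0_near ltr01 _ (lim0M (lim0_cst (- 1)) h)) => t _ _.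
  by rewrite /W !mxE /= [t%:C^-1 * _]mulrC.
have HX0 : mxlim0 (fun _ : R => X) X by move=> ? ?; exact: lim0_cst.
have := mxlim0M HI (mxlim0D HY (mxlim0M HW HX0)).
by rewrite scaleN1r mulNmx; apply.
Qed.

Lemma dzb_connection : (forall z, U z -> H z \in unitmx) ->
  dzb_mx (fun w => invmx (H w) *m dz_mx H w) a =
  invmx (H a) *m (dzb_mx (dz_mx H) a - dzb_mx H a *m (invmx (H a) *m dz_mx H a)).
Proof.
move=> uH; pose X := invmx (H a) *m dz_mx H a.
pose Y b := \matrix_(j, k) dderiv (dz (fun w => H w j k)) (dirC R b) a.
pose K b := \matrix_(j, k) dderiv (fun w => H w j k) (dirC R b) a.
have -> : dzb_mx (dz_mx H) a = 2%:R^-1 *: (Y false + 'i *: Y true).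
  apply/matrixP => j k; rewrite !mxE.
  have -> : (fun w => dz_mx H w j k) = dz (fun w => H w j k).
    by apply/funext => w; rewrite mxE.
  by rewrite /dzb mulrC.
have -> : dzb_mx H a = 2%:R^-1 *: (K false + 'i *: K true).
  by apply/matrixP => j k; rewrite !mxE /dzb mulrC.
have -> : 2%:R^-1 *: (Y false + 'i *: Y true) - 2%:R^-1 *: (K false + 'i *: K true) *m X =
   2%:R^-1 *: ((Y false - K false *m X) + 'i *: (Y true - K true *m X)).
  rewrite -scalemxAl -scalerBr; congr (_ *: _); rewrite mulmxDl -scalemxAl.
  by rewrite scalerBr opprD addrACA.
rewrite -scalemxAr mulmxDr -scalemxAr.
apply/matrixP => p q; rewrite mxE /dzb.
have cd b : dderiv (fun w => (invmx (H w) *m dz_mx H w) p q) (dirC R b) a =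
    (invmx (H a) *m (Y b - K b *m X)) p q.
  exact: dderivE (connection_dderiv uH b p q).
rewrite (cd false) (cd true).
rewrite mulrC [RHS]mxE; congr (_ * _); rewrite [RHS]mxE; congr (_ + _).
by rewrite [RHS]mxE.
Qed.

Hypothesis hermH : forall z, U z -> adjmx (H z) = H z.

(** Conjugation commutes with derivatives along real increments. The induction runs over all points
    of [U], since each derivative involves neighbouring points. *)
Lemma diter_conj (l : seq bool) p q z : U z ->
  diter l (fun w => H w p q) z = (diter l (fun w => H w q p) z)^*%C.
Proof.
elim: l z => [|b l IH] z Uz /=.
  by rewrite -{1}(hermH Uz) adjmxE.
apply: dderivE.
have := @smooth_is_dderiv R U _ l b z (smoothH q p) Uz; rewrite /= => /lim0_is_dderiv h.
apply/lim0_is_dderiv.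
have [d [d0 dU]] := oU Uz.
move=> e e0; have [d' [d'0 Hd']] := h e e0; exists (Num.min d d').
split; first by rewrite lt_min d0.
move=> t t0; rewrite lt_min => /andP[td td'].
have Uw : U (z + t%:C * dirC R b).
  by apply: dU; rewrite /disc /= addrAC subrr add0r cabs_lt cabsM cabs_dirC mulr1 cabsR.
have := Hd' t t0 td'; rewrite -cabsJ.
by rewrite conjcB conjcM conjcB -!IH // conjc_inv conjc_real.
Qed.

Lemma dzb_adj : dzb_mx H a = adjmx (dz_mx H a).
Proof.
apply/matrixP => j k; rewrite adjmxE !mxE /dzb /dz.
have h b := @diter_conj [:: b] j k a Ua; rewrite /= in h.
rewrite (h false) (h true) conjcM conjcB conjcM conjc_inv conjc_nat.
by congr (_ / _); congr (_ + _); rewrite -mulNr; congr (_ * _);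
  apply/eqP; rewrite eq_complex /= oppr0 opprK !eqxx.
Qed.

Lemma dzb_dz_herm : adjmx (dzb_mx (dz_mx H) a) = dzb_mx (dz_mx H) a.
Proof.
have E j k : dzb_mx (dz_mx H) a j k = dzb (dz (fun w => H w j k)) a.
  rewrite mxE; congr (dzb _ a); apply/funext => w; by rewrite mxE.
apply/matrixP => j k; rewrite adjmxE !E !(dzb_dz oU (smoothH _ _) Ua).
rewrite conjcM conjcD conjc_inv conjc_nat.
have h b := @diter_conj [:: b; b] j k a Ua.
by rewrite (h false) (h true).
Qed.

End ChernCurvature.

(** * Lower bound for the squared norm of a section *)

Section MatrixNorm.
Variable R : realType.
Local Notation C := R[i].

(** The entrywise sum norm is submultiplicative and invariant under the adjoint. *)
Definition mnorm m n (A : 'M[C]_(m, n)) : R := \sum_i \sum_j cabs (A i j).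

Lemma mnorm_ge0 m n (A : 'M[C]_(m, n)) : 0 <= mnorm A.
Proof. by apply: sumr_ge0 => i _; apply: sumr_ge0 => j _; exact: cabs_ge0. Qed.

Lemma cabs_le_mnorm m n (A : 'M[C]_(m, n)) i j : cabs (A i j) <= mnorm A.
Proof.
rewrite /mnorm (bigD1 i) //= (bigD1 j) //= -addrA lerDl addr_ge0 //.
  by apply: sumr_ge0 => k _; exact: cabs_ge0.
by apply: sumr_ge0 => k _; apply: sumr_ge0 => l _; exact: cabs_ge0.
Qed.

Lemma mnormD m n (A B : 'M[C]_(m, n)) : mnorm (A + B) <= mnorm A + mnorm B.
Proof.
rewrite /mnorm -big_split /=; apply: ler_sum => i _.
by rewrite -big_split /=; apply: ler_sum => j _; rewrite mxE cabsD.
Qed.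

Lemma mnormZ m n (k : C) (A : 'M[C]_(m, n)) : mnorm (k *: A) = cabs k * mnorm A.
Proof.
rewrite /mnorm mulr_sumr; apply: eq_bigr => i _; rewrite mulr_sumr.
by apply: eq_bigr => j _; rewrite mxE cabsM.
Qed.

Lemma mnorm_adj m n (A : 'M[C]_(m, n)) : mnorm (adjmx A) = mnorm A.
Proof.
rewrite /mnorm exchange_big /=; apply: eq_bigr => i _; apply: eq_bigr => j _.
by rewrite adjmxE cabsJ.
Qed.

Lemma cabs_sum (I : Type) (s : seq I) (F : I -> C) :
  cabs (\sum_(i <- s) F i) <= \sum_(i <- s) cabs (F i).
Proof.
elim: s => [|i s IH]; first by rewrite !big_nil cabs0.
by rewrite !big_cons; apply: (le_trans (cabsD _ _)); rewrite lerD2l.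
Qed.

Lemma mnormM m n p (A : 'M[C]_(m, n)) (B : 'M[C]_(n, p)) :
  mnorm (A *m B) <= mnorm A * mnorm B.
Proof.
rewrite {1 2}/mnorm mulr_suml; apply: ler_sum => i _.
apply: (@le_trans _ _ (\sum_j \sum_k cabs (A i k) * cabs (B k j))).
  apply: ler_sum => j _; rewrite mxE; apply: (le_trans (cabs_sum _ _)).
  by apply: ler_sum => k _; rewrite cabsM.
rewrite exchange_big /= mulr_suml; apply: ler_sum => k _.
rewrite -mulr_sumr; apply: ler_wpM2l; first exact: cabs_ge0.
rewrite [leRHS](bigD1 k) //= lerDl.
by apply: sumr_ge0 => l _; apply: sumr_ge0 => j _; exact: cabs_ge0.
Qed.

Lemma mnorm_le m n (A : 'M[C]_(m, n)) (e : R) : (forall i j, cabs (A i j) <= e) ->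
  mnorm A <= e * (m * n)%:R.
Proof.
move=> Ae; apply: (@le_trans _ _ (\sum_(i < m) \sum_(j < n) e)).
  by apply: ler_sum => i _; apply: ler_sum.
by rewrite !sumr_const !card_ord -mulrnA mulnC mulr_natr.
Qed.

Lemma cabs_mulmx_le n (x : 'rV[C]_n) (y : 'cV[C]_n) :
  cabs ((x *m y) ord0 ord0) <= mnorm x * mnorm y.
Proof. exact: le_trans (cabs_le_mnorm _ _ _) (mnormM _ _). Qed.

Lemma finite_radius (T : finType) (Q : T -> C -> Prop) :
  (forall i, exists d : R, 0 < d /\ forall h, cabs h < d -> Q i h) ->
  exists d : R, 0 < d /\ forall h, cabs h < d -> forall i, Q i h.
Proof.
move=> H; suff [d [d0 Hd]] : exists d : R, 0 < d /\
    forall h, cabs h < d -> forall i, i \in enum T -> Q i h.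
  by exists d; split => // h hd i; apply: Hd => //; rewrite mem_enum.
elim: (enum T) => [|i s [d [d0 Hd]]]; first by exists 1.
have [d' [d'0 Hd']] := H i; exists (Num.min d d'); split; first by rewrite lt_min d0.
move=> h; rewrite lt_min => /andP[hd hd'] j; rewrite inE => /predU1P[->|js].
  exact: Hd'.
exact: Hd.
Qed.

Lemma adjmx_form n (M : 'M[C]_n) (x y : 'cV[C]_n) : adjmx M = M ->
  (adjmx y *m M *m x) ord0 ord0 = ((adjmx x *m M *m y) ord0 ord0)^*%C.
Proof.
by move=> hM; rewrite -adjmxE !adjmxM adjmxK hM mulmxA.
Qed.

Lemma Re_formD n (M : 'M[C]_n) (x y : 'cV[C]_n) : adjmx M = M ->
  complex.Re ((adjmx (x + y) *m M *m (x + y)) ord0 ord0) =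
  complex.Re ((adjmx x *m M *m x) ord0 ord0) +
  2 * complex.Re ((adjmx x *m M *m y) ord0 ord0) +
  complex.Re ((adjmx y *m M *m y) ord0 ord0).
Proof.
move=> hM; rewrite adjmxD !mulmxDl !mulmxDr.
have -> : forall X1 X2 X3 X4 : 'M[C]_1, complex.Re ((X1 + X2 + (X3 + X4)) ord0 ord0) =
    complex.Re (X1 ord0 ord0) + complex.Re (X2 ord0 ord0) +
    complex.Re (X3 ord0 ord0) + complex.Re (X4 ord0 ord0).
  by move=> X1 X2 X3 X4; rewrite !mxE !ReD; ring.
by rewrite (adjmx_form x y hM) ReJ; ring.
Qed.

Definition pairing n (u : 'rV[C]_n) (v : 'cV[C]_n) : C := (u *m v) ord0 ord0.

Lemma pairingDl n (u1 u2 : 'rV[C]_n) v :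
  pairing (u1 + u2) v = pairing u1 v + pairing u2 v.
Proof. by rewrite /pairing mulmxDl mxE. Qed.

Lemma pairingZl n c (u : 'rV[C]_n) v : pairing (c *: u) v = c * pairing u v.
Proof. by rewrite /pairing -scalemxAl mxE. Qed.

Lemma pairingDr n (u : 'rV[C]_n) v1 v2 :
  pairing u (v1 + v2) = pairing u v1 + pairing u v2.
Proof. by rewrite /pairing mulmxDr mxE. Qed.

Lemma pairingZr n c (u : 'rV[C]_n) v : pairing u (c *: v) = c * pairing u v.
Proof. by rewrite /pairing -scalemxAr mxE. Qed.

Lemma pairing_expansion n (g0 g1 gq gd gq' rho : 'rV[C]_n) (xi eta : 'cV[C]_n)
    (h h' t : C) :
  let Q := h ^+ 2 *: gq + t *: gd + h' ^+ 2 *: gq' in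
  pairing (g0 + h *: g1 + Q + rho) (xi + h *: eta) = pairing g0 xi +
    ((pairing g1 xi + pairing g0 eta) * h + (pairing gq xi + pairing g1 eta) * h ^+ 2 +
     h' ^+ 2 * pairing gq' xi) +
    t * pairing gd xi + (h * pairing Q eta + pairing rho (xi + h *: eta)).
Proof. by move=> Q; rewrite !(pairingDl, pairingDr, pairingZl, pairingZr); ring. Qed.

Lemma pairing_double n (g0 g1 : 'rV[C]_n) (v : 'cV[C]_n) (h : C) :
  pairing (2 *: g0 + h *: (2 *: g1)) v = 2 * pairing (g0 + h *: g1) v.
Proof. by rewrite !(pairingDl, pairingZl); ring. Qed.

(** Provides the constant with which the form of the deviation u absorbs the errors linear in u. *)
Lemma posdef_lower_bound n (M : 'M[C]_n) : adjmx M = M ->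
  (forall v : 'cV[C]_n, v != 0 -> 0 < (adjmx v *m M *m v) ord0 ord0) ->
  exists c : R, 0 < c /\ forall u : 'cV[C]_n,
    c * mnorm u ^+ 2 <= complex.Re ((adjmx u *m M *m u) ord0 ord0).
Proof.
move=> hM pM; have uM := posdef_unitmx pM.
have pM0 (v : 'cV[C]_n) : 0 <= (adjmx v *m M *m v) ord0 ord0.
  have [->|/pM/ltW //] := eqVneq v 0; by rewrite mulmx0 mxE.
pose Qf (v : 'cV[C]_n) : R := complex.Re ((adjmx v *m M *m v) ord0 ord0).
have Q0 v : 0 <= Qf v by have := pM0 v; rewrite lecE /= => /andP[].
(* u j is the M-inner product of u with w j, so Cauchy-Schwarz bounds it. *)
pose w (j : 'I_n) : 'cV[C]_n := invmx M *m delta_mx j ord0.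
have wM j (u : 'cV[C]_n) : (adjmx (w j) *m M *m u) ord0 ord0 = u j ord0.
  rewrite /w adjmxM adjmx_invmx // -[_ *m invmx M *m M]mulmxA mulVmx // mulmx1.
  have -> : adjmx (delta_mx j ord0 : 'cV[C]_n) = delta_mx ord0 j.
    by apply/matrixP => p q; rewrite adjmxE !mxE conjc_nat andbC.
  by rewrite -rowE mxE.
have w0 j : w j != 0.
  apply/eqP => E; have := wM j (delta_mx j ord0).
  by rewrite E /adjmx map_mx0 trmx0 !mul0mx !mxE !eqxx /= => /eqP; rewrite eq_sym oner_eq0.
have kap j : 0 < Qf (w j).
  by have := pM _ (w0 j); rewrite ltcE /= => /andP[].
have QE v : (adjmx v *m M *m v) ord0 ord0 = (Qf v)%:C.
  have := pM0 v; rewrite lecE /= => /andP[/eqP im _].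
  by apply/eqP; rewrite eq_complex /= im !eqxx.
have CS j (u : 'cV[C]_n) : cabs (u j ord0) ^+ 2 <= Qf (w j) * Qf u.
  (* [t *: w j] is the M-orthogonal projection of u on [w j]; positivity of the form on the residual
     is the Cauchy-Schwarz inequality. *)
  pose t : C := u j ord0 / (Qf (w j))%:C.
  have kn : (Qf (w j))%:C != 0 :> C by rewrite (fmorph_eq0 (real_complex R)) gt_eqF.
  have := pM0 (u - t *: w j).
  rewrite adjmxD adjmxN adjmxZ !mulmxDl !mulmxDr !mulNmx !mulmxN -!scalemxAl -!scalemxAr.
  have -> : forall X Y Z T : 'M[C]_1, (X - t *: Y + (- (t^*%C *: Z) - - (t^*%C *: (t *: T))))
      ord0 ord0 = X ord0 ord0 - t * Y ord0 ord0 - t^*%C * Z ord0 ord0 +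
        t^*%C * t * T ord0 ord0 by move=> X Y Z T; rewrite !mxE; ring.
  rewrite (adjmx_form (w j) u hM) (QE u) (QE (w j)) wM.
  have -> : (Qf u)%:C - t * (u j ord0)^*%C - t^*%C * u j ord0 + t^*%C * t * (Qf (w j))%:C =
      (Qf u - cabs (u j ord0) ^+ 2 / Qf (w j))%:C.
    have tJ : t^*%C = (u j ord0)^*%C / (Qf (w j))%:C.
      by rewrite /t conjcM conjc_inv conjc_real.
    have uu : u j ord0 * (u j ord0)^*%C = (cabs (u j ord0) ^+ 2)%:C.
      by rewrite -sqr_normc cabsE rmorphXn.
    rewrite (rmorphB (real_complex R)) (rmorphM (real_complex R)) (fmorphV (real_complex R)).
    rewrite -[X in _ = _ - X / _]/((cabs (u j ord0) ^+ 2)%:C) -uu tJ /t.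
    by field.
  rewrite -(rmorph0 (real_complex R)) lecR subr_ge0 ler_pdivrMr // mulrC.
  by [].
pose K := \sum_j @Num.sqrt R (Qf (w j)).
have K0 : 0 <= K by apply: sumr_ge0 => j _; exact: sqrtr_ge0.
(* The + 1 covers n = 0, where K vanishes. *)
exists (K ^+ 2 + 1)^-1; have K1 : 0 < K ^+ 2 + 1 by have := sqr_ge0 K; lra.
split=> [|u]; first by rewrite invr_gt0.
rewrite mulrC ler_pdivrMr // -/(Qf u).
have : mnorm u <= K * @Num.sqrt R (Qf u).
  rewrite /mnorm mulr_suml; apply: ler_sum => j _.
  rewrite big_ord1 -sqrtrM; last exact: ltW.
  by rewrite -[leLHS]ger0_norm ?cabs_ge0 // -sqrtr_sqr ler_wsqrtr.
move=> h; have : mnorm u ^+ 2 <= (K * @Num.sqrt R (Qf u)) ^+ 2.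
  rewrite ler_sqr ?nnegrE ?mnorm_ge0 // mulr_ge0 // sqrtr_ge0.
rewrite exprMn sqr_sqrtr // => /le_trans; apply.
by rewrite mulrDr mulr1 mulrC lerDl.
Qed.

End MatrixNorm.

(** * Expansion of the metric and completion of the square *)

Section PointwiseBound.
Variable R : realType.
Local Notation C := R[i].
Variables (r : nat) (U : set C) (H : C -> 'M[C]_r) (a : C).
Hypotheses (oU : open_set U) (Ua : U a).
Hypothesis smoothH : forall p q, smooth_on U (fun z => H z p q).
Hypothesis hermH : forall z, U z -> adjmx (H z) = H z.
Hypothesis posH : forall z, U z -> forall v : 'cV[C]_r, v != 0 ->
  0 < (adjmx v *m H z *m v) ord0 ord0.

Let A := dz_mx H a.
Let D := dzb_mx (dz_mx H) a.

Lemma taylor_mx : exists B B' : 'M[C]_r, forall e : R, 0 < e ->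
  exists delta : R, 0 < delta /\ forall h : C, cabs h < delta ->
  mnorm (H (a + h) - (H a + h *: A + h^*%C *: adjmx A + h ^+ 2 *: B +
    (h^*%C) ^+ 2 *: B' + (cabs h ^+ 2)%:C *: D)) <= e * cabs h ^+ 2.
Proof.
have /choice[BB HBB] : forall jk : 'I_r * 'I_r, exists BB : C * C,
    forall e : R, 0 < e -> exists delta : R, 0 < delta /\
    forall h, cabs h < delta ->
    cabs (H (a + h) jk.1 jk.2 - (H a jk.1 jk.2 + A jk.1 jk.2 * h +
      adjmx A jk.1 jk.2 * h^*%C + BB.1 * h ^+ 2 +
      BB.2 * (h^*%C) ^+ 2 + D jk.1 jk.2 * (cabs h ^+ 2)%:C)) <= e * cabs h ^+ 2.
  move=> [j k]; have [B [B' HB]] := taylor_complex oU (smoothH j k) Ua.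
  exists (B, B') => e e0; have [d [d0 Hd]] := HB e e0; exists d; split => // h hd.
  have := Hd h hd; rewrite /=.
  have -> : A j k = dz (fun z => H z j k) a by rewrite /A mxE.
  have -> : adjmx A j k = dzb (fun z => H z j k) a.
    by rewrite /A -(dzb_adj oU Ua smoothH hermH) mxE.
  have -> : D j k = dzb (dz (fun z => H z j k)) a.
    by rewrite /D mxE; congr (dzb _ a); apply/funext => w; rewrite mxE.
  by [].
exists (\matrix_(j, k) (BB (j, k)).1), (\matrix_(j, k) (BB (j, k)).2) => e e0.
have N0 : 0 < (r * r)%:R + 1 :> R by have := ler0n R (r * r); lra.
(* The r^2 entrywise errors add up in [mnorm]; the + 1 covers r = 0. *)
pose e' := e / ((r * r)%:R + 1).
have e'0 : 0 < e' by rewrite divr_gt0.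
have [d [d0 Hd]] := finite_radius (fun jk => HBB jk e' e'0).
exists d; split => // h hd.
have h2 : 0 <= cabs h ^+ 2 by rewrite sqr_ge0.
apply: (@le_trans _ _ (e' * cabs h ^+ 2 * (r * r)%:R)).
  apply: mnorm_le => j k; have := Hd h hd (j, k); rewrite /=.
  move: A D => A0 D0; rewrite !mxE.
  by rewrite [A0 j k * h]mulrC [_ * h^*%C]mulrC [_ * h ^+ 2]mulrC
    [_ * h^*%C ^+ 2]mulrC [D0 j k * _]mulrC.
rewrite /e' mulrAC; apply: ler_wpM2r => //.
rewrite mulrAC ler_pdivrMr //.
by rewrite ler_pM2l //; lra.
Qed.

(** The relation between [x] and [e] cancels the term linear in h'. What remains is a row affine in
    h, a quadratic row, and a remainder that is o(|h|^2) when [Rm] is. *)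
Lemma row_expansion (x e : 'rV[C]_r) (H0 A0 A1 B B' D0 Rm : 'M[C]_r) (h h' n : C) :
  x *m A1 + e *m H0 = 0 -> n = h * h' ->
  (x + h' *: e) *m (H0 + h *: A0 + h' *: A1 + h ^+ 2 *: B + h' ^+ 2 *: B' + n *: D0 + Rm) =
  (x *m H0 + h *: (x *m A0)) +
  (h ^+ 2 *: (x *m B) + n *: (x *m D0 + e *m A0) + h' ^+ 2 *: (x *m B' + e *m A1)) +
  (x *m Rm + h' *: (e *m (h ^+ 2 *: B + h' ^+ 2 *: B' + n *: D0 + Rm))).
Proof.
move=> /eqP; rewrite addrC addr_eq0 => /eqP E nE.
rewrite mulmxDl -scalemxAl !mulmxDr -!scalemxAr E.
move: (x *m H0) (x *m A0) (x *m A1) (x *m B) (x *m B') (x *m D0) (x *m Rm) => v1 v2 v3 v4 v5 v6 v7.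
move: (e *m A0) (e *m A1) (e *m B) (e *m B') (e *m D0) (e *m Rm) => y1 y2 y3 y4 y5 y6.
by apply/rowP => k; rewrite !mxE nE; ring.
Qed.

Lemma remainder_arith (k d eps T x1 x2 x3 x4 y1 y2 y3 z q E1 E2 E3 : R) :
  - E1 <= y1 + y2 -> - E2 <= y3 -> - E3 <= q - 2 * E2 -> E1 + E3 <= eps * T -> q <= z ->
  k + (d * T + - eps * T) + (x1 + (x2 + x3) + 2 * x4) <=
  k + (x1 + x2 + x3) + T * d + (y1 + y2) + 2 * (x4 + y3) + z.
Proof. by move=> *; rewrite [T * d]mulrC mulNr; lra. Qed.

(* Around xi + h eta the first-order term in h^* of the metric is cancelled by
   eta = - (H a)^-1 A xi; completing the square in F - xi - h eta leaves a remainder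
   that is the real part of a function holomorphic in h as soon as F is. *)
Lemma pointwise_lower_bound (xi : 'cV[C]_r) :
  let k := complex.Re ((adjmx xi *m H a *m xi) ord0 ord0) in
  let d := complex.Re ((adjmx xi *m (D - adjmx A *m invmx (H a) *m A) *m xi) ord0 ord0) in
  exists (eta : 'cV[C]_r) (g0 g1 : 'rV[C]_r) (c1 c2 : C),
  forall eps : R, 0 < eps -> exists delta : R, 0 < delta /\
  forall (h : C) (F : 'cV[C]_r), cabs h < delta ->
    k + (d - eps) * cabs h ^+ 2 + complex.Re (c1 * h + c2 * h ^+ 2 +
      ((g0 + h *: g1) *m (F - xi - h *: eta)) ord0 ord0)
    <= complex.Re ((adjmx F *m H (a + h) *m F) ord0 ord0).
Proof.
move=> k d.
have [B [B' HB]] := taylor_mx.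
have uH : H a \in unitmx by exact: posdef_unitmx (posH Ua).
have hH := hermH Ua.
pose eta : 'cV[C]_r := - (invmx (H a) *m A *m xi).
pose x := adjmx xi; pose e := adjmx eta.
have eE : e = - (x *m adjmx A *m invmx (H a)).
  by rewrite /e /eta adjmxN !adjmxM adjmx_invmx // mulmxA.
have key : x *m adjmx A + e *m H a = 0.
  by rewrite eE mulNmx -[_ *m invmx _ *m H a]mulmxA mulVmx // mulmx1 subrr.
pose g0 := x *m H a; pose g1 := x *m A; pose gq := x *m B.
pose gd := x *m D + e *m A; pose gq' := x *m B' + e *m adjmx A.
pose s := @pairing R r.
(* The factors 2 come from the cross term of the Hermitian form. The term in conj(h)^2 has the same
   real part as the conjugate coefficient times h^2, so it joins [c2]. *)
exists eta, (2 *: g0), (2 *: g1), (s g1 xi + s g0 eta),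
  (s gq xi + s g1 eta + (s gq' xi)^*%C).
have [c [c0 Hc]] := posdef_lower_bound hH (posH Ua).
pose X := mnorm xi; pose Y := mnorm eta.
pose Kq := mnorm gq + mnorm gd + mnorm gq'.
pose K3 := mnorm B + mnorm B' + mnorm D.
pose KA := 2 * mnorm A + K3 + 1.
have X0 : 0 <= X := mnorm_ge0 _; have Y0 : 0 <= Y := mnorm_ge0 _.
have Kq0 : 0 <= Kq by rewrite !addr_ge0 ?mnorm_ge0.
have K30 : 0 <= K3 by rewrite !addr_ge0 ?mnorm_ge0.
have KA0 : 0 < KA by rewrite /KA; have := mnorm_ge0 A; lra.
(* [K5] bounds, relative to |h|^2, the row paired with u beyond its affine part. [K6] and [K7]
   control the terms free of u, with an extra factor |h| and [e1] respectively; [K8] is the loss in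
   completing the square. *)
pose K5 := Kq + X + Y * (K3 + 1).
have K31 : 0 <= K3 + 1 by lra.
have YK : 0 <= Y * (K3 + 1) by rewrite mulr_ge0.
have XY : 0 <= X + Y by rewrite addr_ge0.
have K50 : 0 <= K5 by apply: addr_ge0 => //; exact: addr_ge0.
pose K6 := Kq * Y + Y * (K3 + 1) * (X + Y).
pose K7 := X * (X + Y).
pose K8 := 2 * K5 ^+ 2 / c.
have K60 : 0 <= K6 by apply: addr_ge0; exact: mulr_ge0.
have K70 : 0 <= K7 by exact: mulr_ge0.
have K80 : 0 <= K8.
  by apply: divr_ge0; [apply: mulr_ge0 => //; exact: sqr_ge0|exact: ltW].
move=> eps eps0.
pose e1 := Num.min 1 (eps / (2 * (K7 + 1))).
have e10 : 0 < e1.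
  by rewrite lt_min ltr01 /= divr_gt0 // mulr_gt0 //; lra.
have e11 : e1 <= 1 by rewrite ge_min lexx.
have e1K : e1 * K7 <= eps / 2.
  have : e1 <= eps / (2 * (K7 + 1)) by rewrite ge_min lexx orbT.
  rewrite ler_pdivlMr; last by rewrite mulr_gt0 //; lra.
  by nra.
have [d1 [d10 Hd1]] := HB e1 e10.
have [d2 [d20 Hd2]] := oU Ua.
(* This radius is fixed before [F]: 1 allows |h|^2 <= |h|, [d1] is for the Taylor bound and [d2] for
   staying in [U]; c / (2 KA) leaves at least half of the positivity constant at a + h, and the last
   bound absorbs K6 + K8 into eps / 2. *)
pose del := Num.min (Num.min 1 (Num.min d1 d2))
  (Num.min (c / (2 * KA)) (eps / (2 * (K6 + K8 + 1)))).
have K681 : 0 < 2 * (K6 + K8 + 1) by rewrite mulr_gt0 //; lra.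
have KA2 : 0 < 2 * KA by rewrite mulr_gt0.
exists del; split; first by rewrite !lt_min ltr01 d10 d20 !divr_gt0.
move=> h F; rewrite !lt_min => /andP[/andP[h1 /andP[hd1 hd2]] /andP[hc heps]].
have hh0 := cabs_ge0 h.
have hK : cabs h * (K6 + K8) <= eps / 2.
  by move: heps; rewrite ltr_pdivlMr //; nra.
have hKA : cabs h * KA <= c / 2.
  by move: hc; rewrite ltr_pdivlMr //; nra.
set h' := h^*%C.
have h'E : cabs h' = cabs h by rewrite /h' cabsJ.
pose n : C := (cabs h ^+ 2)%:C.
have nE : n = h * h' by rewrite /n rmorphXn /= -cabsE sqr_normc.
have nabs : cabs n = cabs h ^+ 2 by rewrite cabsR ger0_norm ?sqr_ge0.
pose Rm := H (a + h) - (H a + h *: A + h' *: adjmx A + h ^+ 2 *: B +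
    h' ^+ 2 *: B' + n *: D).
have HRm : mnorm Rm <= e1 * cabs h ^+ 2 by exact: Hd1.
have HE : H (a + h) = H a + h *: A + h' *: adjmx A + h ^+ 2 *: B +
    h' ^+ 2 *: B' + n *: D + Rm by rewrite [RHS]addrC /Rm subrK.
pose t := cabs h; have t2 : 0 <= t ^+ 2 := sqr_ge0 _.
have tt : t ^+ 2 <= t by rewrite expr2 ler_piMl // ltW.
pose rest := h ^+ 2 *: B + h' ^+ 2 *: B' + n *: D + Rm.
have cabs2 (z : C) : cabs (z ^+ 2) = cabs z ^+ 2 by rewrite expr2 cabsM.
have Hrest : mnorm rest <= (K3 + 1) * t ^+ 2.
  apply: (le_trans (mnormD _ _)).
  have := mnormD (h ^+ 2 *: B + h' ^+ 2 *: B') (n *: D).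
  have := mnormD (h ^+ 2 *: B) (h' ^+ 2 *: B').
  rewrite !mnormZ !cabs2 h'E nabs -/t.
  have : e1 * t ^+ 2 <= t ^+ 2 by rewrite ler_piMl.
  move: HRm; rewrite -/t /K3 !mulrDl !mul1r.
  by rewrite ![mnorm _ * t ^+ 2]mulrC; clear; lra.
pose Q := h ^+ 2 *: gq + n *: gd + h' ^+ 2 *: gq'.
have HQ : mnorm Q <= Kq * t ^+ 2.
  apply: (le_trans (mnormD _ _)).
  have := mnormD (h ^+ 2 *: gq) (n *: gd).
  rewrite !mnormZ !cabs2 h'E nabs -/t /Kq !mulrDl ![mnorm _ * t ^+ 2]mulrC.
  by clear; lra.
pose rho := x *m Rm + h' *: (e *m rest).
have Hrho : mnorm rho <= (e1 * X + t * (Y * (K3 + 1))) * t ^+ 2.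
  apply: (le_trans (mnormD _ _)); rewrite mulrDl; apply: lerD.
    apply: (le_trans (mnormM _ _)); rewrite /x mnorm_adj -/X [e1 * X]mulrC -mulrA.
    exact: ler_wpM2l.
  rewrite mnormZ h'E -/t -mulrA; apply: ler_wpM2l => //.
  apply: (le_trans (mnormM _ _)); rewrite /e mnorm_adj -/Y -mulrA.
  exact: ler_wpM2l.
pose s0 := xi + h *: eta; pose u := F - xi - h *: eta.
have FE : F = s0 + u by rewrite /u /s0 -[F - xi - _]addrA -opprD [RHS]addrC subrK.
have GE : adjmx s0 *m H (a + h) = (g0 + h *: g1) + Q + rho.
  rewrite /s0 adjmxD adjmxZ -/x -/e -/h' HE.
  by rewrite (row_expansion _ _ _ _ _ key nE).
pose m := mnorm u; have m0 : 0 <= m := mnorm_ge0 _.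
have Gu : cabs (s (Q + rho) u) <= K5 * t ^+ 2 * m.
  apply: (le_trans (cabs_mulmx_le _ _)); apply: ler_wpM2r => //.
  apply: (le_trans (mnormD _ _)); rewrite /K5 -addrA mulrDl; apply: lerD => //.
  apply: (le_trans Hrho); apply: ler_wpM2r => //; apply: lerD.
    by rewrite ler_piMl.
  by rewrite ler_piMl // ?mulr_ge0 // ?addr_ge0 // ltW.
have Gs : cabs (h * s Q eta + s rho s0) <= (t * K6 + e1 * K7) * t ^+ 2.
  apply: (le_trans (cabsD _ _)).
  have s0n : mnorm s0 <= X + Y.
    apply: (le_trans (mnormD _ _)); rewrite mnormZ lerD2l ler_piMl //.
    exact: ltW.
  have b1 : cabs (h * s Q eta) <= t * (Kq * Y) * t ^+ 2.
    rewrite cabsM -mulrA; apply: ler_wpM2l => //.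
    apply: (le_trans (cabs_mulmx_le _ _)); rewrite -mulrA [Y * _]mulrC mulrA.
    exact: ler_wpM2r.
  have b2 : cabs (s rho s0) <= (e1 * X + t * (Y * (K3 + 1))) * t ^+ 2 * (X + Y).
    apply: (le_trans (cabs_mulmx_le _ _)); apply: ler_pM => //; exact: mnorm_ge0.
  have -> : (t * K6 + e1 * K7) * t ^+ 2 = t * (Kq * Y) * t ^+ 2 +
    (e1 * X + t * (Y * (K3 + 1))) * t ^+ 2 * (X + Y) by rewrite /K6 /K7; ring.
  exact: lerD.
have Hu : c / 2 * m ^+ 2 <= complex.Re ((adjmx u *m H (a + h) *m u) ord0 ord0).
  have dH : mnorm (H (a + h) - H a) <= c / 2.
    have -> : H (a + h) - H a = h *: A + h' *: adjmx A + rest.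
      by rewrite HE /rest; apply/matrixP => i j; rewrite !mxE; ring.
    apply: (le_trans (mnormD _ _)); have := mnormD (h *: A) (h' *: adjmx A).
    rewrite !mnormZ h'E mnorm_adj -/t => b1; apply: le_trans hKA; rewrite -/t.
    have b2 : (K3 + 1) * t ^+ 2 <= (K3 + 1) * t.
      by apply: ler_wpM2l => //; rewrite addr_ge0.
    have -> : t * KA = t * mnorm A + t * mnorm A + (K3 + 1) * t by rewrite /KA; ring.
    by apply: lerD; [exact: b1|exact: le_trans Hrest b2].
  have -> : adjmx u *m H (a + h) *m u = adjmx u *m H a *m u +
      adjmx u *m ((H (a + h) - H a) *m u).
    by rewrite -[adjmx u *m H a *m u]mulmxA -mulmxDr -mulmxDl [H a + _]addrC subrK mulmxA.
  rewrite mxE ReD.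
  have b3 : `|complex.Re ((adjmx u *m ((H (a + h) - H a) *m u)) ord0 ord0)| <= c / 2 * m ^+ 2.
    apply: (le_trans (Re_le_cabs _)); apply: (le_trans (cabs_mulmx_le _ _)).
    rewrite mnorm_adj -/m expr2 mulrCA; apply: ler_wpM2l => //.
    by apply: (le_trans (mnormM _ _)); apply: ler_wpM2r.
  have := Hc u; rewrite -/m; move: b3; rewrite ler_norml => /andP[b3 _].
  by move: b3; set q := m ^+ 2; set z1 := complex.Re _; set z2 := complex.Re _; clear; lra.
have Uh : U (a + h) by apply: Hd2; rewrite /disc /= addrAC subrr add0r cabs_lt.
have hHh := hermH Uh.
have -> : complex.Re ((adjmx F *m H (a + h) *m F) ord0 ord0) =
    complex.Re (s (adjmx s0 *m H (a + h)) s0) +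
    2 * complex.Re (s (adjmx s0 *m H (a + h)) u) +
    complex.Re ((adjmx u *m H (a + h) *m u) ord0 ord0).
  by rewrite FE; exact: Re_formD.
rewrite GE.
(* The correction contributes e A = - x adj(A) H(a)^-1 A, which completes x D to the row defining
   [d]. *)
have gdE : complex.Re (s gd xi) = d.
  rewrite /d /s /gd; congr (complex.Re (_ ord0 ord0)).
  by rewrite mulmxBr eE mulNmx !mulmxA.
have sGs : s (g0 + h *: g1 + Q + rho) s0 = s g0 xi +
    ((s g1 xi + s g0 eta) * h + (s gq xi + s g1 eta) * h ^+ 2 + h' ^+ 2 * s gq' xi) +
    n * s gd xi + (h * s Q eta + s rho s0).
  exact: pairing_expansion.
have sGu : s (g0 + h *: g1 + Q + rho) u = s (g0 + h *: g1) u + s (Q + rho) u.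
  by rewrite -addrA; exact: pairingDl.
have Eg : ((2 *: g0 + h *: (2 *: g1)) *m (F - xi - h *: eta)) ord0 ord0 =
    2 * s (g0 + h *: g1) u.
  exact: pairing_double.
rewrite Eg sGs sGu.
have ReN (z : C) : complex.Re (n * z) = t ^+ 2 * complex.Re z by rewrite /n ReRM.
have Re2 (z : C) : complex.Re (2 * z) = 2 * complex.Re z.
  by rewrite (_ : 2 = (2%:R : R)%:C) ?ReRM // rmorph_nat.
have ReJq : complex.Re (h' ^+ 2 * s gq' xi) = complex.Re ((s gq' xi)^*%C * h ^+ 2).
  by rewrite -[LHS]ReJ conjcM mulrC /h' expr2 conjcM conjcK -expr2.
rewrite mulrDl !ReD ReN gdE ReJq Re2.
have k0E : complex.Re (s g0 xi) = k by [].
rewrite k0E.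
have b1 : - ((t * K6 + e1 * K7) * t ^+ 2) <= complex.Re (h * s Q eta + s rho s0).
  by have := le_trans (Re_le_cabs _) Gs; rewrite ler_norml => /andP[].
have b2 : - (K5 * t ^+ 2 * m) <= complex.Re (s (Q + rho) u).
  by have := le_trans (Re_le_cabs _) Gu; rewrite ler_norml => /andP[].
(* As a quadratic in m the right-hand side is least at 2 K5 t^2 / c, with value - K8 t^4, and t <=
   1. *)
have b3 : - (K8 * t * t ^+ 2) <= c / 2 * m ^+ 2 - 2 * (K5 * t ^+ 2 * m).
  have sq : 0 <= c / 2 * (m - 2 * K5 * t ^+ 2 / c) ^+ 2.
    by rewrite mulr_ge0 ?sqr_ge0 // divr_ge0 // ltW.
  have E : c / 2 * (m - 2 * K5 * t ^+ 2 / c) ^+ 2 =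
      c / 2 * m ^+ 2 - 2 * (K5 * t ^+ 2 * m) + K8 * t ^+ 2 * t ^+ 2.
    by rewrite /K8; field; rewrite gt_eqF.
  have b4 : K8 * t ^+ 2 * t ^+ 2 <= K8 * t * t ^+ 2.
    by apply: ler_wpM2r => //; apply: ler_wpM2l.
  by move: sq b4; rewrite E; clear; lra.
have b5 : (t * K6 + e1 * K7) * t ^+ 2 + K8 * t * t ^+ 2 <= eps * t ^+ 2.
  rewrite -mulrDl; apply: ler_wpM2r => //.
  by move: hK e1K; rewrite -/t; clear; lra.
rewrite [(s gq xi + s g1 eta + _) * h ^+ 2]mulrDl ReD -/t; rewrite ReD in b1.
exact: remainder_arith b1 b2 b3 b5 Hu.
Qed.

End PointwiseBound.

(** * Lower bound for the extension index *)

Section HolomorphicAlgebra.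
Variable R : realType.
Local Notation C := R[i].
Implicit Types (f g : C -> C) (U : set C).

Lemma rdiffD f g z a b a' b' : rdiff f z a b -> rdiff g z a' b' ->
  rdiff (fun x => f x + g x) z (a + a') (b + b').
Proof.
move=> rf rg e e0; have e2 : 0 < e / 2 by rewrite divr_gt0.
have [d1 [d10 fd]] := rf _ e2; have [d2 [d20 gd]] := rg _ e2.
exists (Num.min d1 d2); split; first by rewrite lt_min d10.
move=> h; rewrite lt_min => /andP[/fd h1 /gd h2].
have -> : f (z + h) + g (z + h) - (f z + g z) - (a + a') * h - (b + b') * h^*%C =
  (f (z + h) - f z - a * h - b * h^*%C) + (g (z + h) - g z - a' * h - b' * h^*%C).
  by ring.
apply: (le_trans (cabsD _ _)).
have -> : e * cabs h = e / 2 * cabs h + e / 2 * cabs h by field.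
exact: lerD.
Qed.

Lemma rdiff_is_cderiv f z c : rdiff f z c 0 -> is_cderiv f z c.
Proof.
move=> H e e0; have [d [d0 Hd]] := H (e / 2) ltac:(by rewrite divr_gt0).
exists d; split => // w; rewrite normr_gt0 => wz; rewrite !cabs_lt => wd.
have := Hd (w - z) wd; rewrite [z + _]addrC subrK mul0r subr0.
have -> : (f w - f z) / (w - z) - c = (f w - f z - c * (w - z)) / (w - z).
  by rewrite [in RHS]mulrBl mulfK.
rewrite cabsM cabsV => h; rewrite ltr_pdivrMr ?cabs_gt0 //.
apply: (le_lt_trans h); rewrite ltr_pM2r ?cabs_gt0 //; lra.
Qed.

Lemma holo_onD U f g : holo_on U f -> holo_on U g -> holo_on U (fun z => f z + g z).
Proof.
move=> hf hg z Uz; have [c dc] := hf z Uz; have [c' dc'] := hg z Uz.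
exists (c + c'); apply: rdiff_is_cderiv.
by rewrite -(addr0 0); apply: rdiffD; exact: rdiff_cderiv.
Qed.

Lemma holo_onM U f g : holo_on U f -> holo_on U g -> holo_on U (fun z => f z * g z).
Proof.
move=> hf hg z Uz; have [c dc] := hf z Uz; have [c' dc'] := hg z Uz.
exists (c * g z + f z * c'); apply: rdiff_is_cderiv.
have := rdiffM (rdiff_cderiv dc) (rdiff_cderiv dc').
by rewrite mul0r mulr0 addr0.
Qed.

Lemma holo_on_cst U (c : C) : holo_on U (fun=> c).
Proof.
move=> z _; exists 0 => e e0; exists 1; split => // w _ _.
by rewrite subrr mul0r subr0 normr0 -(rmorph0 (real_complex R)) ltcR.
Qed.

Lemma holo_on_id U : holo_on U id.
Proof.
move=> z _; exists 1 => e e0; exists 1; split => // w; rewrite normr_gt0 => wz _.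
by rewrite divff // subrr normr0 -(rmorph0 (real_complex R)) ltcR.
Qed.

Lemma holo_on_sum U (I : Type) (s : seq I) (F : I -> C -> C) :
  (forall i, holo_on U (F i)) -> holo_on U (fun z => \sum_(i <- s) F i z).
Proof.
move=> hF; elim: s => [|i s IH].
  by under eq_fun do rewrite big_nil; exact: holo_on_cst.
by under eq_fun do rewrite big_cons; apply: holo_onD.
Qed.

End HolomorphicAlgebra.

(** * From the pointwise bound to the extension index *)

Section ExtensionIndex.
Variable R : realType.
Local Notation C := R[i].

Lemma quadratic_quotient (F : numFieldType) (p k l t : F) :
  p != 0 -> k != 0 -> t != 0 ->
  1 + l * t / (2 * k) = (p * k * t + p * l * t ^+ 2 / 2) * (p * t * k)^-1.
Proof. by move=> p0 k0 t0; field; rewrite k0 p0 t0. Qed.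

(** Passage to the limit c -> K, used to let the smaller discs exhaust the disc of radius rho. [L]
    exceeds the Lipschitz constant of the polynomial on [0, K] by 1, which makes it positive. *)
Lemma le_quadratic_limit (al be M K : R) : 0 < K ->
  (forall c, 0 < c -> c < K -> al * c + be * c ^+ 2 <= M) ->
  al * K + be * K ^+ 2 <= M.
Proof.
move=> K0 H; rewrite leNgt; apply/negP => MK.
pose q := al * K + be * K ^+ 2 - M.
have q0 : 0 < q by rewrite subr_gt0.
pose L := `|al| + 2 * `|be| * K + 1.
have L0 : 0 < L.
  by rewrite /L ltr_wpDl // addr_ge0 // !mulr_ge0 // ltW.
pose x := Num.min (K / 2) (q / L / 2).
have x0 : 0 < x by rewrite lt_min !divr_gt0.
have xK : x <= K / 2 by rewrite ge_min lexx.
have xq : x * L <= q / 2.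
  have : x <= q / L / 2 by rewrite ge_min lexx orbT.
  by rewrite mulrAC ler_pdivlMr.
have := H (K - x) ltac:(lra) ltac:(lra).
have E : al * (K - x) + be * (K - x) ^+ 2 =
  al * K + be * K ^+ 2 - (al * x + be * x * (2 * K - x)) by ring.
rewrite E => h.
have b1 : al * x <= `|al| * x by apply: ler_wpM2r; [exact: ltW|exact: ler_norm].
have b2 : be * x * (2 * K - x) <= 2 * `|be| * K * x.
  have : be * x * (2 * K - x) <= `|be| * x * (2 * K).
    apply: (@le_trans _ _ (`|be| * x * (2 * K - x))).
      apply: ler_wpM2r; first lra.
      by apply: ler_wpM2r; [exact: ltW|exact: ler_norm].
    by apply: ler_wpM2l; [rewrite mulr_ge0 // ltW|lra].
  by move=> /le_trans; apply; rewrite le_eqVlt; apply/orP; left; apply/eqP; ring.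
have : q <= x * L - x.
  have -> : x * L - x = `|al| * x + 2 * `|be| * K * x by rewrite /L; ring.
  by rewrite /q; lra.
lra.
Qed.

Variables (Om : set C) (r : nat) (E : holo_bundle Om r).
Variable H : hb_idx E -> C -> 'M[C]_r.
Hypothesis hH : herm_metric H.

(** The squared norm is defined through the chart selected at each point, a selection with no
    regularity; the transition rules allow one fixed frame over the whole disc. *)
Lemma sec_sqnorm_frame (V : set C) (s : hb_idx E -> C -> 'cV[C]_r) i z :
  holo_section V s -> hb_U i z -> V z ->
  sec_sqnorm H s z = complex.Re ((adjmx (s i z) *m H i z *m s i z) ord0 ord0).
Proof.
move=> [_ trans] Uz Vz; have [_ [_ [_ Htrans]]] := hH.
have Omz := hb_U_sub Uz; have Uj := hb_selP E Omz.
rewrite /sec_sqnorm /hinner (trans _ i z Uj Uz Vz) (Htrans (hb_sel E z) i z Uj Uz).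
by rewrite adjmxM !mulmxA.
Qed.

Variables (a : C) (xi : 'cV[C]_r).
Hypotheses (Oma : Om a) (xi0 : xi != 0).
Local Notation i0 := (hb_sel E a).
Let A := dz_mx (H i0) a.
Let D := dzb_mx (dz_mx (H i0)) a.

(** The coefficient of |z - a|^2 left by completing the square; it is minus the curvature form at
    xi. *)
Definition chern_defect : R := complex.Re
  ((adjmx xi *m (D - adjmx A *m invmx (H i0 a) *m A) *m xi) ord0 ord0).

Definition fiber_sqnorm : R := complex.Re (hinner H a xi xi).

Lemma fiber_sqnorm_gt0 : 0 < fiber_sqnorm.
Proof.
have [_ [_ [pos _]]] := hH.
by have := pos i0 a (hb_selP E Oma) xi xi0; rewrite ltcE /= => /andP[].
Qed.

Lemma hinner_fiber_sqnorm : hinner H a xi xi = (fiber_sqnorm)%:C.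
Proof.
have [_ [_ [pos _]]] := hH.
have := pos i0 a (hb_selP E Oma) xi xi0; rewrite ltcE /= => /andP[/eqP im _].
by apply/eqP; rewrite eq_complex /= eqxx /= /hinner im.
Qed.

(** Multiplication by H(a) cancels the outer inverse in the curvature and leaves - (D - adj(A)
    H(a)^-1 A), because dzb H = adj(dz H). This matrix is Hermitian, so its form is real, as a
    comparison in [R[i]] requires. *)
Lemma hinner_chern_curv :
  hinner H a (chern_curv H i0 a *m xi) xi = (- chern_defect)%:C.
Proof.
have [sm [he [pos _]]] := hH.
have Ua := hb_selP E Oma; have oU : open_set (hb_U i0) := @hb_U_open _ _ _ E i0.
have uH z : hb_U i0 z -> H i0 z \in unitmx by move=> Uz; exact: posdef_unitmx (pos i0 z Uz).
have hHa := he i0 a Ua.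
rewrite /hinner /chern_curv (dzb_connection oU Ua (sm i0) uH).
rewrite (dzb_adj oU Ua (sm i0) (he i0)) -/A -/D.
pose M := D - adjmx A *m invmx (H i0 a) *m A.
have hM : adjmx M = M.
  rewrite /M adjmxD adjmxN !adjmxM adjmxK (adjmx_invmx (uH _ Ua) hHa) mulmxA.
  by rewrite (dzb_dz_herm oU Ua (sm i0) (he i0)).
have -> : adjmx xi *m H i0 a *m (- (invmx (H i0 a) *m (D - adjmx A *m
    (invmx (H i0 a) *m A))) *m xi) = - (adjmx xi *m M *m xi).
  rewrite mulNmx mulmxN -!mulmxA; congr (- (_ *m _)).
  by rewrite (mulKVmx (uH _ Ua)) /M [adjmx A *m (_ *m A)]mulmxA.
rewrite mxE /chern_defect -/M.
have := adjmx_form xi xi hM; case: ((adjmx xi *m M *m xi) ord0 ord0) => x y /eqP.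
rewrite eq_complex /= eqxx /= => /eqP yE.
have y0 : y = 0 by lra.
by rewrite y0; apply/eqP; rewrite eq_complex /= oppr0 !eqxx.
Qed.

Lemma L2ext_index_ge (eps : R) : 0 < eps -> exists delta : R, 0 < delta /\
  forall rho : R, 0 < rho -> rho < delta ->
  ((1 + (chern_defect - eps) * rho ^+ 2 / (2 * fiber_sqnorm))%:E <=
     L2ext_index H a rho xi)%E.
Proof.
move=> eps0; have [sm [he [pos _]]] := hH.
have Ua := hb_selP E Oma; have oU : open_set (hb_U i0) := @hb_U_open _ _ _ E i0.
have k0 := fiber_sqnorm_gt0; set k := fiber_sqnorm in k0 *.
set l := chern_defect - eps.
have [eta [g0 [g1 [c1 [c2 PB]]]]] := pointwise_lower_bound oU Ua (sm i0) (he i0) (pos i0) xi.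
have [d1 [d10 Hd1]] := PB eps eps0.
have [d2 [d20 Hd2]] := oU a Ua.
have l1 : 0 < `|l| + 1 by rewrite ltr_wpDl.
(* [d1] is for the pointwise bound and [d2] keeps the disc in the frame; the last two make k + l t
   non-negative for t < rho^2, as the disc integral needs. *)
exists (Num.min (Num.min d1 d2) (Num.min 1 (k / (`|l| + 1)))).
split; first by rewrite !lt_min d10 d20 ltr01 divr_gt0.
move=> rho rho0; rewrite !lt_min => /andP[/andP[rd1 rd2] /andP[r1 rk]].
apply: le_ereal_inf_tmp => _ [s [[hs _] sxi] <-].
have rho20 : 0 < rho ^+ 2 by rewrite exprn_gt0.
have rr : rho ^+ 2 <= rho by rewrite expr2 ler_piMl // ltW.
have discU z : disc a rho z -> hb_U i0 z.
  move=> dz; apply: Hd2; move: dz; rewrite /disc /= !cabs_lt => /lt_trans; exact.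
(* The holomorphic part of the pointwise bound at F = s(z), written in coordinates so that
   holomorphy follows from sums and products. *)
pose w z := c1 * (z - a) + c2 * ((z - a) * (z - a)) +
  \sum_j (g0 ord0 j + (z - a) * g1 ord0 j) *
     (s i0 z j ord0 + (- xi j ord0 + (z - a) * - eta j ord0)).
have wE z : w z = c1 * (z - a) + c2 * (z - a) ^+ 2 +
    ((g0 + (z - a) *: g1) *m (s i0 z - xi - (z - a) *: eta)) ord0 ord0.
  rewrite /w expr2 [in RHS]mxE; congr (_ + _); apply: eq_bigr => j _; rewrite !mxE.
  by rewrite mulrN addrA.
have hz : holo_on (disc a rho) (fun z => z - a).
  by apply: holo_onD; [exact: holo_on_id|exact: holo_on_cst].
have hw : holo_on (disc a rho) w.
  have hc := @holo_on_cst R (disc a rho).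
  have hsj j : holo_on (disc a rho) (fun z => s i0 z j ord0).
    by move=> z dz; have [hs1 _] := hs; apply: (hs1 i0 j z); split => //; exact: discU.
  have h1 := holo_onD (holo_onM (hc c1) hz) (holo_onM (hc c2) (holo_onM hz hz)).
  have h2 j := holo_onM (holo_onD (hc (g0 ord0 j)) (holo_onM hz (hc (g1 ord0 j))))
    (holo_onD (hsj j) (holo_onD (hc (- xi j ord0)) (holo_onM hz (hc (- eta j ord0))))).
  exact: (holo_onD h1 (holo_on_sum _ h2)).
have wa : w a = 0.
  by rewrite wE sxi !subrr expr2 !mulr0 !scale0r subr0 mulmx0 mxE !addr0.
have S0 z : disc a rho z -> 0 <= sec_sqnorm H s z.
  move=> dz; have Uz := discU z dz; rewrite (sec_sqnorm_frame hs Uz dz).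
  have [->|v0] := eqVneq (s i0 z) 0; first by rewrite mulmx0 mxE.
  by have := pos i0 z Uz _ v0; rewrite ltcE /= => /andP[_ /ltW].
have SG z : disc a rho z -> k + l * sqd a z + complex.Re (w z) <= sec_sqnorm H s z.
  move=> dz; have Uz := discU z dz; rewrite (sec_sqnorm_frame hs Uz dz).
  have hz1 : cabs (z - a) < d1.
    by move: dz; rewrite /disc /= cabs_lt => /lt_trans; exact.
  have := Hd1 (z - a) (s i0 z) hz1; rewrite [a + (z - a)]addrC subrK -wE.
  exact.
have kl t : 0 <= t -> t < rho ^+ 2 -> 0 <= k + l * t.
  move=> t0 tr; have : - (`|l| * t) <= l * t.
    by rewrite -mulNr; apply: ler_wpM2r => //; rewrite lerNl -normrN ler_norm.
  have : `|l| * t <= (`|l| + 1) * rho.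
    by apply: ler_pM => //; [rewrite lerDl|exact: ltW (lt_le_trans tr rr)].
  by move: rk; rewrite ltr_pdivlMr // mulrC; lra.
have pk : 0 < pi * rho ^+ 2 * k by rewrite !mulr_gt0 // pi_gt0.
have lb : ((pi * k * rho ^+ 2 + pi * l * (rho ^+ 2) ^+ 2 / 2)%R%:E <=
    disc_integral a rho (sec_sqnorm H s))%E.
  have LB c : 0 < c -> c < rho ^+ 2 ->
      ((pi * k * c + pi * l / 2 * c ^+ 2)%R%:E <= disc_integral a rho (sec_sqnorm H s))%E.
    move=> c0 cr; have := disc_integral_ge rho0 c0 cr hw wa kl S0 SG.
    by rewrite [pi * l * c ^+ 2 / 2]mulrAC.
  rewrite [pi * l * _ / 2]mulrAC.
  move: LB; case: (disc_integral a rho (sec_sqnorm H s)) => [I|_|LB].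
  - move=> LB; rewrite lee_fin; apply: le_quadratic_limit; first exact: exprn_gt0.
    by move=> c c0 cr; have := LB c c0 cr; rewrite lee_fin.
  - exact: leey.
  - by have := LB (rho ^+ 2 / 2) ltac:(by rewrite divr_gt0) ltac:(lra).
(* Normalisation by pi rho^2 k: the 2 is left by the mean rho^2 / 2 of |z - a|^2 over the disc. *)
have -> : 1 + l * rho ^+ 2 / (2 * k) =
    (pi * k * rho ^+ 2 + pi * l * (rho ^+ 2) ^+ 2 / 2) * (pi * rho ^+ 2 * k)^-1.
  by apply: quadratic_quotient; rewrite lt0r_neq0 // pi_gt0.
rewrite EFinM; apply: lee_wpmul2r; last exact: lb.
by rewrite lee_fin invr_ge0 ltW.
Qed.

End ExtensionIndex.

(** Replaces the exponential upper bound by a rational one, after which the comparison with the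
    lower bound is polynomial. *)
Lemma le_expR_inv (R : realType) (x : R) : 0 < 1 + x -> expR (- x) <= (1 + x)^-1.
Proof.
move=> x0; rewrite expRN lef_pV2 ?posrE ?expR_gt0 //.
exact: expR_ge1Dx.
Qed.

Theorem theorem1p4 (R : realType) (Om : set R[i]) (r : nat)
  (E : holo_bundle Om r) (H : hb_idx E -> R[i] -> 'M[R[i]]_r) :
  bounded_domain Om ->
  herm_metric H ->
  (forall a, Om a -> exists (gamma : R) (g : R -> R),
     [/\ 0 < gamma, gamma < bdist Om a, lsc_on_interval gamma g,
         (forall x, 0 <= x <= gamma -> 0 <= g x) &
         forall (xi : 'cV[R[i]]_r) (rho : R), xi != 0 -> 0 < rho -> rho < gamma ->
           (L2ext_index H a rho xi <= (expR (- (g rho * rho ^+ 2)))%:E)%E]) ->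
  forall (a : R[i]) (gamma : R) (g : R -> R), Om a ->
     0 < gamma -> gamma < bdist Om a -> lsc_on_interval gamma g ->
     (forall x, 0 <= x <= gamma -> 0 <= g x) ->
     (forall (xi : 'cV[R[i]]_r) (rho : R), xi != 0 -> 0 < rho -> rho < gamma ->
        (L2ext_index H a rho xi <= (expR (- (g rho * rho ^+ 2)))%:E)%E) ->
  forall xi : 'cV[R[i]]_r,
    (2 * g 0)%:C * hinner H a xi xi
      <= hinner H a (chern_curv H (hb_sel E a) a *m xi) xi.
Proof.
move=> _ hH _ a gamma g Oma gamma0 _ lsc _ Lg xi.
(* The index divides by the squared norm of xi, so the zero vector is treated apart. *)
have [->|xi0] := eqVneq xi 0.
  by rewrite /hinner !mulmx0 !mxE mulr0.
rewrite (hinner_fiber_sqnorm hH Oma xi0) (hinner_chern_curv hH xi Oma).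
rewrite -(rmorphM (real_complex R)) lecR.
have k0 := fiber_sqnorm_gt0 hH Oma xi0; set k := fiber_sqnorm _ _ _ in k0 *.
set d := chern_defect _ _ _.
suff main (eps : R) : 0 < eps -> (d - eps) / (2 * k) + (g 0 - eps) <= 0.
  rewrite leNgt; apply/negP => h.
  (* Multiplied by 2 k, [main] reads d + 2 g(0) k <= eps (1 + 2 k); this [eps] makes the right-hand
     side half of a positive left-hand side. *)
  pose eps := (d + 2 * g 0 * k) / (2 * (1 + 2 * k)).
  have K1 : 0 < 1 + 2 * k by lra.
  have eps0 : 0 < eps by rewrite divr_gt0 // ?mulr_gt0 //; lra.
  have epsE : eps * (1 + 2 * k) = (d + 2 * g 0 * k) / 2.
    by rewrite /eps; field; rewrite gt_eqF.
  have := main eps eps0; rewrite -(pmulr_rle0 _ (_ : 0 < 2 * k)); last by lra.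
  rewrite mulrDr [2 * k * (_ / _)]mulrC divfK ?gt_eqF //; last by lra.
  by move: epsE; nra.
move=> eps0; have [d1 [d10 HL]] := L2ext_index_ge hH Oma xi0 eps0.
have [d2 [d20 Hg]] := lsc 0 ltac:(by rewrite lexx ltW) eps eps0.
set La := (d - eps) / (2 * k); set G := g 0 - eps.
rewrite leNgt; apply/negP => LG.
(* A single small radius gives the contradiction: rho^2 B < q <= 1 keeps 1 + G rho^2 positive, and
   rho^2 B < q <= La + G makes the cross term rho^2 La G too small to change the sign of La + G. *)
pose B := `|G| + `|La * G| + 1.
have B0 : 0 < B by rewrite /B ltr_wpDl // addr_ge0.
pose q := Num.min 1 (La + G).
have q0 : 0 < q by rewrite lt_min ltr01.
pose m := Num.min (Num.min d1 d2) (Num.min gamma (Num.min 1 (q / B))).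
have m0 : 0 < m by rewrite !lt_min d10 d20 gamma0 ltr01 divr_gt0.
pose rho := m / 2.
have rho0 : 0 < rho by rewrite divr_gt0.
have : rho < m by rewrite /rho; lra.
rewrite !lt_min => /andP[/andP[r1 r2] /andP[r3 /andP[r4 r5]]].
have rB : rho ^+ 2 * B < q.
  move: r5; rewrite ltr_pdivlMr //; apply: le_lt_trans.
  by apply: ler_wpM2r; [exact: ltW|rewrite expr2 ler_piMl // ltW].
have rho2 : 0 < rho ^+ 2 by rewrite exprn_gt0.
have bG : rho ^+ 2 * `|G| < q.
  apply: le_lt_trans rB; apply: ler_wpM2l; first exact: ltW.
  by rewrite /B -addrA lerDl addr_ge0.
have bLG : rho ^+ 2 * `|La * G| < q.
  apply: le_lt_trans rB; apply: ler_wpM2l; first exact: ltW.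
  by rewrite /B addrAC lerDr addr_ge0.
have q1 : q <= 1 by rewrite ge_min lexx.
have qLG : q <= La + G by rewrite ge_min lexx orbT.
have nG : - `|G| <= G by rewrite lerNl -normrN ler_norm.
have nLG : - `|La * G| <= La * G by rewrite lerNl -normrN ler_norm.
have G1 : 0 < 1 + G * rho ^+ 2.
  have : - (rho ^+ 2 * `|G|) <= rho ^+ 2 * G by rewrite -mulrN ler_pM2l.
  by rewrite [G * _]mulrC; lra.
(* Lower semi-continuity at 0: g(rho) exceeds G = g(0) - eps. *)
have gG : G * rho ^+ 2 <= g rho * rho ^+ 2.
  apply: ler_wpM2r; first exact: ltW.
  apply/ltW/Hg; first by rewrite !ltW.
  by rewrite subr0 gtr0_norm.
have := le_trans (HL rho rho0 r1) (Lg xi rho xi0 rho0 r3).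
rewrite lee_fin => h1.
have h2 : 1 + La * rho ^+ 2 <= (1 + G * rho ^+ 2)^-1.
  apply: le_trans (le_expR_inv G1).
  apply: (@le_trans _ _ (expR (- (g rho * rho ^+ 2)))).
    by apply: le_trans h1; rewrite /La mulrAC.
  by rewrite ler_expR lerN2.
have h3 : (1 + La * rho ^+ 2) * (1 + G * rho ^+ 2) <= 1.
  by rewrite -ler_pdivlMr // mul1r.
have h4 : rho ^+ 2 * (La + G + rho ^+ 2 * (La * G)) <= 0.
  have -> : rho ^+ 2 * (La + G + rho ^+ 2 * (La * G)) =
    (1 + La * rho ^+ 2) * (1 + G * rho ^+ 2) - 1 by ring.
  lra.
have h5 : 0 < La + G + rho ^+ 2 * (La * G).
  have : - (rho ^+ 2 * `|La * G|) <= rho ^+ 2 * (La * G) by rewrite -mulrN ler_pM2l.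
  lra.
by have := mulr_gt0 rho2 h5; rewrite ltNge h4.
Qed.
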